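(* For each integer $k\geq 1$ let $\mathrm{SB}^k$ denote the $k$-bladed saw blade complex, i.e., the $2$-dimensional CW complex obtained from a polygonal disk with $3k$ boundary edges, labeled and oriented in cyclic order as $$a_1,\,a_1^{-1},\,a_1,\;a_2,\,a_2^{-1},\,a_2,\;\dots,\;a_k,\,a_k^{-1},\,a_k,$$ by identifying, for each $i=1,\dots,k$, the three edges $a_i,a_i^{-1},a_i$ with each other according to their orientations. Then the following hold. (i) The dunce hat $\mathrm{SB}^1$ can be triangulated with $8$ vertices. (ii) $\mathrm{SB}^2$ can be triangulated with $9$ vertices. (iii) For every $k\geq 3$, $\mathrm{SB}^k$ can be triangulated with $3k$ vertices. (iv) For every $k\geq 1$, any triangulation of $\mathrm{SB}^k$ is contractible, but non-collapsible.
   Context: Labeling and orientation: traversing the boundary of the polygonal disk once in a fixed direction, one meets the $3k$ edges in the listed order; an edge written $a_i$ is oriented along the direction of traversal and an edge written $a_i^{-1}$ is oriented against it. All edges carrying the same letter $a_i$ are identified by orientation-preserving (affine) homeomorphisms. The resulting CW complex $\mathrm{SB}^k$ has $k$ vertices, $k$ edges and a single $2$-cell. For $k=1$ one obtains the dunce hat: a triangle whose three edges are identified in the order $a_1,a_1^{-1},a_1$. A triangulation of a topological space $X$ is a finite abstract simplicial complex whose geometric realization is homeomorphic to $X$; ''$X$ can be triangulated with $n$ vertices'' means that there is a triangulation of $X$ with exactly $n$ vertices. In a finite simplicial complex $K$, a free face is an $(i-1)$-dimensional face that is contained in exactly one $i$-face of $K$, where that $i$-face is the only face of $K$ properly containing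 it. An elementary collapse removes a free face together with the unique face properly containing it. $K$ is collapsible if it can be reduced to a single vertex by a finite sequence of elementary collapses, and non-collapsible otherwise. *)

(* Defs.v *)
From HB Require Import structures.
From mathcomp Require Import all_boot all_order all_algebra generic_quotient.
From mathcomp Require Import all_classical all_reals all_analysis.
From Stdlib Require Import Relation_Operators.

Set Implicit Arguments.
Unset Strict Implicit.
Unset Printing Implicit Defensive.

Import Order.TTheory GRing.Theory Num.Theory.
Import numFieldNormedType.Exports.

Local Open Scope classical_set_scope.
Local Open Scope ring_scope.

Section Topology.

Definition homeomorphic (X Y : topologicalType) : Prop :=
  exists (f : X -> Y) (g : Y -> X),
    [/\ cancel f g, cancel g f, continuous f & continuous g].

Definition contractible (R : realType) (X : topologicalType) : Prop :=
  exists (x0 : X) (H : R * X -> X),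
    [/\ {within `[0, 1] `*` [set: X], continuous H},
        forall x, H (0, x) = x & forall x, H (1, x) = x0].

End Topology.

Section SimplicialComplexes.
Variable V : finType.
Implicit Types K L : {set {set V}}.

(* The empty simplex is not counted as a face. *)
Definition simplicial_complex K : Prop :=
  (finset.set0 \notin K) /\
  (forall s t : {set V},
     s \in K -> t != finset.set0 -> t \subset s -> t \in K).

(* Elements of V that do not occur in K are not vertices of K. *)
Definition vertices K : {set V} := [set v : V | [set v]%SET \in K]%SET.

Definition free_face K (s t : {set V}) : bool :=
  [&& s \in K, t \in K, s \proper t, #|t| == #|s|.+1
    & [forall u in K, (s \proper u) ==> (u == t)]].

Definition elementary_collapse : rel {set {set V}} := fun K L =>
  [exists s : {set V}, exists t : {set V},
     free_face K s t && (L == K :\: [set s; t])%SET].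

Definition collapsible K : bool :=
  [exists v : V, connect elementary_collapse K [set [set v]]%SET].

(* Barycentric coordinates; for the finite type V the topology of pointwise
   convergence is the Euclidean one. *)
Definition barycentric_points (R : realType) K : set {ptws V -> R} :=
  [set x | [/\ forall v, 0 <= x v, \sum_v x v = 1
             & [set v | x v != 0]%SET \in K]].

Definition realization (R : realType) K : topologicalType :=
  set_type (@barycentric_points R K).

Definition triangulates (R : realType) K (X : topologicalType) : Prop :=
  simplicial_complex K /\ homeomorphic (realization R K) X.

End SimplicialComplexes.

Definition triangulable_with (R : realType) (X : topologicalType) (n : nat) :
    Prop :=
  exists (V : finType) (K : {set {set V}}),
    triangulates R K X /\ #|vertices K| = n.

Section PolygonalComplexes.
Variable R : realType.

Definition polygon_vertex (n j : nat) : R^o * R^o :=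
  (cos (2 * pi * j%:R / n%:R), sin (2 * pi * j%:R / n%:R)).

Definition polygon (n : nat) : set (R^o * R^o) :=
  [set x | exists c : 'I_n -> R,
     [/\ forall j, 0 <= c j, \sum_j c j = 1
       & x = \sum_j c j *: polygon_vertex n j]].

(* The j-th edge, parametrized by [0, 1] in the direction of traversal. *)
Definition polygon_edge (n j : nat) (t : R) : R^o * R^o :=
  (1 - t) *: polygon_vertex n j + t *: polygon_vertex n j.+1.

(* A boundary word lists the edges in cyclic order: (i, true) stands for the
   letter a_i and (i, false) for its inverse. *)
Variable w : seq (nat * bool).

Definition letter (j : nat) : nat := (nth (0%N, true) w j).1.
Definition forward (j : nat) : bool := (nth (0%N, true) w j).2.

(* The j-th edge, parametrized in the direction of its letter. *)
Definition oriented_edge (j : nat) (t : R) : R^o * R^o :=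
  polygon_edge (size w) j (if forward j then t else 1 - t).

Definition disk : Type := set_type (polygon (size w)).
HB.instance Definition _ := Topological.on disk.

Definition glued (x y : disk) : Prop :=
  exists (i j : 'I_(size w)) (t : R),
    [/\ letter i = letter j, t \in `[0, 1],
        set_val x = oriented_edge i t & set_val y = oriented_edge j t].

Definition glue_rel : rel disk :=
  fun x y => `[< clos_refl_sym_trans disk glued x y >].

Lemma glue_rel_refl : reflexive glue_rel.
Proof. by move=> x; apply/asboolP; exact: rst_refl. Qed.

Lemma glue_rel_sym : symmetric glue_rel.
Proof.
by move=> x y; apply/idP/idP => /asboolP h; apply/asboolP; exact: rst_sym.
Qed.

Lemma glue_rel_trans : transitive glue_rel.
Proof.
move=> y x z /asboolP xy /asboolP yz; apply/asboolP; exact: rst_trans xy yz.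
Qed.

Definition glue_equiv : equiv_rel disk :=
  EquivRel glue_rel glue_rel_refl glue_rel_sym glue_rel_trans.

Definition polygon_quotient : topologicalType :=
  quotient_topology {eq_quot glue_equiv}%qT.

End PolygonalComplexes.

(* The word a_0 a_0^-1 a_0 a_1 a_1^-1 a_1 ... (letters numbered from 0). *)
Definition saw_blade_word (k : nat) : seq (nat * bool) :=
  [seq (i, b) | i <- iota 0 k, b <- [:: true; false; true]].

Definition saw_blade (R : realType) (k : nat) : topologicalType :=
  polygon_quotient R (saw_blade_word k).

(* Main.v *)
(* Points of the polygon are written in polar form, the parameter on the
   boundary being the perimeter; the gluing identifies the boundary points with
   the same [position] on a circle of length [k].

   Triangulations: bistellar moves turn the fan over the subdivided boundary
   into a triangulation of the disk in which the star of every interior vertex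
   meets every vertex of the glued boundary at most once; it then descends to a
   triangulation of the quotient.

   Contractibility: the path a a^-1 a is homotopic to a, so the attaching loop
   can be straightened.

   Non-collapsibility: the barycenter of a free face can be avoided by self-maps
   supported in arbitrarily small neighbourhoods.  No point of the saw blade
   complex has this property: near an interior point, respectively on two or
   three of the half-disks meeting along the edge, such a map would yield a
   nowhere zero map of a square into the plane that a Sperner-type parity count
   of its sign changes on the boundary excludes. *)
From HB Require Import structures.
Require Import Defs.
From mathcomp Require Import all_boot all_order all_algebra generic_quotient.
From mathcomp Require Import all_classical all_reals all_analysis.
From mathcomp Require Import ring lra zify.
From Stdlib Require Import Relation_Operators.

Set Implicit Arguments.
Unset Strict Implicit.
Unset Printing Implicit Defensive.

Import Order.TTheory GRing.Theory Num.Theory.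
Import numFieldNormedType.Exports.

Local Open Scope classical_set_scope.
Local Open Scope ring_scope.

(** * Topology *)

Lemma compact_quotient_continuous (T Y Z : topologicalType) (A : set T)
    (f : T -> Y) (g : Y -> Z) :
  compact A -> hausdorff_space Y -> {within A, continuous f} ->
  {within A, continuous (g \o f)} -> {within f @` A, continuous g}.
Proof.
move=> cA hY cf cgf; apply/continuous_closedP => C cC.
have /closed_subspaceP[B cB BA] : closed ((g \o f) @^-1` C : set (subspace A)).
  by move/continuous_closedP : cgf; exact.
apply/closed_subspaceP; exists (f @` (B `&` A)).
  apply: compact_closed => //; apply: continuous_compact.
    exact: (continuous_subspaceW (@subIsetr _ _ _) cf).
  by rewrite setIC; apply: compact_closedI.
rewrite BA; apply/seteqP; split => y /=.
  by move=> [[x [Cx Ax] <-] _]; split => //; exists x.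
by move=> [Cy [x Ax xy]]; split; exists x => //; split => //; rewrite /= xy.
Qed.

Lemma compact_quotient_continuousT (T Y Z : topologicalType) (A : set T)
    (f : T -> Y) (g : Y -> Z) :
  compact A -> hausdorff_space Y -> {within A, continuous f} ->
  {within A, continuous (g \o f)} -> f @` A = setT -> continuous g.
Proof.
move=> cA hY cf cgf fA; apply/continuous_subspace_setT; rewrite -fA.
exact: compact_quotient_continuous.
Qed.

Lemma homeomorphic_sym (X Y : topologicalType) :
  homeomorphic X Y -> homeomorphic Y X.
Proof. by move=> [f [g [? ? ? ?]]]; exists g, f. Qed.

Lemma compact_bijection_homeomorphic (X Y : topologicalType) (f : X -> Y) :
  compact [set: X] -> hausdorff_space Y -> continuous f ->
  injective f -> (forall y, exists x, f x = y) -> homeomorphic X Y.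
Proof.
move=> cX hY cf fI fS.
have [g gP] := @choice _ _ (fun y x => f x = y) fS.
have fK : cancel f g by move=> x; apply: fI; exact: gP.
exists f, g; split => //.
apply: (@compact_quotient_continuousT _ _ _ setT f) => //.
- exact: continuous_subspaceT.
- have -> : g \o f = id by apply/funext.
  by apply: continuous_subspaceT => x; exact: cvg_id.
- by apply/seteqP; split => // y _; have [x <-] := fS y; exists x.
Qed.

Lemma homeomorphic_hausdorff (X Y : topologicalType) :
  homeomorphic X Y -> hausdorff_space X -> hausdorff_space Y.
Proof.
move=> [f [g [fK gK cf cg]]] hX p q pq; apply: (can_inj gK); apply: hX => A B.
move=> /cg pA /cg qB; have [y [/= Ay By]] := pq _ _ pA qB.
by exists (g y).
Qed.

Lemma homeomorphic_contractible (R : realType) (X Y : topologicalType) :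
  homeomorphic X Y -> contractible R X -> contractible R Y.
Proof.
move=> [f [g [fK gK cf cg]]] [x0 [H [cH H0 H1]]].
exists (f x0), (fun p => f (H (p.1, g p.2))); split; last 2 first.
- by move=> y; rewrite H0 gK.
- by move=> y; rewrite H1.
apply/subspace_continuousP => -[t y] [t01 _]; apply: (@cvg_comp _ _ _ (fun p => H (p.1, g p.2)) f _ _ _ _ (cf _)).
move/subspace_continuousP : cH => /(_ (t, g y) (conj t01 I)) cH.
move=> B /cH [[U1 U2] /= [tU1 yU2] UB].
exists (U1, g @^-1` U2) => /=; first by split => //; exact: cg.
by move=> [t' y'] [/= ? ?] [? _]; apply: (UB (t', g y')).
Qed.

Lemma realization_hausdorff (R : realType) (V : finType) (K : {set {set V}}) :
  hausdorff_space (realization R K).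
Proof.
move=> p q pq; apply: val_inj => /=.
have hP : hausdorff_space {ptws V -> R}.
  by apply: hausdorff_product => _; exact: Rhausdorff.
apply: hP => A B pA qB.
have c : continuous (set_val : realization R K -> {ptws V -> R}).
  exact: initial_continuous.
have [y [/= Ay By]] := pq _ _ (c p _ pA) (c q _ qB).
by exists (val y).
Qed.

Definition labile (X : topologicalType) (p : X) : Prop :=
  forall U : set X, nbhs p U ->
  exists f : X -> X, [/\ continuous f, forall x, ~ U x -> f x = x,
    forall x, U x -> U (f x) & forall x, f x <> p].

Lemma homeomorphic_labile (X Y : topologicalType) :
  homeomorphic X Y -> (exists p : X, labile p) -> exists q : Y, labile q.
Proof.
move=> [f [g [fK gK cf cg]]] [p lp]; exists (f p) => U.
move=> /cf /lp[F [cF F1 F2 F3]].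
exists (f \o F \o g); split.
- move=> y; apply: (continuous_comp (cg y)).
  by apply: (continuous_comp (cF _)); exact: cf.
- by move=> y Uy /=; rewrite F1 ?gK //= gK.
- by move=> y Uy /=; apply: F2; rewrite /= gK.
- by move=> y /(congr1 g) /=; rewrite !fK; exact: F3.
Qed.

Lemma ptws_continuous (T : topologicalType) (V : Type) (R : realType)
    (f : T -> {ptws V -> R}) :
  (forall v, continuous (fun x => f x v : R)) -> continuous f.
Proof.
move=> cf x; apply/cvg_sup => v B [] /= C [[D oD <-] Dx] CB.
rewrite nbhs_simpl; apply: (filterS CB) => //.
by apply: (cf v); exact: open_nbhs_nbhs.
Qed.

Lemma ptws_eval_continuous (V : eqType) (R : realType) (v : V) :
  continuous (fun x : {ptws V -> R} => x v).
Proof. exact: (@proj_continuous V (fun=> R) v). Qed.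

Lemma set_type_continuous (T U : topologicalType) (A : set U)
    (f : T -> set_type A) :
  continuous (set_val \o f : T -> U) -> continuous f.
Proof. by move=> cf x; apply: continuous_comp_initial. Qed.

Lemma set_val_continuous (U : topologicalType) (A : set U) :
  continuous (set_val : set_type A -> U).
Proof. exact: initial_continuous. Qed.

Section RealFunctions.
Context {R : realType} {T : topologicalType}.
Implicit Types f g : T -> R.

Lemma ctsD f g :
  continuous f -> continuous g -> continuous (fun x => f x + g x).
Proof. by move=> cf cg x; apply: cvgD; [exact: cf|exact: cg]. Qed.

Lemma ctsN f : continuous f -> continuous (fun x => - f x).
Proof. by move=> cf x; apply: cvgN; exact: cf. Qed.

Lemma ctsM f g :
  continuous f -> continuous g -> continuous (fun x => f x * g x).
Proof. by move=> cf cg x; apply: cvgM; [exact: cf|exact: cg]. Qed.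

Lemma cts_norm f : continuous f -> continuous (fun x => `|f x|).
Proof. by move=> cf x; apply: cvg_norm; exact: cf. Qed.

Lemma cts_cst (c : R) : continuous (fun _ : T => c).
Proof. by move=> x; exact: cvg_cst. Qed.

Lemma cts_max f g :
  continuous f -> continuous g -> continuous (fun x => Num.max (f x) (g x)).
Proof.
move=> cf cg; rewrite (_ : (fun x => _) =
    fun x => (f x + g x + `|f x - g x|) / 2); last first.
  by apply/funext => x; rewrite maxr_absE.
by apply: ctsM; [apply: ctsD; [exact: ctsD|
  apply: cts_norm; apply: ctsD => //; exact: ctsN]|exact: cts_cst].
Qed.

Lemma cts_min f g :
  continuous f -> continuous g -> continuous (fun x => Num.min (f x) (g x)).
Proof.
move=> cf cg; rewrite (_ : (fun x => _) =
    fun x => (f x + g x - `|f x - g x|) / 2); last first.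
  by apply/funext => x; rewrite minr_absE.
by apply: ctsM; [apply: ctsD; [exact: ctsD|
  apply: ctsN; apply: cts_norm; apply: ctsD => //; exact: ctsN]|exact: cts_cst].
Qed.

Lemma cts_sum (I : Type) (r : seq I) (P : pred I) (F : I -> T -> R) :
  (forall i, continuous (F i)) ->
  continuous (fun x => \sum_(i <- r | P i) F i x).
Proof.
move=> cF; elim: r => [|i r IH].
  by under eq_fun do rewrite big_nil; exact: cts_cst.
under eq_fun do rewrite big_cons.
by case: (P i) => //; exact: ctsD.
Qed.

Lemma cts_cos f : continuous f -> continuous (fun x => cos (f x)).
Proof.
by move=> cf x; apply: (continuous_comp (cf x)); exact: continuous_cos.
Qed.

Lemma cts_sin f : continuous f -> continuous (fun x => sin (f x)).
Proof.
by move=> cf x; apply: (continuous_comp (cf x)); exact: continuous_sin.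
Qed.

End RealFunctions.

Lemma cts_fst (T U V : topologicalType) (f : T -> U * V) :
  continuous f -> continuous (fun x => (f x).1).
Proof. by move=> cf x; apply: (continuous_comp (cf x)); exact: cvg_fst. Qed.

Lemma cts_snd (T U V : topologicalType) (f : T -> U * V) :
  continuous f -> continuous (fun x => (f x).2).
Proof. by move=> cf x; apply: (continuous_comp (cf x)); exact: cvg_snd. Qed.

Lemma cts_pair (T U V : topologicalType) (f : T -> U) (g : T -> V) :
  continuous f -> continuous g -> continuous (fun x => (f x, g x)).
Proof. by move=> cf cg x; apply: cvg_pair; [exact: cf|exact: cg]. Qed.

Lemma cts_id (T : topologicalType) : continuous (fun x : T => x).
Proof. by move=> x; exact: cvg_id. Qed.

Lemma cts_comp (T U V : topologicalType) (f : T -> U) (g : U -> V) :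
  continuous g -> continuous f -> continuous (fun x => g (f x)).
Proof. by move=> cg cf x; apply: (continuous_comp (cf x)); exact: cg. Qed.

Ltac cts_step := lazymatch goal with
  | |- continuous ?f => lazymatch f with
    | fun _ => ?c => apply: cts_cst
    | fun x => x => apply: cts_id
    | fst => exact: (cts_fst (@cts_id _))
    | snd => exact: (cts_snd (@cts_id _))
    | fun x => (@?f1 x + @?f2 x)%R => apply: ctsD
    | fun x => (- (@?f1 x))%R => apply: ctsN
    | fun x => (@?f1 x * @?f2 x)%R => apply: ctsM
    | fun x => `|@?f1 x|%R => apply: cts_norm
    | fun x => Num.max (@?f1 x) (@?f2 x) => apply: cts_max
    | fun x => Num.min (@?f1 x) (@?f2 x) => apply: cts_min
    | fun x => cos (@?f1 x) => apply: cts_cos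
    | fun x => sin (@?f1 x) => apply: cts_sin
    | fun x => (@?f1 x, @?f2 x) => apply: cts_pair
    | fun x => (@?f1 x).1 => first [assumption | apply: cts_fst]
    | fun x => (@?f1 x).2 => first [assumption | apply: cts_snd]
    | fun x => \sum_(i <- @?r x | @?P x i) @?F x i => apply: cts_sum => ?
    | _ => first [assumption | apply: cts_min | apply: cts_max | apply: ctsM
        | apply: ctsD | apply: ctsN | apply: cts_norm ]
    end
  end.
Ltac cts := repeat cts_step.

Lemma hausdorff_prod (T U : topologicalType) :
  hausdorff_space T -> hausdorff_space U -> hausdorff_space (T * U)%type.
Proof.
move=> hT hU [a b] [c d] abcd; congr (_, _).
- apply: hT => A B aA cB.
  have nfst (x : T) (y : U) (C : set T) : nbhs x C -> nbhs (x, y) (fst @^-1` C).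
    move=> xC; exists (C, setT) => /=; first by split => //; exact: filterT.
    by move=> [? ?] [].
  have [[x y] [/= Ax Bx]] := abcd _ _ (nfst _ _ _ aA) (nfst _ _ _ cB).
  by exists x.
- apply: hU => A B bA dB.
  have nsnd (x : T) (y : U) (C : set U) : nbhs y C -> nbhs (x, y) (snd @^-1` C).
    move=> yC; exists (setT, C) => /=; first by split => //; exact: filterT.
    by move=> [? ?] [].
  have [[x y] [/= Ay By]] := abcd _ _ (nsnd _ _ _ bA) (nsnd _ _ _ dB).
  by exists y.
Qed.

Lemma continuous_paste (R : realType) (T U : topologicalType) (f g : T -> U)
    (a b : T -> R) : continuous f -> continuous g ->
  continuous a -> continuous b -> (forall x, a x = b x -> f x = g x) ->
  continuous (fun x => if a x <= b x then f x else g x).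
Proof.
move=> cf cg ca cb fg.
have cl (c d : T -> R) : continuous c -> continuous d ->
    closed [set x | c x <= d x].
  move=> cc cd; rewrite (_ : [set x | _] = (fun x => d x + - c x) @^-1` `[0, +oo[).
    have cdc : continuous (fun x => d x + - c x) by cts.
    by apply: closed_comp => [x _|]; [exact: cdc|exact: rray_closed].
  by apply/seteqP; split => x; rewrite /= in_itv /= andbT subr_ge0.
apply/continuous_subspace_setT.
rewrite (_ : setT = [set x | a x <= b x] `|` [set x | b x <= a x]); last first.
  by apply/seteqP; split => // x _; case/orP: (le_total (a x) (b x)); [left|right].
apply: withinU_continuous; [exact: cl|exact: cl| |].
- apply: (@subspace_eq_continuous _ _ _ f); last exact: continuous_subspaceT.
  by move=> x; rewrite inE /= /from_subspace => ab; rewrite ab.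
- apply: (@subspace_eq_continuous _ _ _ g); last exact: continuous_subspaceT.
  move=> x; rewrite inE /= /from_subspace => ba; case: ifPn => // ab; apply/esym/fg.
  by apply/eqP; rewrite eq_le ab ba.
Qed.

Lemma continuous_comp_within (S T U : topologicalType) (A : set T) (c : S -> T)
    (f : T -> U) :
  {within A, continuous f} -> continuous c -> (forall x, A (c x)) ->
  continuous (fun x => f (c x)).
Proof.
move=> /subspace_continuousP cf cc cA x B /(cf _ (cA x)) /= BA.
have {BA} : nbhs x (c @^-1` [set y | A y -> (f @^-1` B) y]) by exact: cc.
by apply: filterS => y /=; apply; exact: cA.
Qed.

Definition clamp (R : realType) (b x : R) : R := Num.max 0 (Num.min b x).

Lemma clamp_itv (R : realType) (b x : R) : 0 <= b -> 0 <= clamp b x <= b.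
Proof. by move=> b0; rewrite /clamp le_max lexx ge_max b0 ge_min lexx. Qed.

Lemma clamp_id (R : realType) (b x : R) : 0 <= x <= b -> clamp b x = x.
Proof. by move=> /andP[x0 xb]; rewrite /clamp min_r // max_r. Qed.

Lemma clamp_continuous (R : realType) (b : R) : continuous (clamp b).
Proof. by rewrite /clamp; cts. Qed.

(** * Piecewise linear interpolation *)

Section Interpolation.
Context {R : realType}.

Definition hat (x : R) : R := Num.max 0 (1 - `|x|).

Lemma hat_ge0 x : 0 <= hat x.
Proof. by rewrite /hat le_max lexx. Qed.

Lemma hat_out x : 1 <= `|x| -> hat x = 0.
Proof. by move=> x1; rewrite /hat max_l // subr_le0. Qed.

Definition interp (V : lmodType R) (n : nat) (a : nat -> V) (x : R) : V :=
  \sum_(i < n.+1) hat (x - i%:R) *: a i.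

Lemma interpE (V : lmodType R) (n : nat) (a : nat -> V) (j : nat) (t : R) :
  (j < n)%N -> 0 <= t <= 1 ->
  interp n a (j%:R + t) = (1 - t) *: a j + t *: a j.+1.
Proof.
move=> jn /andP[t0 t1]; rewrite /interp.
have j1 : (j < n.+1)%N by lia.
rewrite (bigD1 (Ordinal j1)) //= (bigD1 (Ordinal (jn : j.+1 < n.+1)%N)) /=; last first.
  by apply/eqP => /(congr1 val) /=; lia.
rewrite big1 ?addr0 => [|i /andP[ij ij1]].
  congr (_ *: _ + _ *: _).
    rewrite /hat (_ : j%:R + t - _ = t); last by ring.
    by rewrite ger0_norm // max_r // subr_ge0.
  rewrite /hat (_ : j%:R + t - _ = t - 1); last by rewrite /= -natr1; ring.
  by rewrite ler0_norm ?subr_le0 // max_r; lra.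
rewrite hat_out ?scale0r //.
have [ij'|ij'] : (i + 1 <= j)%N \/ (j + 2 <= i)%N.
  have : i != j :> nat by apply: contra ij => /eqP ij; apply/eqP/val_inj.
  have : i != j.+1 :> nat by apply: contra ij1 => /eqP ij1; apply/eqP/val_inj.
  lia.
- rewrite ger0_norm; move: ij'; rewrite -(ler_nat R) natrD; lra.
- rewrite ler0_norm; move: ij'; rewrite -(ler_nat R) natrD; lra.
Qed.

Lemma interp_nat (V : lmodType R) (n : nat) (a : nat -> V) (j : nat) :
  (j <= n)%N -> (0 < n)%N -> interp n a j%:R = a j.
Proof.
move=> jn n0; have [->|jn'] := eqVneq j n.
  case: n {jn} n0 => // n _.
  rewrite -natr1 interpE ?ltnSn ?ler01 ?lexx //.
  by rewrite subrr scale0r scale1r add0r.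
rewrite -[j%:R]addr0 interpE ?lexx ?ler01 //; last by lia.
by rewrite subr0 scale0r scale1r addr0.
Qed.

Lemma floor_split (n : nat) (x : R) : (0 < n)%N -> 0 <= x <= n%:R ->
  exists j t, [/\ (j < n)%N, 0 <= t <= 1 & x = j%:R + t].
Proof.
move=> n0 /andP[x0 xn]; have [xn'|xn'] := ltP x n%:R; last first.
  exists n.-1, 1; split; rewrite ?ler01 ?lexx //; first by lia.
  by rewrite natr1 prednK //; lra.
have /andP[t1 t2] := truncn_itv x0.
exists (Num.truncn x), (x - (Num.truncn x)%:R); split.
- by rewrite -(ltr_nat R); lra.
- by rewrite -natr1 in t2; lra.
- by lra.
Qed.

Lemma hat_continuous : continuous hat.
Proof. by rewrite /hat; cts. Qed.

Lemma interp_continuous (n : nat) (a : nat -> R^o) :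
  continuous (interp n a : R -> R).
Proof.
apply: cts_sum => i; apply: ctsM; last exact: cts_cst.
by apply: (cts_comp hat_continuous); cts.
Qed.

Lemma interp_continuous2 (n : nat) (a : nat -> R^o * R^o) :
  continuous (interp n a : R -> R^o * R^o).
Proof.
have -> : interp n a = fun x => (interp n (fst \o a) x, interp n (snd \o a) x).
  apply/funext => x; rewrite [LHS]surjective_pairing /interp.
  by rewrite (big_morph fst (fun _ _ => erefl) erefl)
    (big_morph snd (fun _ _ => erefl) erefl).
by apply: cts_pair; apply: interp_continuous.
Qed.

End Interpolation.

(** * The regular polygon *)

Section Polygon.
Context {R : realType} (n : nat).
Hypothesis n3 : (3 <= n)%N.

Local Notation v := (polygon_vertex R n).
Local Notation alpha := (pi / n%:R : R).

Let n0 : n%:R != 0 :> R.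
Proof. by rewrite pnatr_eq0; lia. Qed.

Lemma alpha_gt0 : 0 < alpha.
Proof. by rewrite divr_gt0 ?pi_gt0 // ltr0n; lia. Qed.

Lemma alphan : n%:R * alpha = pi.
Proof. by field. Qed.

Lemma alpha_le : 3 * alpha <= pi.
Proof.
by rewrite -[leRHS]alphan ler_pM2r ?alpha_gt0 // (ler_nat R 3).
Qed.

Lemma polygon_vertexE j :
  v j = (cos (2 * j%:R * alpha), sin (2 * j%:R * alpha)).
Proof. by rewrite /polygon_vertex; congr (cos _, sin _); field. Qed.

Lemma polygon_vertex_n : v n = v 0.
Proof.
rewrite !polygon_vertexE mulr0 mul0r -mulrA alphan cos0 sin0.
by rewrite mulr_natl cos2pi sin2pi.
Qed.

Lemma cos_le_sector (a y : R) : 0 <= a <= y -> y <= 2 * pi - a ->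
  cos y <= cos a.
Proof.
move=> /andP[a0 ay] ya; have [ypi|piy] := leP y pi.
  by rewrite leNgt ltr_cos ?in_itv /=; lra.
have -> : cos y = cos (2 * pi - y).
  by rewrite mulr_natl cosB cos2pi sin2pi mul0r mul1r addr0.
by rewrite leNgt ltr_cos ?in_itv /=; lra.
Qed.

Lemma cos_lt_sector (a y : R) : 0 <= a < y -> y < 2 * pi - a ->
  cos y < cos a.
Proof.
move=> /andP[a0 ay] ya; have [ypi|piy] := leP y pi.
  by rewrite ltr_cos ?in_itv /=; lra.
have -> : cos y = cos (2 * pi - y).
  by rewrite mulr_natl cosB cos2pi sin2pi mul0r mul1r addr0.
by rewrite ltr_cos ?in_itv /=; lra.
Qed.

Definition side_form (i : nat) (x : R^o * R^o) : R :=
  (cos ((2 * i%:R + 1) * alpha) * x.1 + sin ((2 * i%:R + 1) * alpha) * x.2)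
   / cos alpha.

Definition ray_form (j : nat) (x : R^o * R^o) : R :=
  cos (2 * j%:R * alpha) * x.2 - sin (2 * j%:R * alpha) * x.1.

Lemma cos_alpha_gt0 : 0 < cos alpha.
Proof.
have := alpha_le; have := alpha_gt0 => a0 a3.
by apply: cos_gt0_pihalf; lra.
Qed.

Lemma sin_alpha_gt0 : 0 < sin alpha.
Proof.
have := alpha_le; have := alpha_gt0 => a0 a3.
by apply: sin_gt0_pi; lra.
Qed.

Lemma sin_2alpha_gt0 : 0 < sin (2 * alpha).
Proof.
have := alpha_le; have := alpha_gt0 => a0 a3.
by apply: sin_gt0_pi; lra.
Qed.

Lemma side_formD i x y : side_form i (x + y) = side_form i x + side_form i y.
Proof. by rewrite /side_form /=; lra. Qed.

Lemma side_formZ i a x : side_form i (a *: x) = a * side_form i x.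
Proof. by rewrite /side_form /= /GRing.scale /=; ring. Qed.

Lemma ray_formD i x y : ray_form i (x + y) = ray_form i x + ray_form i y.
Proof. by rewrite /ray_form /=; lra. Qed.

Lemma ray_formZ i a x : ray_form i (a *: x) = a * ray_form i x.
Proof. by rewrite /ray_form /= /GRing.scale /=; ring. Qed.

Lemma side_form_vertexE i j :
  side_form i (v j) = cos ((2 * i%:R + 1 - 2 * j%:R) * alpha) / cos alpha.
Proof.
rewrite /side_form polygon_vertexE /=; congr (_ / _).
rewrite (_ : (_ - _) * _ = (2 * i%:R + 1) * alpha - 2 * j%:R * alpha).
  by rewrite cosB.
by ring.
Qed.

Lemma side_form_vertex_le1 i j : (i < n)%N -> (j <= n)%N ->
  side_form i (v j) <= 1.
Proof.
move=> i_n jn; have a0 := alpha_gt0.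
rewrite side_form_vertexE ler_pdivrMr ?cos_alpha_gt0 // mul1r.
have piE := alphan.
have i_n' : i%:R + 1 <= n%:R :> R by rewrite natr1 ler_nat.
have jn' : j%:R <= n%:R :> R by rewrite ler_nat.
have i0 : 0 <= i%:R :> R by [].
have j0 : 0 <= j%:R :> R by [].
have M x y : x <= y -> x * alpha <= y * alpha by rewrite ler_pM2r.
have [/(M _ _) ? /(M _ _) ?] := (i_n', jn').
have [/(M _ _) ? /(M _ _) ?] := (i0, j0).
have [ij|ij] := leqP j i.
  have /(M _ _) ij' : j%:R <= i%:R :> R by rewrite ler_nat.
  by apply: cos_le_sector; lra.
have /(M _ _) ij' : i%:R + 1 <= j%:R :> R by rewrite natr1 ler_nat.
by rewrite -cosN; apply: cos_le_sector; lra.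
Qed.

Lemma side_form_vertex_lt1 i j : (i < n)%N -> (j <= n)%N ->
  ~~ [|| j == i, j == i.+1, (i == 0%N) && (j == n) | (i == n.-1) && (j == 0%N)] ->
  side_form i (v j) < 1.
Proof.
move=> i_n jn ij; have a0 := alpha_gt0.
rewrite side_form_vertexE ltr_pdivrMr ?cos_alpha_gt0 // mul1r.
have piE := alphan.
have i0 : 0 <= i%:R :> R by [].
have j0 : 0 <= j%:R :> R by [].
have M x y : x <= y -> x * alpha <= y * alpha by rewrite ler_pM2r.
have [/(M _ _) ? /(M _ _) ?] := (i0, j0).
have [ji|ji] := leqP j i.
  have /(M _ _) ij1 : j%:R + 1 <= i%:R :> R by rewrite natr1 ler_nat; lia.
  have /(M _ _) ij2 : i%:R + 2 <= n%:R + j%:R :> R by rewrite -!natrD ler_nat; lia.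
  by apply: cos_lt_sector; lra.
have /(M _ _) ij1 : i%:R + 2 <= j%:R :> R by rewrite -natrD ler_nat; lia.
have /(M _ _) ij2 : j%:R + 1 <= n%:R + i%:R :> R by rewrite natr1 -!natrD ler_nat; lia.
by rewrite -cosN; apply: cos_lt_sector; lra.
Qed.

Lemma side_form_own i : side_form i (v i) = 1.
Proof.
rewrite side_form_vertexE (_ : _ - _ = 1) ?mul1r; last by ring.
by rewrite divff // gt_eqF // cos_alpha_gt0.
Qed.

Lemma side_form_ownS i : side_form i (v i.+1) = 1.
Proof.
rewrite side_form_vertexE (_ : _ - _ = -1); last by rewrite -natr1; ring.
by rewrite mulN1r cosN divff // gt_eqF // cos_alpha_gt0.
Qed.

Lemma ray_form_step i x : (side_form i.+1 x - side_form i x) * cos alpha =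
  2 * sin alpha * ray_form i.+1 x.
Proof.
rewrite /side_form /ray_form -mulrBl divfK ?gt_eqF ?cos_alpha_gt0 //.
rewrite (_ : (2 * i.+1%:R + 1) * alpha = 2 * i.+1%:R * alpha + alpha); last by ring.
rewrite (_ : (2 * i%:R + 1) * alpha = 2 * i.+1%:R * alpha - alpha); last first.
  by rewrite -natr1; ring.
by rewrite cosD cosB sinD sinB; ring.
Qed.

Lemma sector_decomposition i x :
  sin (2 * alpha) *: x = ray_form i x *: v i.+1 - ray_form i.+1 x *: v i.
Proof.
rewrite !polygon_vertexE /ray_form.
have -> : 2 * alpha = 2 * i.+1%:R * alpha - 2 * i%:R * alpha.
  by rewrite -natr1; ring.
rewrite sinB; case: x => x1 x2 /=.
by apply/pair_equal_spec; split; rewrite /= /GRing.scale /=; ring.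
Qed.

Lemma ray_form_own i : ray_form i (v i) = 0.
Proof. by rewrite /ray_form polygon_vertexE /=; ring. Qed.

Lemma ray_form_ownS i : ray_form i (v i.+1) = sin (2 * alpha).
Proof.
rewrite /ray_form polygon_vertexE /=.
have -> : 2 * alpha = 2 * i.+1%:R * alpha - 2 * i%:R * alpha.
  by rewrite -natr1; ring.
by rewrite sinB; ring.
Qed.

End Polygon.

Section EdgeCombinatorics.
Variables (n j l : nat).
Hypotheses (n3 : (3 <= n)%N) (jn : (j < n)%N) (ln : (l < n)%N) (jl : j != l).

Lemma edge_startsF :
  [\/ j = l, j = l.+1 | l = n.-1 /\ j = 0%N] ->
  [\/ l = j, l = j.+1 | j = n.-1 /\ l = 0%N] -> False.
Proof. by case=> [?|?|[? ?]] [?|?|[? ?]]; lia. Qed.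

Lemma edge_endsF :
  [\/ j.+1 = l, j = l | l = 0%N /\ j.+1 = n] ->
  [\/ l.+1 = j, l = j | j = 0%N /\ l.+1 = n] -> False.
Proof. by case=> [?|?|[? ?]] [?|?|[? ?]]; lia. Qed.

Lemma edge_interiorF :
  [\/ j.+1 = l, j = l | l = 0%N /\ j.+1 = n] ->
  [\/ j = l, j = l.+1 | l = n.-1 /\ j = 0%N] -> False.
Proof. by case=> [?|?|[? ?]] [?|?|[? ?]]; lia. Qed.

End EdgeCombinatorics.

Section PolygonPolar.
Context {R : realType} (n : nat).
Hypothesis n3 : (3 <= n)%N.

Local Notation v := (polygon_vertex R n).
Local Notation alpha := (pi / n%:R : R).
Local Notation P := (@polygon R n).

Let alpha_gt0 : 0 < alpha := alpha_gt0 n3.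
Let alphan : n%:R * alpha = pi := alphan n3.

Lemma ray_form_n x : @ray_form R n n x = ray_form n 0 x.
Proof.
rewrite /ray_form mulr0 mul0r -mulrA alphan cos0 sin0.
by rewrite mulr_natl cos2pi sin2pi.
Qed.

Lemma side_form_n x : @side_form R n n x = side_form n 0 x.
Proof.
rewrite /side_form mulr0 add0r mul1r.
have pi2 : pi *+ 2 = 2 * (n%:R * alpha) by rewrite alphan mulr_natl.
rewrite (_ : (_ + 1) * _ = alpha + pi *+ 2); last by rewrite pi2; ring.
by rewrite cosD2pi sinD2pi.
Qed.

Lemma sector_exists x : exists2 i, (i < n)%N &
  0 <= @ray_form R n i x /\ @ray_form R n i.+1 x <= 0.
Proof.
have n0 : (0 < n)%N by lia.
have c0 := @cos_alpha_gt0 R n n3; have s0 := @sin_alpha_gt0 R n n3.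
have stepS i : side_form n i.+1 x <= side_form n i x -> ray_form n i.+1 x <= 0.
  move=> h; rewrite -(pmulr_rle0 _ (_ : 0 < 2 * sin alpha)) ?mulr_gt0 //.
  by rewrite -ray_form_step // pmulr_lle0 // subr_le0.
have step i : side_form n i x <= side_form n i.+1 x -> 0 <= ray_form n i.+1 x.
  move=> h; rewrite -(pmulr_rge0 _ (_ : 0 < 2 * sin alpha)) ?mulr_gt0 //.
  by rewrite -ray_form_step // pmulr_lge0 // subr_ge0.
case: (@Order.TotalTheory.arg_maxP _ _ 'I_n (Ordinal n0) xpredT
  (fun i : 'I_n => side_form n i x) isT) => i _ imax.
exists i => //; split; last first.
  apply: stepS; have [iS|iS] := ltnP i.+1 n; first exact: (imax (Ordinal iS)).
  have -> : i.+1 = n by have := ltn_ord i; lia.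
  by rewrite side_form_n; exact: (imax (Ordinal n0)).
case: i imax => -[|i] ilt /= imax; last first.
  by apply: step; have ilt' : (i < n)%N by [lia]; exact: (imax (Ordinal ilt')).
rewrite -ray_form_n; have nS : n.-1.+1 = n by lia.
have := step n.-1; rewrite nS; apply; rewrite side_form_n.
by have ilt' : (n.-1 < n)%N by [lia]; exact: (imax (Ordinal ilt')).
Qed.

Lemma side_form_sum i (I : Type) (r : seq I) (F : I -> R^o * R^o) :
  side_form n i (\sum_(j <- r) F j) = \sum_(j <- r) side_form n i (F j).
Proof.
rewrite (big_morph (side_form n i) (side_formD n i) (_ : _ = 0)) //.
by rewrite /side_form /= !mulr0 addr0 mul0r.
Qed.

Lemma polygon_side_le1 x i : (i < n)%N -> P x -> side_form n i x <= 1.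
Proof.
move=> i_n [c [c0 c1 ->]]; rewrite side_form_sum -c1.
apply: ler_sum => j _; rewrite side_formZ ler_piMr //.
by apply: side_form_vertex_le1 => //; exact: ltnW.
Qed.

Lemma sum_polygon_vertex : \sum_(j < n) v j = 0.
Proof.
have s0 : 2 * sin alpha != 0 by rewrite mulf_neq0 // gt_eqF // sin_alpha_gt0.
pose g (j : nat) : R^o * R^o :=
  (sin ((2 * j%:R - 1) * alpha), - cos ((2 * j%:R - 1) * alpha)).
have E j : (2 * sin alpha) *: v j = g j.+1 - g j.
  rewrite /g polygon_vertexE //.
  have -> : (2 * j.+1%:R - 1) * alpha = 2 * j%:R * alpha + alpha.
    by rewrite -natr1; ring.
  have -> : (2 * j%:R - 1) * alpha = 2 * j%:R * alpha - alpha by ring.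
  rewrite sinD sinB cosD cosB.
  by apply/pair_equal_spec; split; rewrite /= /GRing.scale /=; ring.
apply: (scalerI s0); rewrite scaler0 scaler_sumr.
rewrite (eq_bigr (fun j : 'I_n => g j.+1 - g j)) => [|j _]; last exact: E.
rewrite -(big_mkord xpredT (fun j => g j.+1 - g j)) telescope_sumr //.
have pi2 : pi *+ 2 = 2 * (n%:R * alpha) by rewrite alphan mulr_natl.
have gn : (2 * n%:R - 1) * alpha = (2 * 0%:R - 1) * alpha + pi *+ 2.
  by rewrite pi2; ring.
by rewrite /g gn sinD2pi cosD2pi subrr.
Qed.

Lemma polygon_convex (x y : R^o * R^o) (t : R) : 0 <= t <= 1 -> P x -> P y ->
  P ((1 - t) *: x + t *: y).
Proof.
move=> /andP[t0 t1] [c [c0 c1 ->]] [d [d0 d1 ->]].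
exists (fun j => (1 - t) * c j + t * d j); split.
- by move=> j; rewrite addr_ge0 // mulr_ge0 // subr_ge0.
- by rewrite big_split -!mulr_sumr c1 d1 /= !mulr1 subrK.
- rewrite !scaler_sumr -big_split; apply: eq_bigr => j _ /=.
  by rewrite [RHS]scalerDl !scalerA.
Qed.

Lemma polygon0 : P 0.
Proof.
have n0 : n%:R != 0 :> R by rewrite pnatr_eq0; lia.
exists (fun=> n%:R^-1); split => [j||]; first by rewrite invr_ge0.
  by rewrite sumr_const card_ord -[_ *+ n]mulr_natl divff.
by rewrite -scaler_sumr sum_polygon_vertex scaler0.
Qed.

Lemma polygon_vertexP j : (j <= n)%N -> P (v j).
Proof.
wlog jn : j / (j < n)%N => [H|_].
  rewrite leq_eqVlt => /predU1P[->|jn]; last by apply: H => //; exact: ltnW.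
  by rewrite polygon_vertex_n //; apply: H; lia.
exists (fun i => (i == Ordinal jn)%:R); split => [i||]; first by case: (_ == _).
  by rewrite (bigD1 (Ordinal jn)) //= eqxx big1 ?addr0 // => i /negPf ->.
rewrite (bigD1 (Ordinal jn)) //= eqxx scale1r big1 ?addr0 // => i /negPf ->.
by rewrite scale0r.
Qed.

Definition boundary (x : R) : R^o * R^o := interp n v x.

Lemma boundaryE j t : (j < n)%N -> 0 <= t <= 1 ->
  boundary (j%:R + t) = polygon_edge n j t.
Proof. exact: interpE. Qed.

Lemma boundary_polygon x : 0 <= x <= n%:R -> P (boundary x).
Proof.
move=> /floor_split[|j [t [jn t01 ->]]]; first by lia.
by rewrite boundaryE //; apply: polygon_convex => //;
  apply: polygon_vertexP => //; exact: ltnW.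
Qed.

Lemma polar_polygon r x : 0 <= r <= 1 -> 0 <= x <= n%:R ->
  P (r *: boundary x).
Proof.
move=> r01 x0n; rewrite -[_ *: _]add0r -(scaler0 _ (1 - r)).
by apply: polygon_convex => //; [exact: polygon0|exact: boundary_polygon].
Qed.

Lemma sector_polar x : exists j r t,
  [/\ (j < n)%N, 0 <= t <= 1, x = r *: @polygon_edge R n j t,
   0 <= r & r = side_form n j x :> R].
Proof.
have [j jn [rj rj1]] := sector_exists x.
have s0 := @sin_2alpha_gt0 R n n3.
set s := sin (2 * alpha) in s0.
pose a := - ray_form n j.+1 x / s; pose b := ray_form n j x / s.
have a0 : 0 <= a by rewrite divr_ge0 ?oppr_ge0 // ltW.
have b0 : 0 <= b by rewrite divr_ge0 // ltW.
have xE : x = a *: v j + b *: v j.+1.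
  apply: (scalerI (lt0r_neq0 s0)); rewrite (sector_decomposition n3 j).
  rewrite scalerDr !scalerA /a /b ![s * (_ / s)]mulrC !divfK ?gt_eqF //.
  by rewrite scaleNr addrC.
have rE : a + b = side_form n j x.
  rewrite {1}xE side_formD !side_formZ side_form_own // side_form_ownS //.
  by rewrite !mulr1.
clearbody a b; exists j, (a + b).
have [ab0|ab0] := eqVneq (a + b) 0.
  have [a00 b00] : a = 0 /\ b = 0 by lra.
  exists 0; split => //; rewrite ?lexx ?ler01 // ?ab0 ?scale0r //.
  by rewrite xE a00 b00 !scale0r addr0.
have ab : 0 < a + b by rewrite lt_def ab0 addr_ge0.
exists (b / (a + b)); split => //; last exact: ltW.
  by rewrite divr_ge0 ?(ltW ab) //= ler_pdivrMr // mul1r lerDr.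
rewrite /polygon_edge scalerDr !scalerA xE; congr (_ *: _ + _ *: _); by field.
Qed.

Lemma polygon_sideP x : P x <-> forall i, (i < n)%N -> side_form n i x <= 1.
Proof.
split=> [Px i i_n|h]; first exact: polygon_side_le1.
have [j [r [t [jn t01 xE r0 rE]]]] := sector_polar x.
rewrite xE -boundaryE //; apply: polar_polygon; first by rewrite r0 rE h.
move/andP: t01 => [t0 t1]; rewrite addr_ge0 //=.
by rewrite (@le_trans _ _ (j%:R + 1)) ?lerD // natr1 ler_nat.
Qed.

Lemma polygon_polar x : P x -> exists r y,
  [/\ 0 <= r <= 1, 0 <= y <= n%:R & x = r *: boundary y].
Proof.
move=> Px; have [j [r [t [jn t01 xE r0 rE]]]] := sector_polar x.
exists r, (j%:R + t); split; last by rewrite boundaryE.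
  by rewrite r0 rE polygon_side_le1.
move/andP: t01 => [t0 t1]; rewrite addr_ge0 //=.
by rewrite (@le_trans _ _ (j%:R + 1)) ?lerD // natr1 ler_nat.
Qed.

Lemma side_form_boundary_le1 i x : (i < n)%N -> 0 <= x <= n%:R ->
  side_form n i (boundary x) <= 1.
Proof. by move=> i_n x0n; apply: polygon_side_le1 => //; exact: boundary_polygon. Qed.

Lemma side_form_edge j (t : R) : side_form n j (polygon_edge n j t) = 1.
Proof.
rewrite /polygon_edge side_formD !side_formZ side_form_own // side_form_ownS //.
by ring.
Qed.

Lemma edge_tight i j (t : R) : (i < n)%N -> (j < n)%N -> 0 <= t <= 1 ->
  side_form n i (polygon_edge n j t) = 1 ->
  (t < 1 -> [\/ j = i, j = i.+1 | i = n.-1 /\ j = 0%N]) /\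
  (0 < t -> [\/ j.+1 = i, j = i | i = 0%N /\ j.+1 = n]).
Proof.
move=> i_n jn /andP[t0 t1]; rewrite /polygon_edge side_formD !side_formZ => E.
have A : side_form n i (v j) <= 1 by apply: side_form_vertex_le1 => //; exact: ltnW.
have B : side_form n i (v j.+1) <= 1 by apply: side_form_vertex_le1.
split=> [t1'|t0'].
- have {}A : ~ (side_form n i (v j) < 1) by nra.
  case: (boolP [|| j == i, j == i.+1, (i == 0%N) && (j == n) | (i == n.-1) && (j == 0%N)]).
    move=> /or4P[/eqP ->|/eqP ->|/andP[_ /eqP jn']|/andP[/eqP -> /eqP ->]].
    + by constructor 1.
    + by constructor 2.
    + by move: jn; rewrite jn' ltnn.
    + by constructor 3.
  by move/(side_form_vertex_lt1 n3 i_n (ltnW jn)).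
- have {}B : ~ (side_form n i (v j.+1) < 1) by nra.
  case: (boolP [|| j.+1 == i, j.+1 == i.+1, (i == 0%N) && (j.+1 == n) | (i == n.-1) && (j.+1 == 0%N)]).
    move=> /or4P[/eqP ->|/eqP[->]|/andP[/eqP -> /eqP ->]|/andP[_ //]].
    + by constructor 1.
    + by constructor 2.
    + by constructor 3.
  by move/(side_form_vertex_lt1 n3 i_n jn).
Qed.

Lemma polar_inj r s x y : 0 <= r -> 0 <= s ->
  0 <= x <= n%:R -> 0 <= y <= n%:R -> r *: boundary x = s *: boundary y ->
  r = s /\ [\/ r = 0, x = y, x = 0 /\ y = n%:R | x = n%:R /\ y = 0].
Proof.
move=> r0 s0 x0n y0n E.
have n0 : (0 < n)%N by lia.
have [j [t [jn t01 xE]]] := floor_split n0 x0n.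
have [l [u [ln u01 yE]]] := floor_split n0 y0n.
have Ej : r * side_form n j (boundary x) = s * side_form n j (boundary y).
  by rewrite -!side_formZ E.
have El : r * side_form n l (boundary x) = s * side_form n l (boundary y).
  by rewrite -!side_formZ E.
have jx : side_form n j (boundary x) = 1 by rewrite xE boundaryE // side_form_edge.
have ly : side_form n l (boundary y) = 1 by rewrite yE boundaryE // side_form_edge.
have jy := side_form_boundary_le1 jn y0n.
have lx := side_form_boundary_le1 ln x0n.
rewrite jx mulr1 in Ej; rewrite ly mulr1 in El.
have rs : r = s by apply/eqP; rewrite eq_le; apply/andP; split; nra.
split => //; have [r00|r00] := eqVneq r 0; first by constructor 1.
have rp : 0 < r by rewrite lt_def r00.
rewrite -rs in Ej El E.
have {}jy : side_form n j (boundary y) = 1 by apply: (mulfI r00); rewrite mulr1.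
have {}lx : side_form n l (boundary x) = 1 by apply: (mulfI r00); rewrite mulr1.
have {E} : boundary x = boundary y by apply: (scalerI r00).
rewrite xE yE !boundaryE // in jy lx *.
have [h1 h2] := edge_tight jn ln u01 jy.
have [h3 h4] := edge_tight ln jn t01 lx.
move/andP : t01 => [t0 t1]; move/andP : u01 => [u0 u1].
have [jl E|jl _] := eqVneq j l.
  constructor 2; rewrite -jl; congr (_ + _).
  move/(congr1 (@ray_form R n j)) : E; rewrite -jl.
  rewrite /polygon_edge !ray_formD !ray_formZ ray_form_own // ray_form_ownS //.
  by rewrite !mulr0 !add0r => /mulIf; apply; rewrite gt_eqF // sin_2alpha_gt0.
have [t0'|t0'] := eqVneq t 0.
  have t1' : t < 1 by rewrite t0'.
  have ul : u = 1.
    apply/eqP; rewrite eq_le u1 leNgt; apply/negP => /h1.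
    exact: edge_startsF n3 jn ln jl (h3 t1').
  case: (h3 t1') => [jl'|jl'|[ln' j0]]; first by rewrite jl' eqxx in jl.
    by constructor 2; rewrite t0' ul jl' addr0 natr1.
  by constructor 3; rewrite t0' ul j0 addr0 ln' natr1 prednK.
have tp : 0 < t by rewrite lt_def t0'.
have tl : t = 1.
  apply/eqP; rewrite eq_le t1 leNgt; apply/negP => /h3.
  exact: edge_interiorF n3 jn ln jl (h4 tp).
have ul : u = 0.
  apply/eqP; rewrite eq_le u0 andbT leNgt; apply/negP => /h2.
  exact: edge_endsF n3 jn ln jl (h4 tp).
case: (h4 tp) => [jl'|jl'|[l0 jn']].
- by constructor 2; rewrite tl ul addr0 natr1 jl'.
- by rewrite jl' eqxx in jl.
- by constructor 4; rewrite tl ul addr0 l0 natr1 jn'.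
Qed.

End PolygonPolar.

(** * The saw blade complex *)

Definition zigzag (j : nat) : nat := (j %/ 3 + (j %% 3 == 1))%N.

Lemma size_saw_blade_word k : size (saw_blade_word k) = (3 * k)%N.
Proof.
suff H m : size [seq (i, b) | i <- iota m k, b <- [:: true; false; true]] =
  (3 * k)%N by exact: H.
by elim: k m => [|k IH] m; [rewrite muln0|rewrite /= IH; lia].
Qed.

Lemma nth_saw_blade_word k j : (j < 3 * k)%N ->
  nth (0%N, true) (saw_blade_word k) j = ((j %/ 3)%N, (j %% 3 != 1)%N).
Proof.
suff H m : (j < 3 * k)%N ->
    nth (0%N, true) [seq (i, b) | i <- iota m k, b <- [:: true; false; true]] j
  = ((m + j %/ 3)%N, (j %% 3 != 1)%N) by exact: H.
elim: k m j => [|k IH] m j jk; first by lia.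
case: j jk => [|[|[|j]]] jk /=; rewrite ?addn0 //.
rewrite IH; last by lia.
have -> : (j.+3 %/ 3 = (j %/ 3).+1)%N by lia.
have -> : (j.+3 %% 3 = j %% 3)%N by lia.
by rewrite addSnnS.
Qed.

Section SawBlade.
Context {R : realType} (k : nat).
Hypothesis k0 : (0 < k)%N.

Local Notation w := (saw_blade_word k).
Local Notation n := (size w).
Local Notation X := (saw_blade R k).
Local Notation D := (@disk R w).

Let nE : n = (3 * k)%N := size_saw_blade_word k.
Let n3 : (3 <= n)%N. Proof. by rewrite nE; lia. Qed.

Lemma n_real : n%:R = 3 * k%:R :> R.
Proof. by rewrite nE natrM. Qed.

Let kn0 : 0 <= n%:R :> R. Proof. by []. Qed.

Definition position (x : R) : R :=
  interp n (fun j => (zigzag j)%:R : R^o) (clamp n%:R x).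

Lemma position_continuous : continuous position.
Proof.
apply: cts_comp; first exact: interp_continuous.
exact: clamp_continuous.
Qed.

Definition orient (j : nat) (t : R) : R := if (j %% 3 == 1)%N then 1 - t else t.

Lemma orientK j t : orient j (orient j t) = t.
Proof. by rewrite /orient; case: (_ == _) => //; ring. Qed.

Lemma orient01 j t : 0 <= t <= 1 -> 0 <= orient j t <= 1.
Proof. by rewrite /orient; case: ifP => // _; lra. Qed.

Lemma oriented_edgeE j t : (j < n)%N ->
  @oriented_edge R w j t = polygon_edge n j (orient j t).
Proof.
move=> jn; rewrite /oriented_edge /forward nth_saw_blade_word -?nE //=.
by rewrite /orient; case: eqP.
Qed.

Lemma letterE j : (j < n)%N -> letter w j = (j %/ 3)%N.
Proof. by move=> jn; rewrite /letter nth_saw_blade_word -?nE. Qed.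

Lemma edge_itv j (t : R) : (j < n)%N -> 0 <= t <= 1 -> 0 <= j%:R + t <= n%:R.
Proof.
move=> jn /andP[t0 t1]; rewrite addr_ge0 //=.
by rewrite (@le_trans _ _ (j%:R + 1)) ?lerD // natr1 ler_nat.
Qed.

Lemma positionE j (t : R) : (j < n)%N -> 0 <= t <= 1 ->
  position (j%:R + t) = (j %/ 3)%:R + orient j t.
Proof.
move=> jn t01; rewrite /position clamp_id; last exact: edge_itv.
rewrite interpE // /orient /zigzag.
have := divn_eq j 3; have := ltn_pmod j (isT : 0 < 3)%N.
case: (j %% 3)%N => [|[|[|//]]] _ E /=.
- have -> : (j.+1 %/ 3 = j %/ 3)%N by lia.
  have -> : (j.+1 %% 3 = 1)%N by lia.
  by rewrite addn0 /GRing.scale /= natrD; ring.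
- have -> : (j.+1 %/ 3 = j %/ 3)%N by lia.
  have -> : (j.+1 %% 3 = 2)%N by lia.
  by rewrite addn0 /GRing.scale /= natrD; ring.
- have -> : (j.+1 %/ 3 = (j %/ 3).+1)%N by lia.
  have -> : (j.+1 %% 3 = 0)%N by lia.
  by rewrite !addn0 /GRing.scale /= -natr1; ring.
Qed.

Lemma position_itv x : 0 <= position x <= k%:R.
Proof.
rewrite /position; have := clamp_itv x kn0.
set y := clamp _ _ => y0n.
have [|j [t [jn t01 yE]]] := @floor_split _ n y _ y0n; first by lia.
have := positionE jn t01; rewrite /position -yE clamp_id // => ->.
have /andP[t'0 t'1] := orient01 j t01.
rewrite addr_ge0 //= (@le_trans _ _ ((j %/ 3)%:R + 1)) ?lerD //.
by rewrite natr1 ler_nat; move: jn; rewrite nE; lia.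
Qed.

Lemma position0 : position 0 = 0.
Proof.
have n0 : (0 < n)%N by lia.
rewrite -[X in position X](addr0 0%:R) positionE ?lexx ?ler01 //.
by rewrite /orient /= addr0.
Qed.

Lemma position_n : position n%:R = k%:R.
Proof.
have -> : n%:R = (n.-1)%:R + 1 :> R by rewrite natr1 prednK //; lia.
rewrite positionE ?ler01 ?lexx //; last by lia.
have E : (n.-1 = (k.-1) * 3 + 2)%N by rewrite nE; lia.
rewrite /orient E modnMDl divnMDl //= addn0 natr1 prednK //.
Qed.

Lemma position_surj u : 0 <= u <= k%:R ->
  exists2 x, 0 <= x <= n%:R & position x = u.
Proof.
move=> u0k; have [i [t [ik t01 ->]]] := floor_split k0 u0k.
have jn : (3 * i < n)%N by rewrite nE; lia.
exists ((3 * i)%:R + t); first exact: edge_itv.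
by rewrite positionE // /orient mulKn // modnMr.
Qed.

Lemma disk_hausdorff : hausdorff_space D.
Proof.
move=> p q pq; apply: val_inj => /=.
have hP : hausdorff_space (R^o * R^o)%type by exact: norm_hausdorff.
apply: hP => A B pA qB.
have c : continuous (set_val : D -> R^o * R^o) by exact: set_val_continuous.
have [y [/= Ay By]] := pq _ _ (c p _ pA) (c q _ qB).
by exists (val y).
Qed.

Lemma polar_in (r x : R) :
  clamp 1 r *: @boundary R n (clamp n%:R x) \in (@polygon R n).
Proof. by apply/mem_set/(polar_polygon n3); exact: clamp_itv. Qed.

Definition polar (r x : R) : D := SigSub (polar_in r x).

Lemma polarE r x : 0 <= r <= 1 -> 0 <= x <= n%:R ->
  set_val (polar r x) = r *: @boundary R n x.
Proof.
move=> r01 x0n.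
by rewrite set_valE /= !clamp_id.
Qed.

Lemma polar_continuous : continuous (fun p : R * R => polar p.1 p.2).
Proof.
apply: set_type_continuous.
rewrite (_ : _ \o _ = fun p : R * R =>
   ((clamp 1 p.1 * (boundary n (clamp n%:R p.2)).1 : R^o),
    (clamp 1 p.1 * (boundary n (clamp n%:R p.2)).2 : R^o))) //.
have cb : continuous (fun p : R * R => boundary n (clamp n%:R p.2)).
  apply: (cts_comp (@interp_continuous2 _ _ _)).
  by apply: (cts_comp (@clamp_continuous _ _)); cts.
have c1 : continuous (fun p : R * R => clamp 1 p.1).
  by apply: (cts_comp (@clamp_continuous _ _)); cts.
apply: cts_pair; apply: ctsM => //; first exact: cts_fst.
exact: cts_snd.
Qed.

Definition quot (x : D) : X := (\pi_({eq_quot (@glue_equiv R w)})%qT x).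

Lemma quot_eq x y : quot x = quot y <-> glue_rel x y.
Proof. by split => [/eqmodP|h]; [|apply/eqmodP]. Qed.

Lemma quot_continuous : continuous quot.
Proof. exact: pi_continuous. Qed.

Lemma quot_surj (z : X) : exists x, quot x = z.
Proof. by exists (repr z); rewrite /quot reprK. Qed.

Definition sheet (r x : R) : X := quot (polar r x).

Lemma sheet_continuous : continuous (fun p : R * R => sheet p.1 p.2).
Proof. exact: (cts_comp quot_continuous polar_continuous). Qed.

End SawBlade.

Section SawBladeGluing.
Context {R : realType} (k : nat).
Hypothesis k0 : (0 < k)%N.

Local Notation w := (saw_blade_word k).
Local Notation n := (size w).
Local Notation X := (saw_blade R k).
Local Notation D := (@disk R w).
Local Notation polar := (@polar R k k0).
Local Notation sheet := (@sheet R k k0).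
Local Notation position := (@position R k).

Let nE : n = (3 * k)%N := size_saw_blade_word k.
Let n3 : (3 <= n)%N. Proof. by rewrite nE; lia. Qed.
Let n0 : (0 < n)%N. Proof. by lia. Qed.

Lemma polar_center x y : polar 0 x = polar 0 y.
Proof.
by apply: val_inj => /=; rewrite clamp_id ?lexx ?ler01 // !scale0r.
Qed.

Lemma polar_wrap r : polar r 0 = polar r n%:R.
Proof.
apply: val_inj => /=; rewrite !(@clamp_id _ n%:R) ?lexx ?ler0n //; congr (_ *: _).
rewrite /boundary -[X in interp _ _ X = _](_ : 0%:R = 0) //.
by rewrite !interp_nat // polygon_vertex_n.
Qed.

Lemma polar_surj (d : D) :
  exists r x, [/\ 0 <= r <= 1, 0 <= x <= n%:R & polar r x = d].
Proof.
have [r [x [r01 x0n E]]] := polygon_polar n3 (set_valP d).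
exists r, x; split => //; apply: val_inj.
by rewrite -set_valE polarE.
Qed.

Lemma sheet_edge (i j : nat) (t : R) : (i < n)%N -> (j < n)%N ->
  (i %/ 3 = j %/ 3)%N -> 0 <= t <= 1 ->
  sheet 1 (i%:R + orient i t) = sheet 1 (j%:R + orient j t).
Proof.
move=> i_n jn ij t01; apply/quot_eq/asboolP/rst_step.
have val_edge (l : nat) : (l < n)%N -> set_val (polar 1 (l%:R + orient l t)) =
    @oriented_edge R w l t.
  move=> ln; have o01 := orient01 l t01.
  rewrite polarE ?ler01 ?lexx //; last exact: edge_itv.
  by rewrite scale1r boundaryE // oriented_edgeE.
exists (Ordinal i_n), (Ordinal jn), t; split.
- by rewrite !letterE.
- by rewrite in_itv.
- exact: val_edge.
- exact: val_edge.
Qed.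

Lemma sheet_first (x : R) : 0 <= x <= n%:R -> exists i t,
  [/\ (i < k)%N, 0 <= t <= 1, position x = i%:R + t &
   sheet 1 x = sheet 1 ((3 * i)%:R + t)].
Proof.
move=> x0n; have [j [t [jn t01 ->]]] := floor_split n0 x0n.
have o01 := orient01 j t01.
exists (j %/ 3)%N, (orient j t); split => //.
- by move: jn; rewrite nE; lia.
- by rewrite positionE.
have -> : (3 * (j %/ 3))%:R + orient j t =
    (3 * (j %/ 3))%:R + orient (3 * (j %/ 3)) (orient j t).
  by rewrite {2}/orient modnMr.
rewrite -{1}[t](orientK j); apply: sheet_edge => //; last by lia.
by move: jn; rewrite nE; lia.
Qed.

Lemma sheet_junction i : (i < k)%N ->
  sheet 1 ((3 * i)%:R + 1) = sheet 1 (3 * i.+1)%:R.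
Proof.
move=> ik; have := @sheet_edge (3 * i) (3 * i + 2) 1.
rewrite /orient modnMr mulnC modnMDl /= => ->; rewrite ?ler01 ?lexx //.
- by congr (sheet 1 _); rewrite natr1; congr (_%:R); lia.
- by rewrite nE; lia.
- by rewrite nE; lia.
- by lia.
Qed.

Lemma sheet_position (x y : R) : 0 <= x <= n%:R -> 0 <= y <= n%:R ->
  position x = position y -> sheet 1 x = sheet 1 y.
Proof.
move=> /sheet_first[i [t [ik t01 -> ->]]] /sheet_first[j [u [jk u01 -> ->]]].
wlog ij : i j t u ik jk t01 u01 / (i <= j)%N => [H|].
  by case/orP: (leq_total i j) => ij E; [exact: H|apply/esym/H].
have [<- E|ij' E] := eqVneq i j; first by congr (sheet 1 (_ + _)); lra.
have ij1 : i%:R + 1 <= j%:R :> R by rewrite natr1 ler_nat; lia.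
have -> : t = 1 by lra.
have -> : u = 0 by lra.
have -> : j = i.+1.
  have : j%:R = i%:R + 1 :> R by lra.
  by rewrite natr1 => /eqP; rewrite eqr_nat => /eqP.
by rewrite addr0 sheet_junction.
Qed.

Lemma sheet_position_wrap (x y : R) : 0 <= x <= n%:R -> 0 <= y <= n%:R ->
  position x = 0 -> position y = k%:R -> sheet 1 x = sheet 1 y.
Proof.
move=> x0n y0n x0 yk.
rewrite (@sheet_position x 0) ?position0 ?lexx ?ler0n //.
rewrite (@sheet_position y n%:R) ?position_n ?lexx ?ler0n //.
by rewrite /sheet polar_wrap.
Qed.

Lemma glued_position (a b : D) : glued a b -> exists x y,
  [/\ 0 <= x <= n%:R, 0 <= y <= n%:R, position x = position y,
      a = polar 1 x & b = polar 1 y].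
Proof.
move=> [i [j [t [ij]]]]; rewrite in_itv /= => t01 aE bE.
have [oi oj] := (orient01 i t01, orient01 j t01).
have xi := edge_itv (ltn_ord i) oi; have yj := edge_itv (ltn_ord j) oj.
exists (i%:R + orient i t), (j%:R + orient j t); split => //.
- by move: ij; rewrite !positionE // !letterE // !orientK => ->.
- apply: val_inj; rewrite -set_valE aE polarE ?ler01 ?lexx //.
  by rewrite scale1r boundaryE // oriented_edgeE.
- apply: val_inj; rewrite -set_valE bE polarE ?ler01 ?lexx //.
  by rewrite scale1r boundaryE // oriented_edgeE.
Qed.

Definition box : set (R * R) := `[0, 1] `*` `[0, n%:R].

Lemma box_compact : compact box.
Proof. by apply: compact_setX; exact: segment_compact. Qed.

Lemma polar_descend (Z : topologicalType) (G : R -> R -> Z) :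
  continuous (fun p : R * R => G p.1 p.2) ->
  (forall x y, 0 <= x <= n%:R -> 0 <= y <= n%:R -> G 0 x = G 0 y) ->
  (forall r, 0 <= r <= 1 -> G r 0 = G r n%:R) ->
  exists2 g : D -> Z, continuous g & forall r x, 0 <= r <= 1 ->
    0 <= x <= n%:R -> g (polar r x) = G r x.
Proof.
move=> cG G0 Gn.
have /(@choice _ _ _)[g gP] : forall d : D, exists z, forall r x,
    0 <= r <= 1 -> 0 <= x <= n%:R -> polar r x = d -> z = G r x.
  move=> d; have [r [x [r01 x0n <-]]] := polar_surj d.
  exists (G r x) => s y s01 y0n /(congr1 set_val).
  rewrite !polarE // => /(polar_inj n3) []//; last move=> sr.
  - by case/andP: s01.
  - by case/andP: r01.
  by rewrite -sr => -[->|->|[-> ->]|[-> ->]]; [exact: G0| |rewrite Gn|rewrite Gn].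
exists g => [|r x r01 x0n]; last exact: gP.
apply: (@compact_quotient_continuousT _ _ _ box (fun p => polar p.1 p.2)).
- exact: box_compact.
- exact: disk_hausdorff.
- by apply: continuous_subspaceT; exact: polar_continuous.
- apply: (@subspace_eq_continuous _ _ _ (fun p : R * R => G p.1 p.2)).
    move=> [r x]; rewrite inE /= => -[/=]; rewrite !in_itv /= => r01 x0n.
    by rewrite /from_subspace /=; apply/esym/gP.
  exact: continuous_subspaceT.
- apply/seteqP; split => // d _; have [r [x [r01 x0n <-]]] := polar_surj d.
  by exists (r, x) => //; split; rewrite /= in_itv.
Qed.

Lemma quot_descend (Z : topologicalType) (g : D -> Z) : continuous g ->
  (forall x y, 0 <= x <= n%:R -> 0 <= y <= n%:R -> position x = position y ->
    g (polar 1 x) = g (polar 1 y)) ->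
  exists2 h : X -> Z, continuous h & forall d, h (quot d) = g d.
Proof.
move=> cg gE.
have gE' (a b : D) : glue_rel a b -> g a = g b.
  move/asboolP; elim=> {a b} [a b|a|a b _ ->|a b c _ -> _ ->] //.
  by move/glued_position => [x [y [x0n y0n xy -> ->]]]; exact: gE.
exists (g \o repr : X -> Z) => [|d].
  by apply: repr_comp_continuous => // a b /eqP/quot_eq/gE' ->.
by rewrite /=; apply/gE'/quot_eq; rewrite /quot reprK.
Qed.

Lemma sheet_descend (Z : topologicalType) (G : R -> R -> Z) :
  continuous (fun p : R * R => G p.1 p.2) ->
  (forall x y, 0 <= x <= n%:R -> 0 <= y <= n%:R -> G 0 x = G 0 y) ->
  (forall r, 0 <= r <= 1 -> G r 0 = G r n%:R) ->
  (forall x y, 0 <= x <= n%:R -> 0 <= y <= n%:R -> position x = position y ->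
    G 1 x = G 1 y) ->
  exists2 h : X -> Z, continuous h & forall r x, 0 <= r <= 1 ->
    0 <= x <= n%:R -> h (sheet r x) = G r x.
Proof.
move=> cG G0 Gn G1; have [g cg gG] := polar_descend cG G0 Gn.
have [|h ch hg] := quot_descend cg.
  by move=> x y x0n y0n xy; rewrite !gG ?ler01 ?lexx //; exact: G1.
by exists h => // r x r01 x0n; rewrite /sheet hg gG.
Qed.

Lemma sheet_surj (z : X) :
  exists r x, [/\ 0 <= r <= 1, 0 <= x <= n%:R & sheet r x = z].
Proof.
have [d <-] := quot_surj z; have [r [x [r01 x0n <-]]] := polar_surj d.
by exists r, x.
Qed.

End SawBladeGluing.

Section SawBladeContractible.
Context {R : realType} (k : nat).
Hypothesis k0 : (0 < k)%N.

Local Notation w := (saw_blade_word k).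
Local Notation n := (size w).
Local Notation X := (saw_blade R k).
Local Notation sheet := (@sheet R k k0).
Local Notation position := (@position R k).

Lemma circle_exists : exists2 c : R -> X, continuous c &
  forall x, 0 <= x <= n%:R -> c (position x) = sheet 1 x.
Proof.
have /(@choice _ _ _)[c cP] : forall u : R, exists z : X, forall x,
    0 <= x <= n%:R -> position x = u -> z = sheet 1 x.
  move=> u; have [u01|u01] := boolP (0 <= u <= k%:R); last first.
    exists (sheet 0 0) => x _ xu; have := position_itv k0 x.
    by rewrite xu (negPf u01).
  have [x x0n xu] := position_surj k0 u01; exists (sheet 1 x) => y y0n yu.
  by apply: sheet_position; rewrite // xu.
have cE x : 0 <= x <= n%:R -> c (position x) = sheet 1 x.
  by move=> x0n; exact: cP.
exists (c \o clamp k%:R) => [|x x0n]; last first.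
  by rewrite /= clamp_id ?cE // position_itv.
have := @continuous_comp_within R R X [set` `[0, k%:R]] (clamp k%:R) c; apply.
- have <- : position @` `[0, n%:R]%classic = `[0, k%:R]%classic.
    apply/seteqP; split => u /=; rewrite in_itv /=.
      by move=> [x _ <-]; exact: position_itv.
    by move=> /(position_surj k0)[x x0n <-]; exists x; rewrite //= in_itv.
  apply: compact_quotient_continuous; first exact: segment_compact.
  + exact: Rhausdorff.
  + exact/continuous_subspaceT/position_continuous.
  + apply: (@subspace_eq_continuous _ _ _ (sheet 1)).
      by move=> x; rewrite inE /= in_itv /= => x0n; apply/esym/cE.
    apply: continuous_subspaceT.
    have cpair : continuous (fun x : R => (1 : R, x)) by cts.
    exact: (@cts_comp R _ _ _ _ (@sheet_continuous R k k0) cpair).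
- exact: clamp_continuous.
- by move=> x; rewrite /= in_itv /= clamp_itv.
Qed.

(* [push rho u] runs along the radius of the disk in direction [3 * u] for
   [rho <= 1], and then along the homotopy from [position] to the degree one
   parametrization of the circle for [1 <= rho <= 2]. *)
Definition push (c : R -> X) (rho u : R) : X :=
  if rho <= 1 then sheet rho (3 * u)
  else c ((2 - rho) * position (3 * u) + (rho - 1) * u).

Definition stage1 (t r : R) : R :=
  Num.min ((1 + 2 * t) * r) (2 + 2 * t - (1 + 2 * t) * r).

Definition blend (r x : R) : R :=
  let l := Num.max 0 (3 * r - 2) in (1 - l) * (x / 3) + l * position x.

Lemma blend_continuous : continuous (fun p : R * R => blend p.1 p.2).
Proof.
have cp : continuous (fun p : R * R => position p.2).
  by apply: (cts_comp (@position_continuous _ _)); cts.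
by rewrite /blend; cts.
Qed.

Section Push.
Variable c : R -> X.
Hypothesis cc : continuous c.
Hypothesis cE : forall x, 0 <= x <= n%:R -> c (position x) = sheet 1 x.

Let n_ge0 : 0 <= n%:R :> R. Proof. by []. Qed.
Let nR : n%:R = 3 * k%:R :> R := n_real k.

Lemma circleE x : c (position x) = sheet 1 x.
Proof.
have xc := clamp_itv x n_ge0.
have -> : position x = position (clamp n%:R x).
  by rewrite /position [in RHS]clamp_id.
have -> : sheet 1 x = sheet 1 (clamp n%:R x).
  by congr (quot _); apply: val_inj => /=; rewrite [in RHS](@clamp_id _ n%:R).
exact: cE.
Qed.

Lemma push_continuous : continuous (fun p : R * R => push c p.1 p.2).
Proof.
apply: continuous_paste; last by move=> p ->; rewrite -circleE; congr (c _); ring.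
- apply: (@cts_comp _ _ _ (fun p : R * R => (p.1, 3 * p.2))
    (fun p => sheet p.1 p.2)); first exact: sheet_continuous.
  by cts.
- apply: (cts_comp cc).
  have cp : continuous (fun p : R * R => position (3 * p.2)).
    by apply: (cts_comp (@position_continuous _ _)); cts.
  by cts.
- by cts.
- by cts.
Qed.

Lemma push0 u u' : push c 0 u = push c 0 u'.
Proof. by rewrite /push ler01 /sheet; congr (quot _); exact: polar_center. Qed.

Lemma push_wrap rho : push c rho 0 = push c rho k%:R.
Proof.
have E : c 0 = c k%:R.
  have := circleE 0; have := circleE n%:R.
  rewrite position0 // position_n // => -> ->.
  by rewrite /sheet polar_wrap.
rewrite /push mulr0 -nR; case: ifP => _; first by rewrite /sheet polar_wrap.
rewrite position0 // position_n //.
rewrite (_ : (2 - rho) * 0 + (rho - 1) * 0 = 0); last by ring.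
by rewrite (_ : (2 - rho) * k%:R + (rho - 1) * k%:R = k%:R) //; ring.
Qed.

Definition contraction (t r x : R) : X :=
  if t <= 1 / 2 then push c (stage1 (2 * t) (clamp 1 r)) (clamp n%:R x / 3)
  else push c ((2 - 2 * t) * Num.min (3 * clamp 1 r) 2)
         (blend (clamp 1 r) (clamp n%:R x)).

Lemma contraction_continuous :
  continuous (fun p : R * (R * R) => contraction p.1 p.2.1 p.2.2).
Proof.
have cr : continuous (fun p : R * (R * R) => clamp 1 p.2.1).
  by apply: (cts_comp (@clamp_continuous _ _)); cts.
have cx : continuous (fun p : R * (R * R) => clamp n%:R p.2.2).
  by apply: (cts_comp (@clamp_continuous _ _)); cts.
have cp (f g : R * (R * R) -> R) : continuous f -> continuous g ->
    continuous (fun p => push c (f p) (g p)).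
  move=> cf cg; apply: (@cts_comp _ _ _ (fun p => (f p, g p))
    (fun p => push c p.1 p.2)); first exact: push_continuous.
  by cts.
apply: continuous_paste => [||||[t [r x]] /= ->].
- by apply: cp; rewrite /stage1; cts.
- apply: cp; first by cts.
  apply: (@cts_comp _ _ _ (fun p : R * (R * R) =>
    (clamp 1 p.2.1, clamp n%:R p.2.2)) (fun p => blend p.1 p.2)).
    exact: blend_continuous.
  by cts.
- by cts.
- by cts.
have := @clamp_itv R 1 r ler01; have := clamp_itv x n_ge0.
move: (clamp 1 r) (clamp n%:R x) => {}r {}x x0n r01.
rewrite /stage1 /blend.
have -> : 2 * (1 / 2) = 1 :> R by lra.
have [r2|r2] := leP r (2 / 3).
  rewrite [X in push c X]min_l; last by lra.
  rewrite [Num.max _ _]max_l; last by lra.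
  rewrite [Num.min (3 * r) 2]min_l; last by lra.
  by congr (push c _ _); lra.
rewrite [X in push c X]min_r; last by lra.
rewrite [Num.max _ _]max_r; last by lra.
rewrite [Num.min (3 * r) 2]min_r; last by lra.
rewrite /push [(2 - 1) * 2 <= 1](_ : _ = false); last by apply/negbTE; lra.
have -> : 3 * (x / 3) = x by lra.
case: ifP => [r1|_]; last by congr (c _); ring.
have -> : r = 1 by lra.
rewrite (_ : 2 + 2 * 1 - (1 + 2 * 1) * 1 = 1); last by ring.
by rewrite -circleE; congr (c _); ring.
Qed.

Lemma saw_blade_contractible :
  hausdorff_space X -> contractible R X.
Proof.
move=> hX.
have half0 : (0 : R) <= 1 / 2 by lra.
have id01 (x : R) : 0 <= x <= 1 -> clamp 1 x = x by exact: clamp_id.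
have idn (x : R) : 0 <= x <= n%:R -> clamp n%:R x = x by exact: clamp_id.
have r1 : 0 <= (1 : R) <= 1 by rewrite ler01 lexx.
have r0 : 0 <= (0 : R) <= 1 by rewrite ler01 lexx.
have x0 : 0 <= (0 : R) <= n%:R by rewrite lexx ler0n.
have xn : 0 <= (n%:R : R) <= n%:R by rewrite lexx ler0n.
have /(@choice _ _ _)[h hP] : forall t : R, exists h : X -> X, 0 <= t <= 1 ->
    forall r x, 0 <= r <= 1 -> 0 <= x <= n%:R -> h (sheet r x) = contraction t r x.
  move=> t; have [t01|t01] := boolP (0 <= t <= 1); last by exists id.
  have [||||h _ hE] := @sheet_descend R k k0 X (contraction t).
  - apply: (@cts_comp _ _ _ (fun p : R * R => (t, p))
      (fun p => contraction p.1 p.2.1 p.2.2)); first exact: contraction_continuous.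
    by cts.
  - move=> x y x0n y0n; rewrite /contraction id01 //.
    case: ifP => _; last first.
      by rewrite [Num.min _ _]min_l ?mulr0 ?ler0n //; exact: push0.
    by rewrite /stage1 !mulr0 min_l ?subr0; [exact: push0|lra].
  - move=> r r01; rewrite /contraction id01 // !idn //.
    rewrite /blend position0 // position_n // mul0r nR.
    have -> : 3 * k%:R / 3 = k%:R :> R by lra.
    set l := Num.max _ _.
    have -> : (1 - l) * 0 + l * 0 = 0 by ring.
    have -> : (1 - l) * k%:R + l * k%:R = k%:R by ring.
    by case: ifP => _; exact: push_wrap.
  - move=> x y x0n y0n xy; rewrite /contraction id01 // !idn //.
    case: ifP => _; last first.
      by rewrite /blend xy max_r; [congr (push c _ _); lra|lra].
    rewrite /stage1 min_r; last by lra.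
    rewrite (_ : _ - _ = 1); last by ring.
    rewrite /push lexx.
    have E (z : R) : 3 * (z / 3) = z by lra.
    by rewrite !E; exact: sheet_position.
  by exists h.
exists (sheet 0 0), (fun p => h p.1 p.2); split.
- set A := `[0, 1] `*` box k : set (R * (R * R)).
  have <- : (fun p : R * (R * R) => (p.1, sheet p.2.1 p.2.2)) @` A =
      `[0, 1] `*` [set: X].
    apply/seteqP; split; first by move=> _ [[t [r x]] [/= t01 _] <-].
    move=> [t z] [/= t01 _]; have [r [x [r01 x0n <-]]] := sheet_surj k0 z.
    by exists (t, (r, x)) => //; split => //; split; rewrite /= in_itv.
  apply: compact_quotient_continuous.
  + by apply: compact_setX; [exact: segment_compact|exact: box_compact].
  + by apply: hausdorff_prod => //; exact: Rhausdorff.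
  + apply: continuous_subspaceT; apply: cts_pair; first by cts.
    apply: (@cts_comp _ _ _ (fun p : R * (R * R) => p.2)
      (fun p => sheet p.1 p.2)); first exact: sheet_continuous.
    by cts.
  + apply: (@subspace_eq_continuous _ _ _
      (fun p : R * (R * R) => contraction p.1 p.2.1 p.2.2)).
      move=> [t [r x]]; rewrite inE /= => -[/= t01 [/= r01 x0n]].
      rewrite /from_subspace /= hP //.
    by apply: continuous_subspaceT; exact: contraction_continuous.
- move=> z; have [r [x [r01 x0n <-]]] := sheet_surj k0 z.
  rewrite /= hP // /contraction half0 id01 // idn // /stage1.
  rewrite min_l; last by lra.
  rewrite /push (_ : _ <= 1); last by lra.
  by congr (sheet _ _); lra.
- move=> z; have [r [x [r01 x0n <-]]] := sheet_surj k0 z.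
  rewrite /= hP // /contraction (_ : 1 <= 1 / 2 = false); last first.
    by apply/negbTE; lra.
  rewrite (_ : 2 - 2 * 1 = 0) ?mul0r; last by ring.
  rewrite (push0 _ 0) /push ler01 /sheet; congr (quot _); exact: polar_center.
Qed.

End Push.
End SawBladeContractible.

(** * Zeros of planar maps from a parity count of sign changes *)

Section ParityCount.
Implicit Types (c : nat -> nat -> nat) (M N : nat).

Definition door (a b : nat) : bool :=
  (a == 0%N) && (b == 1%N) || (a == 1%N) && (b == 0%N).

Definition trichromatic c i j : bool :=
  all (fun l => l \in [:: c i j; c i.+1 j; c i j.+1; c i.+1 j.+1]) [:: 0; 1; 2]%N.

Definition doors_of (f : nat -> nat) N : bool :=
  \big[addb/false]_(i < N) door (f i) (f i.+1).

Lemma doors_of_recr f N :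
  doors_of f N.+1 = doors_of f N (+) door (f N) (f N.+1).
Proof. by rewrite /doors_of big_ord_recr. Qed.

Lemma doors_of0 f N : (forall i, (i < N)%N -> ~~ door (f i) (f i.+1)) ->
  doors_of f N = false.
Proof. by move=> h; rewrite /doors_of big1 // => i _; apply/negbTE/h. Qed.

Lemma doors_of_bicolor f N : (forall i, (i <= N)%N -> (f i < 2)%N) ->
  doors_of f N = (f 0%N != f N).
Proof.
elim: N => [|N IH] h; first by rewrite /doors_of big_ord0 eqxx.
rewrite doors_of_recr IH; last by move=> i iN; apply: h; lia.
have := h 0%N (leq0n _); have := h N (leqnSn _); have := h N.+1 (leqnn _).
by case: (f 0%N) (f N) (f N.+1) => [|[|//]] [|[|//]] [|[|//]].
Qed.

Lemma doors_of_palindrome f N :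
  (forall i, (i <= 2 * N)%N -> f i = f (2 * N - i)%N) ->
  doors_of f (2 * N) = false.
Proof.
move=> h; rewrite mul2n -addnn /doors_of.
rewrite big_split_ord /=.
rewrite [X in _ (+) X](reindex_inj rev_ord_inj) /=.
set S := \big[_/_]_(i < N) _; set S' := \big[_/_]_(i < N) _.
suff -> : S' = S by rewrite addbb.
apply: eq_bigr => i _; have := ltn_ord i => iN.
rewrite (h (N + (N - i.+1))%N) ?(h (N + (N - i.+1)).+1); [|lia|lia].
rewrite /door orbC ![(_ == 0%N) && _]andbC.
by congr (_ || _); congr (_ && _); congr (f _ == _); lia.
Qed.

Lemma doors_of_cell c i j : ~~ trichromatic c i j ->
  (forall i j, (c i j < 3)%N) ->
  door (c i j) (c i.+1 j) (+) door (c i j.+1) (c i.+1 j.+1) (+)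
  door (c i j) (c i j.+1) (+) door (c i.+1 j) (c i.+1 j.+1) = false.
Proof.
rewrite /trichromatic => + h.
move: (h i j) (h i.+1 j) (h i j.+1) (h i.+1 j.+1).
by case: (c i j) (c i.+1 j) (c i j.+1) (c i.+1 j.+1) =>
  [|[|[|//]]] [|[|[|//]]] [|[|[|//]]] [|[|[|//]]].
Qed.

Lemma addb_row a b h1 h2 v0 v1 v2 : h1 (+) h2 (+) v1 (+) v2 = false ->
  a (+) b = v0 (+) v1 -> (a (+) h1) (+) (b (+) h2) = v0 (+) v2.
Proof. by case: a b h1 h2 v0 v1 v2 => [] [] [] [] [] [] []. Qed.

Lemma addb_column a b b1 l r v0 v1 : b (+) b1 = v0 (+) v1 ->
  a (+) b = l (+) r -> a (+) b1 = (l (+) v0) (+) (r (+) v1).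
Proof. by case: a b b1 l r v0 v1 => [] [] [] [] [] [] []. Qed.

Lemma doors_of_row c M j :
  (forall i, (i < M)%N -> ~~ trichromatic c i j) ->
  (forall i j, (c i j < 3)%N) ->
  doors_of (c^~ j) M (+) doors_of (c^~ j.+1) M =
  door (c 0%N j) (c 0%N j.+1) (+) door (c M j) (c M j.+1).
Proof.
move=> + h3; elim: M => [|M IH] h; first by rewrite /doors_of !big_ord0 !addbb.
rewrite !doors_of_recr; apply: addb_row (doors_of_cell (h M (ltnSn _)) h3) _.
exact: IH (fun i iM => h i (ltnW iM)).
Qed.

Lemma trichromatic_cell c M N : (forall i j, (c i j < 3)%N) ->
  doors_of (c^~ 0%N) M (+) doors_of (c^~ N) M (+)
  doors_of (c 0%N) N (+) doors_of (c M) N ->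
  exists i j, [/\ (i < M)%N, (j < N)%N & trichromatic c i j].
Proof.
move=> h3 odd_doors; apply: contrapT => notri.
have {}notri i j : (i < M)%N -> (j < N)%N -> ~~ trichromatic c i j.
  by move=> iM jN; apply/negP => t; apply: notri; exists i, j.
suff E : doors_of (c^~ 0%N) M (+) doors_of (c^~ N) M =
    doors_of (c 0%N) N (+) doors_of (c M) N.
  by move: odd_doors; rewrite E -addbA addbb.
elim: N {odd_doors} notri => [|N IH] notri; first by rewrite /doors_of !big_ord0 !addbb.
have E := IH (fun i j iM jN => notri i j iM (ltnW jN)).
rewrite !doors_of_recr; apply: addb_column E.
exact: doors_of_row (fun i iM => notri i N iM (ltnSn _)) h3.
Qed.

End ParityCount.

Section PlanarZeros.
Context {R : realType}.
Variables g1 g2 : R * R -> R.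
Hypotheses (cg1 : continuous g1) (cg2 : continuous g2).

Definition colour (z : R * R) : nat :=
  if g1 z < 0 then 0 else if 0 <= g2 z then 1 else 2.

Lemma colour_lt3 z : (colour z < 3)%N.
Proof. by rewrite /colour; case: ifP => // _; case: ifP. Qed.

Definition rectangle : set (R * R) :=
  (`[-1, 1]%classic : set R) `*` (`[0, 1]%classic : set R).

Lemma rectangle_compact : compact rectangle.
Proof. by apply: compact_setX; exact: segment_compact. Qed.

Definition node (m i j : nat) : R * R := (i%:R / m%:R - 1, j%:R / m%:R).

Lemma node_rectangle m i j : (0 < m)%N -> (i <= 2 * m)%N -> (j <= m)%N ->
  rectangle (node m i j).
Proof.
move=> m0 im jm; have m0' : 0 < m%:R :> R by rewrite ltr0n.
split; rewrite /= in_itv /=; apply/andP; split.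
- by rewrite lerDr divr_ge0 // ltW.
- by rewrite lerBlDr ler_pdivrMr // -[1 + 1]/(2%:R) -natrM ler_nat.
- by rewrite divr_ge0 // ltW.
- by rewrite ler_pdivrMr // mul1r ler_nat.
Qed.

Lemma node_near m i j i' j' : (0 < m)%N ->
  (i <= i' <= i.+1)%N -> (j <= j' <= j.+1)%N ->
  `|(node m i' j').1 - (node m i j).1| <= m%:R^-1 /\
  `|(node m i' j').2 - (node m i j).2| <= m%:R^-1.
Proof.
move=> m0; have m0' : 0 < m%:R :> R by rewrite ltr0n.
have H (a b : nat) : (a <= b <= a.+1)%N -> `|b%:R / m%:R - a%:R / m%:R| <= m%:R^-1 :> R.
  move=> /andP[ab ba]; rewrite -mulrBl -natrB // normrM ger0_norm //.
  rewrite ger0_norm ?invr_ge0 ?(ltW m0') // ler_piMl ?invr_ge0 ?(ltW m0') //.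
  by rewrite (ler_nat R _ 1); lia.
move=> ii jj; split => /=; last exact: H.
rewrite (_ : _ - _ = i'%:R / m%:R - i%:R / m%:R); first exact: H.
by ring.
Qed.

Lemma nbhs_square (z : R * R) (S : set (R * R)) : nbhs z S ->
  exists2 e : R, 0 < e & forall y, `|y.1 - z.1| < e -> `|y.2 - z.2| < e -> S y.
Proof.
move=> [[A B] /= [/nbhs_ballP[e e0 eA] /nbhs_ballP[d d0 dB]] AB].
exists (Num.min e d); first by rewrite lt_min e0 d0.
move=> y; rewrite !lt_min => /andP[y1 _] /andP[_ y2]; apply: AB; split.
  by apply: eA; rewrite /ball /= distrC.
by apply: dB; rewrite /ball /= distrC.
Qed.

Lemma planar_zero :
  (exists m0, forall m, (m0 <= m)%N -> (0 < m)%N ->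
    let c i j := colour (node m i j) in
    doors_of (c^~ 0%N) (2 * m) (+) doors_of (c^~ m) (2 * m) (+)
    doors_of (c 0%N) m (+) doors_of (c (2 * m)%N) m) ->
  exists2 z, rectangle z & g1 z = 0 /\ g2 z = 0.
Proof.
move=> [m0 odd_doors].
have /(@choice _ _ _)[q qP] : forall m : nat, exists q : R * R, rectangle q /\
    ((m0 <= m)%N -> (0 < m)%N -> forall l, (l < 3)%N ->
     exists p, [/\ `|p.1 - q.1| <= m%:R^-1, `|p.2 - q.2| <= m%:R^-1
       & colour p = l]).
  move=> m; have [mm|mm] := boolP ((m0 <= m) && (0 < m))%N; last first.
    exists (0, 0); split; first by split; rewrite /= in_itv /= ?lexx ?ler01 ?lerN10.
    by move=> m0m mp; rewrite m0m mp in mm.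
  case/andP: mm => m0m mp.
  have [i [j [im jm tri]]] := trichromatic_cell (fun i j => colour_lt3 _)
    (odd_doors m m0m mp).
  exists (node m i j); split; first by apply: node_rectangle => //; lia.
  move=> _ _ l l3.
  have : l \in [:: colour (node m i j); colour (node m i.+1 j);
      colour (node m i j.+1); colour (node m i.+1 j.+1)].
    by move/allP: tri; apply; move: l l3 => [|[|[|]]].
  rewrite !inE => /or4P[]/eqP ->; (eexists; split; [| |reflexivity];
    apply node_near || apply (proj1 (node_near _ _ _))); lia.
have [|z [Bz zq]] := @rectangle_compact (q @ \oo) _.
  by exists 0%N => // m _; exact: (qP m).1.
exists z => //.
have key (S : set (R * R)) : nbhs z S ->
    forall l, (l < 3)%N -> exists2 p, S p & colour p = l.
  move=> /nbhs_square[e e0 eS] l l3.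
  have e20 : 0 < e / 2 by rewrite divr_gt0.
  have zB : nbhs z [set y : R * R | `|y.1 - z.1| < e / 2 /\ `|y.2 - z.2| < e / 2].
    exists (ball z.1 (e / 2), ball z.2 (e / 2)) => /=.
      by split; exact: nbhsx_ballx.
    by move=> [y1 y2] [/= b1 b2]; split; rewrite distrC.
  have [m1 m1P] : exists m1 : nat, forall m, (m1 <= m)%N -> (0 < m)%N /\ m%:R^-1 < e / 2.
    exists (Num.truncn (e / 2)^-1).+1 => m mm; split; first exact: leq_ltn_trans mm.
    rewrite invf_plt ?posrE // ?ltr0n; last exact: leq_ltn_trans mm.
    apply: lt_le_trans (truncnS_gt _) _; by rewrite ler_nat.
  have [] := zq [set q m | m in [set m | (maxn m0 m1 <= m)%N]] _ _ zB.
    by exists (maxn m0 m1) => // m mm; exists m.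
  move=> _ [[m /= mm <-]] [q1 q2].
  have [mp me] := m1P m (leq_trans (leq_maxr _ _) mm).
  have [p [p1 p2 pl]] := (qP m).2 (leq_trans (leq_maxl _ _) mm) mp l l3.
  exists p => //; apply: eS.
    rewrite (_ : p.1 - z.1 = (p.1 - (q m).1) + ((q m).1 - z.1)); last by ring.
    by apply: le_lt_trans (ler_normD _ _) _; lra.
  rewrite (_ : p.2 - z.2 = (p.2 - (q m).2) + ((q m).2 - z.2)); last by ring.
  by apply: le_lt_trans (ler_normD _ _) _; lra.
have opos (g : R * R -> R) : continuous g -> 0 < g z -> nbhs z [set y | 0 < g y].
  by move=> cg gz; apply: (cg z [set x | 0 < x]); apply: open_nbhs_nbhs; split => //; exact: open_gt.
have oneg (g : R * R -> R) : continuous g -> g z < 0 -> nbhs z [set y | g y < 0].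
  by move=> cg gz; apply: (cg z [set x | x < 0]); apply: open_nbhs_nbhs; split => //; exact: open_lt.
split; apply/eqP; rewrite eq_le !leNgt; apply/andP; split; apply/negP.
- move=> /(opos _ cg1)/key/(_ 0%N isT)[p /= p0].
  by rewrite /colour ltNge (ltW p0) /=; case: ifP.
- move=> /(oneg _ cg1)/key/(_ 1%N isT)[p /= p0].
  by rewrite /colour p0.
- move=> /(opos _ cg2)/key/(_ 2%N isT)[p /= p0].
  by rewrite /colour (ltW p0); case: ifP.
- move=> /(oneg _ cg2)/key/(_ 1%N isT)[p /= p0].
  by rewrite /colour [0 <= _]leNgt p0 /=; case: ifP.
Qed.

End PlanarZeros.

Section PlanarZeroCriteria.
Context {R : realType}.
Variables g1 g2 : R * R -> R.
Hypotheses (cg1 : continuous g1) (cg2 : continuous g2).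

Lemma node_left m j : node m 0 j = (-1, j%:R / m%:R) :> R * R.
Proof. by rewrite /node mul0r sub0r. Qed.

Lemma node_right m j : (0 < m)%N ->
  node m (2 * m) j = (1, j%:R / m%:R) :> R * R.
Proof.
move=> m0; have m0' : m%:R != 0 :> R by rewrite pnatr_eq0 -lt0n.
by rewrite /node natrM; congr (_, _); field.
Qed.

Lemma node_bottom m i : node m i 0 = (i%:R / m%:R - 1, 0) :> R * R.
Proof. by rewrite /node mul0r. Qed.

Lemma node_top m i : (0 < m)%N ->
  node m i m = (i%:R / m%:R - 1, 1) :> R * R.
Proof. by move=> m0; rewrite /node divff // pnatr_eq0 -lt0n. Qed.

Lemma node_itv (m i : nat) : (0 < m)%N -> (i <= m)%N ->
  0 <= (i%:R / m%:R : R) <= 1.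
Proof.
move=> m0 im; have m0' : 0 < m%:R :> R by rewrite ltr0n.
by rewrite divr_ge0 //= ler_pdivrMr // mul1r ler_nat.
Qed.

Lemma node_itv2 (m i : nat) : (0 < m)%N -> (i <= 2 * m)%N ->
  -1 <= (i%:R / m%:R - 1 : R) <= 1.
Proof.
move=> m0 im; have m0' : 0 < m%:R :> R by rewrite ltr0n.
rewrite lerDr divr_ge0 //= lerBlDr ler_pdivrMr //.
by rewrite -[1 + 1]/(2%:R) -natrM ler_nat.
Qed.

Lemma colour0 z : g1 z < 0 -> colour g1 g2 z = 0%N.
Proof. by rewrite /colour => ->. Qed.

Lemma colour1 z : 0 <= g1 z -> 0 <= g2 z -> colour g1 g2 z = 1%N.
Proof. by rewrite /colour ltNge => -> ->. Qed.

Lemma colour_ge0 z : 0 <= g2 z -> (colour g1 g2 z < 2)%N.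
Proof. by rewrite /colour => ->; case: ifP. Qed.

Lemma colour_lt0 z : g2 z < 0 -> colour g1 g2 z <> 1%N.
Proof. by rewrite /colour [0 <= _]leNgt => ->; case: ifP. Qed.

Lemma colour_gt0 z : 0 < g1 z -> colour g1 g2 z <> 0%N.
Proof. by move=> g0; rewrite /colour ltNge (ltW g0); case: ifP. Qed.

Lemma door_neq1 a b : a <> 1%N -> b <> 1%N -> ~~ door a b.
Proof. by rewrite /door => /eqP/negPf -> /eqP/negPf ->; rewrite andbF. Qed.

Lemma door_neq0 a b : a <> 0%N -> b <> 0%N -> ~~ door a b.
Proof. by rewrite /door => /eqP/negPf -> /eqP/negPf ->; rewrite andbF. Qed.

Lemma square_zero :
  (forall y, 0 <= y <= 1 -> g1 (-1, y) < 0) ->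
  (forall y, 0 <= y <= 1 -> 0 < g1 (1, y)) ->
  (forall x, -1 <= x <= 1 -> g2 (x, 0) < 0) ->
  (forall x, -1 <= x <= 1 -> 0 < g2 (x, 1)) ->
  exists2 z, rectangle z & g1 z = 0 /\ g2 z = 0.
Proof.
move=> left right bot top; apply: planar_zero => //.
exists 0%N => m _ m0 /=.
rewrite [X in X (+) _ (+) _ (+) _]doors_of0 => [|i im]; last first.
  by rewrite !node_bottom; apply: door_neq1; apply: colour_lt0;
    apply: bot; apply: node_itv2 => //; exact: ltnW.
rewrite [X in _ (+) X (+) _]doors_of0 => [|j jm]; last first.
  by rewrite !node_left; apply: door_neq1; rewrite colour0 //;
    apply: left; apply: node_itv => //; exact: ltnW.
rewrite [X in _ (+) X]doors_of0 => [|j jm]; last first.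
  by rewrite !node_right //; apply: door_neq0; apply: colour_gt0;
    apply: right; apply: node_itv => //; exact: ltnW.
rewrite !addbF addFb doors_of_bicolor => [|i im]; last first.
  by rewrite node_top //; apply: colour_ge0; apply/ltW/top/node_itv2.
rewrite node_left node_right // divff ?pnatr_eq0 -?lt0n //.
rewrite colour0; last by apply: left; rewrite ler01 lexx.
by rewrite colour1 //; [apply/ltW/right|apply/ltW/top];
  rewrite ?lexx ?ler01 ?lerN10 // (le_trans (lerN10 _)).
Qed.

Lemma folded_zero :
  (forall y, 0 < y <= 1 -> g2 (-1, y) < 0) ->
  (forall y, 0 <= y <= 1 -> 0 <= g2 (1, y)) ->
  (forall x, -1 <= x <= 1 -> g1 (x, 1) < 0) ->
  0 < g1 (1, 0) ->
  (forall x, 0 <= x <= 1 -> g1 (- x, 0) = g1 (x, 0) /\ g2 (- x, 0) = g2 (x, 0)) ->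
  exists2 z, rectangle z & g1 z = 0 /\ g2 z = 0.
Proof.
move=> left right top corner fold; apply: planar_zero => //.
have r01 : 0 <= (0 : R) <= 1 by rewrite lexx ler01.
have r11 : 0 <= (1 : R) <= 1 by rewrite lexx ler01.
have [f1 f2] := fold 1 r11.
have [e e0 eP] : exists2 e : R, 0 < e & forall y, `|y.1 - -1| < e ->
    `|y.2 - 0| < e -> 0 < g1 y.
  apply: (@nbhs_square _ (-1, 0) [set y | 0 < g1 y]).
  apply: (cg1 (x := (-1, 0)) (t := [set x | 0 < x])).
  apply: open_nbhs_nbhs; split; first exact: open_gt.
  by rewrite /= f1.
exists (Num.truncn e^-1).+1 => m mm m0 /=.
have m0' : 0 < m%:R :> R by rewrite ltr0n.
have me : m%:R^-1 < e.
  rewrite invf_plt ?posrE //.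
  by apply: lt_le_trans (truncnS_gt _) _; rewrite ler_nat.
rewrite [X in X (+) _ (+) _ (+) _](_ : _ = false); last first.
  apply: (@doors_of_palindrome (fun i => colour g1 g2 (node m i 0))) => i im.
  rewrite !node_bottom natrB // natrM mulrBl mulfK ?gt_eqF //.
  have [im'|im'] := leqP m i.
    have := node_itv m0 (_ : i - m <= m)%N; rewrite natrB // mulrBl divff ?gt_eqF //.
    move=> /(_ _)/fold[|F1 F2]; first by lia.
    rewrite /colour (_ : 2 - _ - 1 = - (i%:R / m%:R - 1)); last by ring.
    by rewrite F1 F2.
  have := node_itv m0 (_ : m - i <= m)%N.
  rewrite natrB ?(ltnW im') // mulrBl divff ?gt_eqF //.
  move=> /(_ _)/fold[|F1 F2]; first by lia.
  rewrite /colour (_ : 2 - _ - 1 = 1 - i%:R / m%:R); last by ring.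
  by rewrite -F1 -F2 opprB.
rewrite [X in _ (+) X (+) _ (+) _]doors_of0 => [|i im]; last first.
  by rewrite !node_top //; apply: door_neq1; rewrite colour0 //;
    apply: top; apply: node_itv2 => //; exact: ltnW.
rewrite [X in _ (+) X (+) _]doors_of0 => [|j jm]; last first.
  rewrite !node_left; case: j jm => [|j] jm; last first.
    apply: door_neq1; apply: colour_lt0; apply: left.
      by rewrite divr_gt0 ?ltr0n //=; case/andP: (node_itv m0 (ltnW jm)).
    by rewrite divr_gt0 ?ltr0n //=; case/andP: (node_itv m0 jm).
  rewrite mul0r mul1r; apply: door_neq0; apply: colour_gt0; first by rewrite f1.
  apply: eP => /=; first by rewrite subrr normr0.
  by rewrite subr0 ger0_norm // invr_ge0 ltW.
rewrite !addFb doors_of_bicolor => [|j jm]; last first.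
  by rewrite node_right //; apply/colour_ge0/right/node_itv.
rewrite !node_right // mul0r divff ?(lt0r_neq0 m0') //.
rewrite colour1 ?(ltW corner) ?right // colour0 //.
by apply: top; rewrite lexx (le_trans (lerN10 _)) // ler01.
Qed.

End PlanarZeroCriteria.

Lemma not_labile (R : realType) (X : topologicalType) (p : X)
    (phi1 phi2 : X -> R) (N : set X) (iota : R * R -> X) (h : R * R -> R) :
  hausdorff_space X -> nbhs p N -> continuous iota -> continuous h ->
  (forall x, N x -> phi1 x = 0 -> phi2 x = 0 -> x = p) ->
  (forall z, rectangle z -> phi1 (iota z) = 0 -> phi2 (iota z) = 0 ->
    iota z = p) ->
  (forall z, rectangle z -> h z = 0 -> iota z <> p) ->
  (forall f : X -> X, continuous f ->
    (forall z, rectangle z -> h z = 0 -> f (iota z) = iota z) ->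
    exists2 z, rectangle z & phi1 (f (iota z)) = 0 /\ phi2 (f (iota z)) = 0) ->
  ~ labile p.
Proof.
move=> hX Np ci ch locN zi nb degree lp.
pose S := iota @` (rectangle `&` h @^-1` [set 0]).
have cS : closed S.
  apply: compact_closed => //; apply: continuous_compact.
    exact: continuous_subspaceT.
  apply: compact_closedI; first exact: rectangle_compact.
  by apply: closed_comp => [z _|]; [exact: ch|exact: closed_eq].
have [|f [cf f1 f2 f3]] := lp (N `&` ~` S).
  apply: filterI => //; apply: open_nbhs_nbhs; split; first exact: closed_openC.
  by move=> [z [Rz hz]] zp; exact: nb Rz hz zp.
have [|z Rz [z1 z2]] := degree f cf.
  by move=> z Rz hz; apply: f1 => -[_]; apply; exists z.
have [Uz|Uz] := pselect ((N `&` ~` S) (iota z)).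
  have [Nz _] := f2 _ Uz; exact: f3 (locN _ Nz z1 z2).
have E := f1 _ Uz; move: z1 z2; rewrite E => z1 z2.
by apply: (f3 (iota z)); rewrite E; exact: zi.
Qed.

Section SawBladeRigid.
Context {R : realType} (k : nat).
Hypothesis k0 : (0 < k)%N.

Local Notation w := (saw_blade_word k).
Local Notation n := (size w).
Local Notation X := (saw_blade R k).
Local Notation D := (@disk R w).
Local Notation polar := (@polar R k k0).
Local Notation sheet := (@sheet R k k0).
Local Notation position := (@position R k).
Hypothesis hX : hausdorff_space X.

Let nE : n = (3 * k)%N := size_saw_blade_word k.
Let n3 : (3 <= n)%N. Proof. by rewrite nE; lia. Qed.
Let n0 : (0 < n)%N. Proof. by lia. Qed.

Lemma radius_exists : exists2 rho : X -> R, continuous rho &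
  forall r x, 0 <= r <= 1 -> 0 <= x <= n%:R -> rho (sheet r x) = r.
Proof.
have [||||rho crho E] := @sheet_descend R k k0 R (fun r _ => r) => //.
- by cts.
- by exists rho.
Qed.

Lemma boundary_wrap : @boundary R n 0 = boundary n n%:R.
Proof.
rewrite /boundary -[X in interp _ _ X = _](_ : 0%:R = 0) //.
by rewrite !interp_nat // polygon_vertex_n.
Qed.

Lemma boundary_fst_continuous : continuous (fun x : R => (boundary n x).1 : R).
Proof. exact: (cts_fst (@interp_continuous2 _ _ _)). Qed.

Lemma boundary_snd_continuous : continuous (fun x : R => (boundary n x).2 : R).
Proof. exact: (cts_snd (@interp_continuous2 _ _ _)). Qed.

Lemma interior_coordinates (y0 : R^o * R^o) : exists phi1 phi2 : X -> R,
  [/\ continuous phi1, continuous phi2 & forall r x, 0 <= r <= 1 ->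
   0 <= x <= n%:R ->
   phi1 (sheet r x) = (1 - r) * ((r *: boundary n x).1 - y0.1) /\
   phi2 (sheet r x) = (1 - r) * ((r *: boundary n x).2 - y0.2)].
Proof.
have [||||f cf fE] := @sheet_descend R k k0 R
  (fun r x => (1 - r) * (r * (boundary n x).1 - y0.1)).
- have c := cts_comp boundary_fst_continuous (@cts_snd (R * R)%type R R _ (@cts_id _)).
  by cts.
- by move=> x y _ _; rewrite !mul0r.
- by move=> r _; rewrite boundary_wrap.
- by move=> x y _ _ _; rewrite subrr !mul0r.
have [||||g cg gE] := @sheet_descend R k k0 R
  (fun r x => (1 - r) * (r * (boundary n x).2 - y0.2)).
- have c := cts_comp boundary_snd_continuous (@cts_snd (R * R)%type R R _ (@cts_id _)).
  by cts.
- by move=> x y _ _; rewrite !mul0r.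
- by move=> r _; rewrite boundary_wrap.
- by move=> x y _ _ _; rewrite subrr !mul0r.
by exists f, g; split => // r x r01 x0n; rewrite fE // gE.
Qed.

Lemma interior_not_labile r0 x0 : 0 <= r0 < 1 -> 0 <= x0 <= n%:R ->
  ~ labile (sheet r0 x0).
Proof.
move=> /andP[r00 r01] x0n; set p := sheet r0 x0.
have r0I : 0 <= r0 <= 1 by rewrite r00 ltW.
pose y0 : R^o * R^o := r0 *: boundary n x0.
have [rho crho rhoE] := radius_exists.
have [phi1 [phi2 [c1 c2 phiE]]] := interior_coordinates y0.
have cosa := @cos_alpha_gt0 R n n3.
pose e := (1 - r0) * cos (pi / n%:R) / 3.
have e0 : 0 < e by rewrite !mulr_gt0 ?subr_gt0.
pose cz (z : R * R) : R * R := (Num.max (-1) (Num.min 1 z.1), clamp 1 z.2).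
pose y (z : R * R) : R^o * R^o :=
  (y0.1 + e * (cz z).1, y0.2 + e * (2 * (cz z).2 - 1)).
have czR z : rectangle (cz z).
  split; rewrite /= in_itv /=; last exact: clamp_itv.
  by rewrite le_max lexx /= ge_max ge_min lexx andbT; lra.
have czE z : rectangle z -> cz z = z.
  case: z => a b [] /=; rewrite !in_itv /= => /andP[a1 a2] b01.
  by rewrite /cz /= clamp_id // min_r // max_r.
have yS z i : (i < n)%N -> side_form n i (y z) < 1.
  move=> i_n.
  have -> : y z = y0 + (e * (cz z).1, e * (2 * (cz z).2 - 1)) by [].
  rewrite side_formD side_formZ.
  have S1 : side_form n i (boundary n x0) <= 1 by exact: side_form_boundary_le1.
  set d : R^o * R^o := (_, _).
  suff : side_form n i d <= 2 / 3 * (1 - r0) by nra.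
  rewrite /side_form ler_pdivrMr // {}/d.
  move: (cz z) (czR z) => [a b] [/=]; rewrite !in_itv /=.
  move=> /andP[a1 a2] /andP[b1 b2].
  have M (u v : R) : -1 <= u <= 1 -> -1 <= v <= 1 -> u * v <= 1 by nra.
  set A := (2 * i%:R + 1) * _.
  have cA : cos A * a <= 1 by apply: M; rewrite ?cos_geN1 ?cos_le1 ?a1.
  have sA : sin A * (2 * b - 1) <= 1.
    by apply: M; rewrite ?sin_geN1 ?sin_le1 //; lra.
  have -> : 2 / 3 * (1 - r0) * cos (pi / n%:R) = e * 2 by rewrite /e; ring.
  have -> : cos A * (e * a) + sin A * (e * (2 * b - 1)) =
    e * (cos A * a + sin A * (2 * b - 1)) by ring.
  by rewrite ler_pM2l //; lra.
have yP z : polygon n (y z).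
  by apply/(polygon_sideP n3) => i i_n; apply/ltW/yS.
have yin z : y z \in (@polygon R n) by apply/mem_set.
pose iota (z : R * R) : X := quot (SigSub (yin z) : D).
have iotaE z : exists r x, [/\ 0 <= r < 1, 0 <= x <= n%:R,
    y z = r *: boundary n x & iota z = sheet r x].
  have [j [r [t [jn t01 yE rr0 rE]]]] := sector_polar n3 (y z).
  have r1 : r < 1 by rewrite rE yS.
  exists r, (j%:R + t); split.
  - by rewrite rr0.
  - exact: edge_itv.
  - by rewrite boundaryE.
  - congr (quot _); apply: val_inj; rewrite /= !clamp_id ?rr0 ?(ltW r1) //.
      by rewrite boundaryE.
    exact: edge_itv.
have loc x : rho x < 1 -> phi1 x = 0 -> phi2 x = 0 -> x = p.
  have [r [x' [rI x'n <-]]] := sheet_surj k0 x.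
  rewrite rhoE // => r1; have [-> ->] := phiE r x' rI x'n.
  have r1' : 1 - r != 0 by rewrite subr_eq0 eq_sym lt_eqF.
  move=> /eqP; rewrite mulf_eq0 (negPf r1') /= subr_eq0 => /eqP E1.
  move=> /eqP; rewrite mulf_eq0 (negPf r1') /= subr_eq0 => /eqP E2.
  congr (quot _); apply: val_inj; rewrite -!set_valE !polarE //.
  exact: (congr2 pair E1 E2).
have phi_iota z : exists s, [/\ 0 < s, rho (iota z) < 1,
    phi1 (iota z) = s * (cz z).1 & phi2 (iota z) = s * (2 * (cz z).2 - 1)].
  have [r [x [/andP[rI r1] x'n yE ->]]] := iotaE z.
  have rI' : 0 <= r <= 1 by rewrite rI ltW.
  exists ((1 - r) * e); split; first by rewrite mulr_gt0 // subr_gt0.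
  - by rewrite rhoE.
  - by rewrite (phiE r x rI' x'n).1 -yE /y /=; ring.
  - by rewrite (phiE r x rI' x'n).2 -yE /y /=; ring.
have [p1 p2] : phi1 p = 0 /\ phi2 p = 0.
  by have [-> ->] := phiE r0 x0 r0I x0n; rewrite !subrr !mulr0.
have ciota : continuous iota.
  have cy : continuous (fun z => SigSub (yin z) : D).
    apply: set_type_continuous.
    by rewrite (_ : _ \o _ = y) //; apply: cts_pair; rewrite /cz /clamp /=; cts.
  exact: (cts_comp (@quot_continuous R k) cy).
apply: (@not_labile R X p phi1 phi2 [set x | rho x < 1] iota
  (fun z => (z.1 + 1) * (z.1 - 1) * z.2 * (z.2 - 1))) => //.
- apply: (crho p [set x | x < 1]); apply: open_nbhs_nbhs; split.
    exact: open_lt.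
  by rewrite /= rhoE.
- by cts.
- move=> z Rz; apply: loc; by have [s []] := phi_iota z.
- move=> z Rz hz zp; have [s [s0 _]] := phi_iota z.
  rewrite zp p1 p2 czE // => /esym/eqP; rewrite mulf_eq0 gt_eqF //= => /eqP z1.
  move=> /esym/eqP; rewrite mulf_eq0 gt_eqF //= => /eqP z2.
  have {}z2 : z.2 = 1 / 2 by lra.
  by move: hz; rewrite z1 z2; lra.
- move=> f cf fS.
  have side z : rectangle z -> (z.1 + 1) * (z.1 - 1) * z.2 * (z.2 - 1) = 0 ->
    exists2 s, 0 < s & phi1 (f (iota z)) = s * z.1 /\
                       phi2 (f (iota z)) = s * (2 * z.2 - 1).
    move=> Rz hz; have [s [s0 _ E1 E2]] := phi_iota z.
    by exists s => //; rewrite fS // E1 E2 czE.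
  have rect a b : -1 <= a <= 1 -> 0 <= b <= 1 -> rectangle (a, b).
    by move=> aI bI; split; rewrite /= in_itv.
  apply: square_zero.
  + exact: cts_comp c1 (cts_comp cf ciota).
  + exact: cts_comp c2 (cts_comp cf ciota).
  + move=> b bI; have [||s s0 [-> _] /=] := side (-1, b).
    * by apply: rect => //; lra.
    * by rewrite /=; ring.
    * by rewrite mulrN1 oppr_lt0.
  + move=> b bI; have [||s s0 [-> _] /=] := side (1, b).
    * by apply: rect => //; lra.
    * by rewrite /=; ring.
    * by rewrite mulr1.
  + move=> a aI; have [||s s0 [_ ->] /=] := side (a, 0).
    * by apply: rect => //; lra.
    * by rewrite /=; ring.
    * by rewrite mulr0 sub0r mulrN1 oppr_lt0.
  + move=> a aI; have [||s s0 [_ ->] /=] := side (a, 1).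
    * by apply: rect => //; lra.
    * by rewrite /=; ring.
    * by rewrite mulr_gt0 //; lra.
Qed.

End SawBladeRigid.

Lemma neq_cases (a i : nat) : a != i -> (a + 1 <= i)%N \/ (i + 1 <= a)%N.
Proof. lia. Qed.

Lemma divn_second (i : nat) : ((3 * i + 1) %/ 3 = i)%N.
Proof. lia. Qed.

Lemma modn_second (i : nat) : ((3 * i + 1) %% 3 = 1)%N.
Proof. lia. Qed.

Section SawBladeRigidBoundary.
Context {R : realType} (k : nat).
Hypothesis k0 : (0 < k)%N.

Local Notation w := (saw_blade_word k).
Local Notation n := (size w).
Local Notation X := (saw_blade R k).
Local Notation sheet := (@sheet R k k0).
Local Notation position := (@position R k).
Hypothesis hX : hausdorff_space X.

Let nE : n = (3 * k)%N := size_saw_blade_word k.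
Let n3 : (3 <= n)%N. Proof. by rewrite nE; lia. Qed.
Let n0 : (0 < n)%N. Proof. by lia. Qed.

Definition bump (l : nat) (x : R) : R :=
  Num.max 0 (1 / 2 - `|x - l%:R - 1 / 2|).

Lemma bumpE (l j : nat) (t : R) : 0 <= t <= 1 ->
  bump l (j%:R + t) = if j == l then Num.min t (1 - t) else 0.
Proof.
move=> /andP[t0 t1]; rewrite /bump; case: eqVneq => [->|jl].
  rewrite (_ : l%:R + t - l%:R - 1 / 2 = t - 1 / 2); last by ring.
  have [t2|t2] := leP t (1 / 2).
    by rewrite ler0_norm ?subr_le0 // max_r ?min_l; lra.
  by rewrite ger0_norm ?subr_ge0 ?(ltW t2) // max_r ?min_r; lra.
have [jl'|jl'] := neq_cases jl.
- move: jl'; rewrite -(ler_nat R) natrD => jl'.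
  by rewrite ler0_norm ?max_l; lra.
- move: jl'; rewrite -(ler_nat R) natrD => jl'.
  by rewrite ger0_norm ?max_l; lra.
Qed.

Lemma bump_continuous l : continuous (bump l).
Proof. by rewrite /bump; cts. Qed.

(* Positive on the second and third copies of the letter [i], negative on the
   first: a coordinate transverse to the fold of the first two copies. *)
Definition crossing (i : nat) (x : R) : R :=
  bump (3 * i + 1) x + bump (3 * i + 2) x - bump (3 * i) x.

Lemma crossing_eq0 i j t : 0 <= t <= 1 -> crossing i (j%:R + t) = 0 ->
  (j %/ 3 != i)%N \/ t = 0 \/ t = 1.
Proof.
move=> t01; rewrite /crossing !bumpE //.
have [ji|ji] := eqVneq (j %/ 3)%N i; last by left.
move=> h; right; have : Num.min t (1 - t) = 0.
  by move: h; do 3! case: eqVneq => ?; try lra; lia.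
by rewrite minEle; case: ifP; lra.
Qed.

Lemma crossing_first i t : 0 <= t <= 1 ->
  crossing i ((3 * i)%:R + t) = - Num.min t (1 - t).
Proof.
move=> t01; rewrite /crossing !bumpE // eqxx.
have -> : (3 * i == 3 * i + 1)%N = false by apply/eqP; lia.
have -> : (3 * i == 3 * i + 2)%N = false by apply/eqP; lia.
by ring.
Qed.

Lemma crossing_second i t : 0 <= t <= 1 ->
  crossing i ((3 * i + 1)%:R + t) = Num.min t (1 - t).
Proof.
move=> t01; rewrite /crossing !bumpE // eqxx.
have -> : (3 * i + 1 == 3 * i)%N = false by apply/eqP; lia.
have -> : (3 * i + 1 == 3 * i + 2)%N = false by apply/eqP; lia.
by ring.
Qed.

Lemma crossing_continuous i : continuous (crossing i).
Proof.
have cb l := @bump_continuous l.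
by apply: ctsD; [apply: ctsD|apply: ctsN]; exact: cb.
Qed.

Lemma crossing_wrap i : crossing i 0 = crossing i n%:R.
Proof.
have -> : crossing i 0 = 0.
  rewrite /crossing -[0 in LHS](addr0 0%:R) !bumpE ?lexx ?ler01 //.
  by rewrite subr0 min_l ?ler01 //; do 3! case: ifP => _; ring.
have -> : n%:R = (n.-1)%:R + 1 :> R by rewrite natr1 prednK //; lia.
rewrite /crossing !bumpE ?lexx ?ler01 // subrr min_r ?ler01 //.
by do 3! case: ifP => _; ring.
Qed.

Section Coordinates.
Variables (i : nat) (t0 : R).
Hypotheses (ik : (i < k)%N) (t01 : 0 < t0 <= 1).

Let eta : R := i%:R + 3 / 4 * t0.
Let angle (v : R) : R := 2 * pi * v / k%:R.
Let level (v : R) : R := cos (angle (v - eta)) - cos (angle (t0 / 4)).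

Let kR : 1 <= k%:R :> R. Proof. by rewrite ler1n. Qed.
Let kp : 0 < k%:R :> R. Proof. by rewrite ltr0n. Qed.
Let iR : i%:R + 1 <= k%:R :> R. Proof. by rewrite natr1 ler_nat. Qed.

Let angleD u v : angle (u + v) = angle u + angle v.
Proof. by rewrite /angle; ring. Qed.

Let angleN u : angle (- u) = - angle u.
Proof. by rewrite /angle; ring. Qed.

Let angle_k : angle k%:R = pi *+ 2.
Proof. by rewrite /angle mulfK ?gt_eqF // mulr_natl. Qed.

Let angle_le u v : (angle u <= angle v) = (u <= v).
Proof. by rewrite /angle ler_pM2r ?invr_gt0 // ler_pM2l // mulr_gt0 // pi_gt0. Qed.

Let angle_lt u v : (angle u < angle v) = (u < v).
Proof. by rewrite /angle ltr_pM2r ?invr_gt0 // ltr_pM2l // mulr_gt0 // pi_gt0. Qed.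

Let angle0 : angle 0 = 0.
Proof. by rewrite /angle mulr0 mul0r. Qed.

Let angle_ge0 u : (0 <= angle u) = (0 <= u).
Proof. by rewrite -{1}angle0 angle_le. Qed.

Let angle_gt0 u : (0 < angle u) = (0 < u).
Proof. by rewrite -{1}angle0 angle_lt. Qed.

Let angle2 u v : angle u <= 2 * pi - angle v = (u <= k%:R - v).
Proof. by rewrite -[RHS]angle_le angleD angleN angle_k mulr_natl. Qed.

Let angle2_lt u v : angle u < 2 * pi - angle v = (u < k%:R - v).
Proof. by rewrite -[RHS]angle_lt angleD angleN angle_k mulr_natl. Qed.

Lemma level_le0 v : 0 <= v <= k%:R -> v <= i%:R \/ i%:R + 1 <= v ->
  level v <= 0.
Proof.
have i0 : 0 <= i%:R :> R by [].
have ik1 := iR; have k1 := kR; have /andP[ta tb] := t01.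
move=> /andP[v0 vk] vi; rewrite subr_le0; case: vi => vi.
  rewrite -cosN -angleN; apply: cos_le_sector; rewrite ?angle2 ?angle_ge0 ?angle_le /eta; lra.
by apply: cos_le_sector; rewrite ?angle2 ?angle_ge0 ?angle_le /eta; lra.
Qed.

Lemma level_root v : 0 <= v <= k%:R -> level v = 0 ->
  0 < sin (angle (v - eta)) -> v = i%:R + t0 \/ v = 0 /\ i%:R + t0 = k%:R.
Proof.
have i0 : 0 <= i%:R :> R by [].
have ik1 := iR; have k1 := kR; have /andP[ta tb] := t01.
move=> /andP[v0 vk] /eqP; rewrite subr_eq0 => /eqP E spos.
have apos : 0 < sin (angle (t0 / 4)).
  apply: sin_gt0_pi; rewrite angle_gt0.
  have : angle (t0 / 4 + t0 / 4) < angle k%:R by rewrite angle_lt; lra.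
  by rewrite angleD angle_k; lra.
have S : sin (angle (v - eta)) = sin (angle (t0 / 4)).
  have := cos2Dsin2 (angle (v - eta)); rewrite E.
  have := cos2Dsin2 (angle (t0 / 4)) => h1 h2.
  have /eqP : sin (angle (v - eta)) ^+ 2 = sin (angle (t0 / 4)) ^+ 2 by lra.
  by rewrite eqf_sqr => /orP[]/eqP h; lra.
pose d := v - (i%:R + t0).
have C : cos (angle d) = 1.
  have -> : d = (v - eta) - t0 / 4 by rewrite /d /eta; lra.
  rewrite angleD angleN cosB E S -!expr2; exact: cos2Dsin2.
have far u : 0 < u < k%:R -> cos (angle u) < 1.
  move=> /andP[u0 uk]; rewrite -cos0; apply: cos_lt_sector.
    by rewrite lexx angle_gt0.
  have := angle2_lt u 0; rewrite angle0 => ->; by rewrite subr0.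
have [d0|d0|d0] := ltgtP d 0; last by left; rewrite /d in d0; lra.
- have [dk|dk] := ltP (- k%:R) d; last by right; rewrite /d in dk; lra.
  by have := far (- d); rewrite angleN cosN C ltxx => F; suff : false by []; apply: F; lra.
- have [dk|dk] := ltP d k%:R; last by rewrite /d in dk; lra.
  by have := far d; rewrite C ltxx => F; suff : false by []; apply: F; lra.
Qed.

Lemma level_root_fold v : eta <= v <= i%:R + 1 -> level v = 0 ->
  v = i%:R + t0.
Proof.
have i0 : 0 <= i%:R :> R by [].
have ik1 := iR; have k1 := kR; have /andP[ta tb] := t01.
move=> /andP[v1 v2] /eqP; rewrite subr_eq0 => /eqP E.
have {}v1 : i%:R + 3 / 4 * t0 <= v by [].
apply/eqP; rewrite eq_le !leNgt; apply/andP; split; apply/negP => vt.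
- suff : cos (angle (v - eta)) < cos (angle (t0 / 4)) by rewrite E ltxx.
  by apply: cos_lt_sector; rewrite ?angle2_lt ?angle_ge0 ?angle_le ?angle_lt /eta; lra.
- suff : cos (angle (t0 / 4)) < cos (angle (v - eta)) by rewrite E ltxx.
  by apply: cos_lt_sector; rewrite ?angle2_lt ?angle_ge0 ?angle_le ?angle_lt /eta; lra.
Qed.

Let b : R := 1 - 3 / 4 * t0.

Lemma level_continuous : continuous (fun x => level (position x)).
Proof. by have cp := @position_continuous R k; rewrite /level /angle; cts. Qed.

Lemma boundary_coordinates : exists phi1 phi2 psi : X -> R,
  [/\ continuous phi1, continuous phi2, continuous psi & forall r x,
   0 <= r <= 1 -> 0 <= x <= n%:R ->
   [/\ phi1 (sheet r x) = r * level (position x) - (1 - r) * 3,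
       phi2 (sheet r x) = (1 - r) * r * crossing i x &
       psi (sheet r x) = r * sin (angle (position x - eta))]].
Proof.
have cl := cts_comp level_continuous (@cts_snd (R * R)%type R R _ (@cts_id _)).
have cc := cts_comp (@crossing_continuous i) (@cts_snd (R * R)%type R R _ (@cts_id _)).
have cp := cts_comp (@position_continuous R k)
  (@cts_snd (R * R)%type R R _ (@cts_id _)).
have pn : position n%:R = k%:R := position_n k0.
have p0 : position 0 = 0 := position0 k0.
have wrap_angle : angle (k%:R - eta) = angle (0 - eta) + pi *+ 2.
  by rewrite -angle_k -angleD; congr angle; ring.
have [||||f cf fE] := @sheet_descend R k k0 R
  (fun r x => r * level (position x) - (1 - r) * 3).
- by cts.
- by move=> x y _ _; rewrite !mul0r.
- by move=> r _; rewrite p0 pn /level wrap_angle cosD2pi.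
- by move=> x y _ _ ->.
have [||||g cg gE] := @sheet_descend R k k0 R
  (fun r x => (1 - r) * r * crossing i x).
- by cts.
- by move=> x y _ _; rewrite !mulr0 !mul0r.
- by move=> r _; rewrite crossing_wrap.
- by move=> x y _ _ _; rewrite subrr !mul0r.
have [||||h ch hE] := @sheet_descend R k k0 R
  (fun r x => r * sin (angle (position x - eta))).
- by rewrite /angle; cts.
- by move=> x y _ _; rewrite !mul0r.
- by move=> r _; rewrite p0 pn wrap_angle sinD2pi.
- by move=> x y _ _ ->.
by exists f, g, h; split => // r x r01 x0n; rewrite fE // gE // hE.
Qed.

Lemma boundary_zero r x : 0 <= r <= 1 -> 0 <= x <= n%:R ->
  r * level (position x) - (1 - r) * 3 = 0 ->
  (1 - r) * r * crossing i x = 0 -> r = 1 /\ level (position x) = 0.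
Proof.
move=> /andP[r0 r1] x0n E1 /eqP; rewrite !mulf_eq0 -orbA.
have [j [t [jn t01' xE]]] := floor_split n0 x0n.
case/or3P => /eqP E2; [|by move: E1; rewrite E2; lra|].
  have r_1 : r = 1 by lra.
  by move: E1; rewrite r_1; split => //; lra.
suff : level (position x) <= 0 by split; nra.
apply: level_le0; first exact: position_itv.
rewrite xE in E2 *; rewrite positionE //.
have := crossing_eq0 t01' E2.
have [ji|ji] := eqVneq (j %/ 3)%N i; last first.
  have /andP[t'0 t'1] := orient01 j t01'.
  move=> _; have [ji'|ji'] := neq_cases ji.
    by left; move: ji'; rewrite -(ler_nat R) natrD; lra.
  by right; move: ji'; rewrite -(ler_nat R) natrD; lra.
rewrite ji /orient => -[//|[|]] ->.
  by case: ifP => _; [right|left]; lra.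
by case: ifP => _; [left|right]; lra.
Qed.

Lemma sheet_fold a : -1 <= a <= 1 ->
  [/\ 0 <= (3 * i + 1)%:R + b * a <= n%:R,
      position ((3 * i + 1)%:R + b * a) = i%:R + 1 - b * `|a| &
      sheet 1 ((3 * i + 1)%:R + b * a) = sheet 1 ((3 * i)%:R + (1 - b * `|a|))].
Proof.
move=> aI; have /andP[ta tb] := t01.
have j0n : (3 * i < n)%N by rewrite nE; lia.
have j1n : (3 * i + 1 < n)%N by rewrite nE; lia.
have bI : 0 < b < 1 by rewrite /b; lra.
have j1 := divn_second i.
have j1m := modn_second i.
have [a0|a0] := leP 0 a.
  rewrite ger0_norm //; have tI : 0 <= b * a <= 1 by apply/andP; split; nra.
  have tI' : 0 <= 1 - b * a <= 1 by lra.
  split; first exact: edge_itv.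
    by rewrite positionE // /orient j1 j1m /=; ring.
  have := @sheet_edge R k k0 (3 * i + 1) (3 * i) (1 - b * a) j1n j0n.
  rewrite /orient modnMr j1m /= j1 mulKn // => /(_ erefl tI').
  by rewrite (_ : 1 - (1 - b * a) = b * a) //; ring.
rewrite ltr0_norm //; have tI : 0 <= 1 + b * a <= 1 by apply/andP; split; nra.
have -> : (3 * i + 1)%:R + b * a = (3 * i)%:R + (1 + b * a) by rewrite natrD; ring.
have -> : 1 - b * - a = 1 + b * a by ring.
split=> //; first exact: edge_itv.
by rewrite positionE // /orient mulKn // modnMr /= ?opprK; ring.
Qed.

Lemma boundary_not_labile_at : ~ labile (sheet 1 ((3 * i)%:R + t0)).
Proof.
set p := sheet 1 _.
have /andP[ta tb] := t01; have ik1 := iR; have k1 := kR.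
have i0 : 0 <= i%:R :> R by [].
have j0n : (3 * i < n)%N by rewrite nE; lia.
have t0I : 0 <= t0 <= 1 by rewrite ltW.
have r11 : 0 <= (1 : R) <= 1 by rewrite ler01 lexx.
have pI : 0 <= (3 * i)%:R + t0 <= n%:R by exact: edge_itv.
have pP : position ((3 * i)%:R + t0) = i%:R + t0.
  by rewrite positionE // /orient mulKn // modnMr.
have [phi1 [phi2 [psi [c1 c2 cpsi phiE]]]] := boundary_coordinates.
pose iota (z : R * R) : X := sheet (1 - z.2 / 2) ((3 * i + 1)%:R + b * z.1).
have b0 : 0 < b < 1 by rewrite /b; lra.
have ciota : continuous iota.
  have cz : continuous (fun z : R * R => (1 - z.2 / 2, (3 * i + 1)%:R + b * z.1)).
    by cts.
  exact: (cts_comp (@sheet_continuous R k k0) cz).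
have iotaE z : rectangle z -> let r := 1 - z.2 / 2 in
    let x := (3 * i + 1)%:R + b * z.1 in
    [/\ 0 <= r <= 1, 0 <= x <= n%:R & position x = i%:R + 1 - b * `|z.1|].
  move=> [/=]; rewrite !in_itv /= => z1 z2.
  by have [? ? _] := sheet_fold z1; split => //; lra.
have zero_iota z : rectangle z -> phi1 (iota z) = 0 -> phi2 (iota z) = 0 ->
    iota z = p.
  move=> Rz; have [rI xI xP] := iotaE z Rz; have [-> -> _] := phiE _ _ rI xI.
  move=> E1 E2; have [r1 L] := boundary_zero rI xI E1 E2.
  rewrite /iota r1; apply: sheet_position => //.
  rewrite pP; apply: level_root_fold L; rewrite xP.
  case: Rz => /=; rewrite !in_itv /= => z1 _.
  have za : `|z.1| <= 1 by rewrite ler_norml.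
  have zb : 0 <= `|z.1| by [].
  by rewrite /eta; move: za zb; rewrite /b => za zb; apply/andP; split; nra.
have [p1 p2 p3] : [/\ phi1 p = 0, phi2 p = 0 & 0 < psi p].
  have [-> -> ->] := phiE _ _ r11 pI; rewrite pP subrr !mul0r subr0 !mul1r.
  have -> : i%:R + t0 - eta = t0 / 4 by rewrite /eta; lra.
  split => //; first by rewrite /level (_ : _ - eta = t0 / 4) ?subrr // /eta; lra.
  apply: sin_gt0_pi; rewrite angle_gt0.
  have : angle (t0 / 4 + t0 / 4) < angle k%:R by rewrite angle_lt; lra.
  by rewrite angleD angle_k; lra.
have level_lt x : level x <= 2.
  by rewrite /level; have := cos_le1 (angle (x - eta)); have := cos_geN1 (angle (t0 / 4)); lra.
have corner : 0 < level eta.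
  rewrite /level subrr angle0 subr_gt0; apply: cos_lt_sector.
    by rewrite lexx angle_gt0; lra.
  by have := angle2_lt (t0 / 4) 0; rewrite angle0 => ->; lra.
have rect a c : -1 <= a <= 1 -> 0 <= c <= 1 -> rectangle (a, c).
  by move=> aI bI; split; rewrite /= in_itv.
have cross_left : crossing i ((3 * i + 1)%:R + b * -1) < 0.
  rewrite (_ : _ + _ = (3 * i)%:R + (1 - b)); last by rewrite natrD; ring.
  by rewrite crossing_first; [rewrite minEle; case: ifP => _; lra|lra].
have cross_right : 0 < crossing i ((3 * i + 1)%:R + b * 1).
  by rewrite mulr1 crossing_second; [rewrite minEle; case: ifP => _; lra|lra].
have side z : rectangle z ->
    [/\ phi1 (iota z) = (1 - z.2 / 2) * level (i%:R + 1 - b * `|z.1|) - z.2 / 2 * 3 &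
     phi2 (iota z) = z.2 / 2 * (1 - z.2 / 2) * crossing i ((3 * i + 1)%:R + b * z.1)].
  move=> Rz; have [rI xI xP] := iotaE z Rz; have [-> -> _] := phiE _ _ rI xI.
  by rewrite xP; split; ring.
have etaE : i%:R + 1 - b * 1 = eta by rewrite /b /eta; ring.
apply: (@not_labile R X p phi1 phi2 [set x | 0 < psi x] iota
  (fun z => (z.1 + 1) * (z.1 - 1) * (z.2 - 1))) => //.
- apply: (cpsi p [set x | 0 < x]); apply: open_nbhs_nbhs; split.
    exact: open_gt.
  exact: p3.
- by cts.
- move=> x; have [r [x' [rI x'n <-]]] := sheet_surj k0 x.
  move=> /=; have [-> -> ->] := phiE _ _ rI x'n => psi0 E1 E2.
  have [r1 L] := boundary_zero rI x'n E1 E2.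
  rewrite r1 mul1r in psi0 *.
  have [v|[v vk]] := level_root (position_itv k0 x') L psi0.
    by apply: sheet_position; rewrite ?pP.
  by apply: sheet_position_wrap; rewrite ?pP.
- move=> z Rz hz zp.
  have [E1 E2] := side z Rz; rewrite zp p1 p2 in E1 E2.
  case: z Rz hz zp E1 E2 => z1 z2 [/=]; rewrite !in_itv /= => z1I z2I hz _ E1 E2.
  have [z21|z21] := eqVneq z2 1.
    by move: E1; rewrite z21; have := level_lt (i%:R + 1 - b * `|z1|); lra.
  have z1E : z1 = 1 \/ z1 = -1.
    move/eqP: hz; rewrite !mulf_eq0 [z2 - 1 == 0]subr_eq0 (negPf z21) orbF.
    by case/orP => /eqP; lra.
  have z20 : z2 = 0.
    apply/eqP; apply: contraT => z20.
    move/esym/eqP: E2; rewrite mulf_eq0 => /orP[|/eqP E2]; last first.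
      by case: z1E E2 => ->; lra.
    rewrite mulf_eq0 => /orP[]/eqP => [E3|E3]; last by lra.
    by move/eqP: z20; lra.
  have nz : `|z1| = 1 by case: z1E => ->; rewrite ?normrN normr1.
  by move: E1; rewrite z20 nz etaE; lra.
- move=> f cf fS; apply: folded_zero.
  + exact: cts_comp c1 (cts_comp cf ciota).
  + exact: cts_comp c2 (cts_comp cf ciota).
  + move=> c /andP[c0 cI].
    have Rz : rectangle (-1, c) by apply: rect; lra.
    rewrite fS //=; last by ring.
    have [_ ->] := side _ Rz; by rewrite /= pmulr_rlt0 ?cross_left // mulr_gt0 //; lra.
  + move=> c cI; have Rz : rectangle (1, c) by apply: rect; lra.
    rewrite fS //=; last by ring.
    by have [_ ->] := side _ Rz; rewrite /= mulr_ge0 ?mulr_ge0 ?(ltW cross_right) //; lra.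
  + move=> a aI; have Rz : rectangle (a, 1) by apply: rect; lra.
    rewrite fS //=; last by ring.
    have [-> _] := side _ Rz; rewrite /=.
    by have := level_lt (i%:R + 1 - b * `|a|); lra.
  + have Rz : rectangle ((1 : R), (0 : R)) by apply: rect; lra.
    rewrite fS //=; last by ring.
    by have [-> _] := side _ Rz; rewrite /= normr1 etaE; lra.
  + move=> a aI; suff -> : iota (- a, 0) = iota (a, 0) by [].
    rewrite /iota /= mul0r subr0.
    have [|_ _ ->] := @sheet_fold (- a); first by lra.
    by have [|_ _ ->] := @sheet_fold a; [lra|rewrite normrN].
Qed.

End Coordinates.
End SawBladeRigidBoundary.

(** * Free faces *)

Section FreeFace.
Context {R : realType} {V : finType}.
Variables (K : {set {set V}}) (s t : {set V}).
Hypotheses (sK : simplicial_complex K) (st : free_face K s t).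

Local Notation X := (realization R K).
Local Notation coord x v := ((set_val (x : X) : V -> R) v).

Let m : R := #|s|%:R.

Lemma free_face_apex : exists2 b, b \notin s & t = (b |: s)%SET.
Proof.
have /and5P[_ _ /properP[s_t [b bt bs]] /eqP ts _] := st.
exists b => //; apply/eqP; rewrite eq_sym eqEcard cardsU1 bs ts leqnn andbT.
by apply/fintype.subsetP => v; rewrite !inE => /predU1P[->|/(fintype.subsetP s_t)].
Qed.

Lemma free_face_maximal u : u \in K -> s \subset u -> u = s \/ u = t.
Proof.
move=> uK su; have /and5P[_ _ _ _ /forall_inP/(_ u uK)] := st.
have [<-|nsu] := eqVneq s u; first by left.
by rewrite finset.properEneq nsu su /= => /eqP ->; right.
Qed.

Lemma card_free_face_gt0 : 0 < m.
Proof.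
rewrite ltr0n lt0n cards_eq0; apply/eqP => s0.
by have /and5P[+ _ _ _ _] := st; rewrite s0 => /negP; case: sK => /negP.
Qed.

Lemma coord_continuous v : continuous (fun x : X => coord x v).
Proof.
apply: (@cts_comp _ _ _ set_val (fun y : {ptws V -> R} => y v)).
  exact: ptws_eval_continuous.
exact: set_val_continuous.
Qed.

Lemma coord_ge0 (x : X) v : 0 <= coord x v.
Proof. by have [h _ _] := set_valP x; exact: h. Qed.

Lemma coord_sum (x : X) : \sum_v coord x v = 1.
Proof. by have [_ h _] := set_valP x; exact: h. Qed.

Lemma coord_support (x : X) : [set v | coord x v != 0]%SET \in K.
Proof. by have [_ _ h] := set_valP x; exact: h. Qed.

Lemma barycenter_in :
  (fun v => if v \in s then m^-1 else 0) \in (@barycentric_points V R K).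
Proof.
have m0 := card_free_face_gt0.
apply/mem_set; split => [v||].
- by case: ifP => // _; rewrite invr_ge0 ltW.
- by rewrite -big_mkcond /= sumr_const -[_ *+ _]mulr_natl divff // gt_eqF.
- rewrite (_ : [set v | _]%SET = s); first by have /and5P[] := st.
  apply/setP => v; rewrite inE; case: ifP => _; last by rewrite eqxx.
  by rewrite invr_neq0 // gt_eqF.
Qed.

Definition barycenter : X := SigSub barycenter_in.

Lemma barycenterE v : coord barycenter v = if v \in s then m^-1 else 0.
Proof. by rewrite set_valE. Qed.

Definition low (x : X) : R := \big[Num.min/1]_(v in s) coord x v.

Lemma low_continuous : continuous low.
Proof.
rewrite /low; elim: (index_enum V) => [|v r IH].
  by under eq_fun do rewrite big_nil; exact: cts_cst.
under eq_fun do rewrite big_cons.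
by case: (v \in s) => //; apply: cts_min => //; exact: coord_continuous.
Qed.

Definition core (e : R) : set X := [set x | forall v, v \in s -> m^-1 - e <= coord x v].

Lemma core_near e x v : core e x -> 0 <= e -> `|coord x v - coord barycenter v| <= m * e.
Proof.
move=> xe e0; have m0 := card_free_face_gt0.
have S : \sum_(u in s) (coord x u - (m^-1 - e)) + \sum_(u | u \notin s) coord x u = m * e.
  rewrite sumrB sumr_const -/m -mulr_natl mulrBr divff ?gt_eqF //.
  have := coord_sum x; rewrite (bigID (mem s)) /= => E.
  by lra.
have S1 : 0 <= \sum_(u in s) (coord x u - (m^-1 - e)).
  by apply: sumr_ge0 => u us; rewrite subr_ge0 xe.
have S2 : 0 <= \sum_(u | u \notin s) coord x u.
  by apply: sumr_ge0 => u us; exact: coord_ge0.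
rewrite barycenterE; case: ifPn => vs.
  have : coord x v - (m^-1 - e) <= \sum_(u in s) (coord x u - (m^-1 - e)).
    rewrite (bigD1 v) //= lerDl; apply: sumr_ge0 => u /andP[us _].
    by rewrite subr_ge0 xe.
  have := xe v vs.
  have e_me : e <= m * e.
    by rewrite ler_peMl // ler1n card_gt0 -cards_eq0 -lt0n -(ltr0n R).
  by move=> h1 h2; rewrite ler_norml; lra.
have : coord x v <= \sum_(u | u \notin s) coord x u.
  by rewrite (bigD1 v) //= lerDl; apply: sumr_ge0 => u _; exact: coord_ge0.
by move=> h; rewrite subr0 ger0_norm ?coord_ge0 //; lra.
Qed.

Lemma core_nbhs (U : set X) : nbhs barycenter U ->
  exists e, [/\ 0 < e, e < m^-1 & core e `<=` U].
Proof.
have m0 := card_free_face_gt0.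
move=> [B /= [[W oW <-]] /= Wp BU].
pose F : set_system {ptws V -> R} :=
  filter_from [set e : R | 0 < e] (fun e => set_val @` core e).
have FF : Filter F.
  apply: filter_from_filter; first by exists 1; rewrite /= ltr01.
  move=> e d e0 d0; exists (Num.min e d); first by rewrite /= lt_min e0.
  move=> _ [x xe <-]; split; exists x => // v vs; apply: le_trans (xe v vs);
    by rewrite lerB // ge_min lexx ?orbT.
have Fp : F --> (set_val barycenter : {ptws V -> R}).
  apply/cvg_sup => v C [] /= D [[E oE <-] Ep] EC.
  have /nbhs_ballP[e e0 eE] : nbhs (coord barycenter v) E by exact: open_nbhs_nbhs.
  exists (e / 2 / m) => /=; first by rewrite !divr_gt0.
  move=> _ [x xe <-]; apply: EC; apply: eE; rewrite /ball /= distrC.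
  apply: le_lt_trans (core_near v xe _) _; first by rewrite !divr_ge0 // ltW.
  have e0' : 0 < e := e0.
  have -> : m * (e / 2 / m) = e / 2 by rewrite mulrC divfK // gt_eqF.
  by lra.
have [e e0 eW] : F W by apply: Fp; exact: open_nbhs_nbhs.
exists (Num.min e (m^-1 / 2)); split.
- by rewrite lt_min e0 divr_gt0 // invr_gt0.
- have mi : 0 < m^-1 by rewrite invr_gt0.
  by rewrite gt_min; apply/orP; right; lra.
- move=> x xe; apply: BU; apply: eW; exists x => // v vs.
  by apply: le_trans (xe v vs); rewrite lerB // ge_min lexx.
Qed.

Lemma free_face_labile : exists p : X, labile p.
Proof.
have [b bs tE] := free_face_apex; have m0 := card_free_face_gt0.
exists barycenter => U /core_nbhs[e [e0 em eU]].
pose delta (x : X) : R := Num.max 0 (low x - (m^-1 - e)).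
have cd : continuous delta.
  by have cl := low_continuous; rewrite /delta; cts.
have delta_ge0 x : 0 <= delta x by rewrite le_max lexx.
have low_le x v : v \in s -> low x <= coord x v by move=> vs; exact: bigmin_le_cond.
have delta_le x v : v \in s -> delta x <= coord x v.
  move=> vs; rewrite ge_max coord_ge0 /=.
  by have := low_le x v vs; lra.
pose g (x : X) : V -> R := fun v =>
  coord x v - (v \in s)%:R * delta x + (v == b)%:R * (m * delta x).
have bsF : (b \in s) = false by apply/negbTE.
have gP x : g x \in (@barycentric_points V R K).
  apply/mem_set.
  have g0 v : 0 <= g x v.
    rewrite /g; apply: addr_ge0; last by rewrite !mulr_ge0 // ltW.
    by case: (boolP (v \in s)) => vs; rewrite ?mul1r ?mul0r ?subr0 ?coord_ge0 // subr_ge0 delta_le.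
  have g1 : \sum_v g x v = 1.
    rewrite big_split sumrB /= coord_sum -!mulr_suml.
    have -> : \sum_v (v == b)%:R = 1 :> R.
      by rewrite (bigD1 b) //= eqxx big1 ?addr0 // => v /negPf ->.
    have -> : \sum_v (v \in s)%:R = m :> R.
      rewrite /m -sum1_card natr_sum [RHS]big_mkcond /=.
      by apply: eq_bigr => v _; case: (v \in s).
    by ring.
  split => //; have [d0|d0] := eqVneq (delta x) 0.
    rewrite (_ : g x = set_val x) ?coord_support //.
    by apply/funext => v; rewrite /g d0 !mulr0 subr0 addr0.
  have dpos : 0 < delta x by rewrite lt_def d0 delta_ge0.
  have ssup : s \subset [set v | coord x v != 0]%SET.
    apply/fintype.subsetP => v vs; rewrite inE gt_eqF //.
    exact: lt_le_trans dpos (delta_le x v vs).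
  have supt : [set v | coord x v != 0]%SET \subset t.
    have [->|->] := free_face_maximal (coord_support x) ssup; last exact: subxx.
    by rewrite tE finset.subsetUr.
  case: sK => _; apply; first by have /and5P[_ h _ _ _] := st; exact: h.
  - apply/eqP => g00; move: g1; rewrite big1 => [/esym/eqP|v _]; first by rewrite oner_eq0.
    by apply/eqP; move/setP/(_ v): g00; rewrite !inE => /negbT; rewrite negbK.
  - apply/fintype.subsetP => v; rewrite inE; apply: contraR => vt.
    have vs : v \notin s by apply: contra vt => vs; rewrite tE inE vs orbT.
    have vb : v != b by apply: contra vt => /eqP ->; rewrite tE finset.setU11.
    rewrite /g (negPf vs) (negPf vb) !mul0r subr0 addr0.
    by apply: contraR vt => xv; apply: (fintype.subsetP supt); rewrite inE.
pose f (x : X) : X := SigSub (gP x).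
have fE x v : coord (f x) v = g x v by rewrite set_valE.
have f_id x : delta x = 0 -> f x = x.
  move=> d0; apply: val_inj; apply/funext => v.
  have -> : \val (f x) v = coord (f x) v by rewrite set_valE.
  by rewrite fE /g d0 !mulr0 subr0 addr0 set_valE.
exists f; split.
- apply: set_type_continuous; apply: ptws_continuous => v.
  rewrite (_ : (fun x => _) = fun x => g x v); last by apply/funext => x; exact: fE.
  by have cv := @coord_continuous v; rewrite /g; cts.
- move=> x xU; apply: f_id; apply/max_l; rewrite subr_le0 leNgt; apply/negP => xl.
  by apply/xU/eU => v vs; apply: le_trans (low_le x v vs); exact: ltW.
- move=> x xU; have [/f_id -> //|d0] := eqVneq (delta x) 0.
  apply: eU => v vs; rewrite fE /g vs mul1r.
  have -> : (v == b) = false by apply/eqP => vb; rewrite -vb vs in bsF.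
  have E : delta x = low x - (m^-1 - e).
    by move: d0; rewrite /delta; case: leP => //; rewrite ?eqxx.
  by rewrite E mul0r addr0; have := low_le x v vs; lra.
- move=> x fp; have := fE x b; rewrite fp barycenterE bsF /g bsF eqxx mul0r subr0 mul1r.
  have := coord_ge0 x b; have := delta_ge0 x => d0 xb /esym E.
  have {}d0 : delta x = 0 by apply/eqP; rewrite eq_le d0 andbT; nra.
  have xp : x = barycenter by rewrite -fp f_id.
  move: d0; rewrite xp /delta max_r; last first.
    rewrite subr_ge0; apply: le_trans (_ : m^-1 <= _); first by lra.
    apply/bigmin_geP; split; last by move=> v vs; rewrite barycenterE vs.
    rewrite invf_le1 // ler1n; move: m0; rewrite ltr0n; exact.
  suff : low barycenter = m^-1 by move=> ->; lra.
  apply/eqP; rewrite eq_le; apply/andP; split.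
    have /set0Pn[v vs] : s != finset.set0 by rewrite -cards_eq0 -lt0n -(ltr0n R).
    by have := low_le barycenter v vs; rewrite barycenterE vs.
  apply/bigmin_geP; split; last by move=> v vs; rewrite barycenterE vs.
  by rewrite invf_le1 // ler1n; move: m0; rewrite ltr0n.
Qed.

End FreeFace.

Lemma collapsible_labile (R : realType) (V : finType) (K : {set {set V}}) :
  simplicial_complex K -> collapsible K ->
  (exists p : realization R K, labile p) \/ (exists v, K = [set [set v]]%SET).
Proof.
move=> sK /existsP[v /connectP[[|L p]] /=]; first by move=> _ <-; right; exists v.
move=> /andP[/existsP[s /existsP[t /andP[st _]]] _] _; left.
exact: free_face_labile st.
Qed.

Lemma saw_blade_not_labile (R : realType) (k : nat) (p : saw_blade R k) :
  (0 < k)%N -> hausdorff_space (saw_blade R k) -> ~ labile p.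
Proof.
move=> k0 hX; have [r [x [r01 x0n <-]]] := sheet_surj k0 p.
have [r1|r1] := ltP r 1.
  by apply: interior_not_labile => //; case/andP: r01 => ->.
have -> : r = 1 by lra.
have [i [t [ik t01 _ ->]]] := sheet_first k0 x0n.
have [t0|t0] := eqVneq t 0; last first.
  have /andP[t00 t1] := t01.
  by apply: boundary_not_labile_at; rewrite // lt_def t0 t00.
rewrite t0 addr0; case: i ik => [|i] ik; last first.
  by rewrite -sheet_junction ?(ltnW ik) //; apply: boundary_not_labile_at;
    rewrite ?ltr01 ?lexx // ltnW.
rewrite muln0 {1}/sheet polar_wrap -/(sheet k0 1 _) size_saw_blade_word.
rewrite -[X in (3 * X)%N](prednK k0) -sheet_junction ?prednK //.
by apply: boundary_not_labile_at; rewrite ?ltr01 ?lexx ?prednK.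
Qed.

Lemma single_vertex_realization (R : realType) (V : finType) (v : V)
    (x y : realization R [set [set v]]%SET) : x = y.
Proof.
have E (z : realization R [set [set v]]%SET) u :
    (set_val z : V -> R) u = (u == v)%:R.
  have [z0 z1 zs] := set_valP z.
  have out u' : u' != v -> (set_val z : V -> R) u' = 0.
    move=> uv; apply/eqP; move: zs; rewrite finset.in_set1 => /eqP/setP/(_ u').
    by rewrite !inE (negPf uv) => /negbT; rewrite negbK.
  have [->|/out //] := eqVneq u v.
  by move: z1; rewrite (bigD1 v) //= big1 ?addr0 // => u' /out.
apply: val_inj; apply/funext => u; rewrite -!set_valE.
by rewrite (E x) (E y).
Qed.

Lemma saw_blade_two_points (R : realType) (k : nat) : (0 < k)%N ->
  exists x y : saw_blade R k, x <> y.
Proof.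
move=> k0; have [rho _ rhoE] := @radius_exists R k k0.
exists (sheet k0 0 0), (sheet k0 1 0) => /(congr1 rho).
rewrite !rhoE ?lexx ?ler01 ?ler0n // => /eqP.
by rewrite eq_sym oner_eq0.
Qed.

Lemma triangulation_contractible_not_collapsible (R : realType) (k : nat)
    (V : finType) (K : {set {set V}}) : (1 <= k)%N ->
  triangulates R K (saw_blade R k) ->
  contractible R (realization R K) /\ ~~ collapsible K.
Proof.
move=> k0 [sK KX]; have hX := homeomorphic_hausdorff KX (@realization_hausdorff R V K).
split.
  apply: homeomorphic_contractible (homeomorphic_sym KX) _.
  have [c cc cE] := @circle_exists R k k0.
  exact: saw_blade_contractible cc cE hX.
apply/negP => /(collapsible_labile R sK)[lK|[v Kv]].
  by have [p] := homeomorphic_labile KX lK; exact: saw_blade_not_labile.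
have [x [y]] := saw_blade_two_points R k0; apply.
have [f [g [_ gK _ _]]] := KX; apply: (can_inj gK).
by subst K; exact: single_vertex_realization.
Qed.

(** * Bistellar moves *)

Section SeqMin.
Context {R : realType}.
Implicit Types (x y : nat -> R) (A B : seq nat).

Definition seqmin x A : R :=
  if A is a :: A' then foldr (fun b r => Num.min (x b) r) (x a) A' else 0.

Lemma seqmin_le x A a : a \in A -> seqmin x A <= x a.
Proof.
case: A => // b A; rewrite inE /=.
elim: A => /= [|c A IH]; first by rewrite orbF => /eqP ->.
rewrite inE ge_min orbCA => /predU1P[->|/IH ->]; rewrite ?lexx ?orbT //.
Qed.

Lemma seqmin_attained x A : A != [::] -> exists2 a, a \in A & seqmin x A = x a.
Proof.
case: A => // b A _ /=; elim: A => /= [|c A [a aA ->]].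
  by exists b; rewrite ?mem_head.
have [xac|xca] := leP (x c) (x a); first by exists c; rewrite ?min_l // !inE eqxx orbT.
exists a; first by move: aA; rewrite !inE => /predU1P[->|->]; rewrite ?eqxx ?orbT.
by rewrite ?min_r // ltW.
Qed.

Lemma seqmin_eq x A r : A != [::] -> (forall a, a \in A -> r <= x a) ->
  (exists2 a, a \in A & x a = r) -> seqmin x A = r.
Proof.
move=> A0 rx [a aA xa]; have [b bA E] := seqmin_attained x A0.
by apply/eqP; rewrite eq_le -{1}xa seqmin_le // E rx.
Qed.

Lemma seqmin_ge0 x A : (forall v, 0 <= x v) -> 0 <= seqmin x A.
Proof.
move=> x0; have [->|A0] := eqVneq A [::]; first by [].
by have [a _ ->] := seqmin_attained x A0.
Qed.

Lemma seqmin_continuous (T : topologicalType) (Phi : nat -> T -> R) A :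
  (forall v, continuous (Phi v)) ->
  continuous (fun t => seqmin (Phi^~ t) A).
Proof.
move=> cP; case: A => [|a A] /=; first exact: cts_cst.
elim: A => [|b A IH] /=; first exact: cP.
by apply: cts_min => //; exact: cP.
Qed.

(* The affine relation identifying the barycenters of [A] and [B] moves the
   largest possible multiple of the barycenter of [A] over to that of [B]. *)
Definition transfer A B x (v : nat) : R :=
  x v - (v \in A)%:R * seqmin x A
      + (v \in B)%:R * (seqmin x A * (size A)%:R / (size B)%:R).

Lemma transfer_id A B x v : seqmin x A = 0 -> transfer A B x v = x v.
Proof. by move=> E; rewrite /transfer E !mul0r !mulr0 subr0 addr0. Qed.

Lemma transfer_continuous (T : topologicalType) (Phi : nat -> T -> R) A B v :
  (forall v, continuous (Phi v)) -> continuous (fun t => transfer A B (Phi^~ t) v).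
Proof.
move=> cP; have cm := @seqmin_continuous T Phi A cP; have cv := cP v.
by rewrite /transfer; cts.
Qed.

Section Transfer.
Variables (A B : seq nat).
Hypotheses (A0 : A != [::]) (B0 : B != [::]) (uAB : uniq (A ++ B)).

Let uA : uniq A. Proof. by move: uAB; rewrite cat_uniq => /and3P[]. Qed.
Let uB : uniq B. Proof. by move: uAB; rewrite cat_uniq => /and3P[]. Qed.
Let notA v : v \in B -> (v \in A) = false.
Proof.
by move: uAB; rewrite cat_uniq => /and3P[_ /hasPn h _] /h/negbTE.
Qed.
Let notB v : v \in A -> (v \in B) = false.
Proof. by move=> vA; apply/negP => /notA; rewrite vA. Qed.
Let sA : 0 < (size A)%:R :> R. Proof. by rewrite ltr0n lt0n size_eq0. Qed.
Let sB : 0 < (size B)%:R :> R. Proof. by rewrite ltr0n lt0n size_eq0. Qed.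

Lemma transfer_ge0 x v : (forall v, 0 <= x v) -> 0 <= transfer A B x v.
Proof.
move=> x0; have m0 := seqmin_ge0 A x0; rewrite /transfer addr_ge0 //; last first.
  by rewrite mulr_ge0 // !mulr_ge0 // invr_ge0 ltW.
case: (boolP (v \in A)) => [/(seqmin_le x) h|_]; last by rewrite mul0r subr0.
by rewrite mul1r subr_ge0.
Qed.

Lemma sum_mem M (S : seq nat) : uniq S -> all (fun v => v < M)%N S ->
  \sum_(v < M) (val v \in S)%:R = (size S)%:R :> R.
Proof.
move=> uS /allP SM; rewrite -natr_sum; congr (_%:R).
rewrite -(big_mkord xpredT (fun v => (v \in S) : nat)).
rewrite (eq_bigr (fun v => if v \in S then 1 else 0)%N) => [|v _]; last by case: ifP.
rewrite -big_mkcond sum1_count.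
have /perm_size <- : perm_eq [seq v <- index_iota 0 M | v \in S] S.
  apply: uniq_perm => //; first by rewrite filter_uniq // iota_uniq.
  move=> v; rewrite mem_filter mem_index_iota /=.
  by case: (boolP (v \in S)) => //= /SM ->.
by rewrite size_filter.
Qed.

Lemma transfer_sum M x : all (fun v => v < M)%N (A ++ B) ->
  \sum_(v < M) transfer A B x v = \sum_(v < M) x v.
Proof.
rewrite all_cat => /andP[AM BM].
rewrite big_split sumrB /= -!mulr_suml !sum_mem //.
rewrite [X in _ + X]mulrC divfK ?gt_eqF //; ring.
Qed.

Lemma transferK x b : b \in B -> x b = 0 -> (forall v, 0 <= x v) ->
  forall v, transfer B A (transfer A B x) v = x v.
Proof.
move=> bB xb x0 v; have m0 := seqmin_ge0 A x0.
pose m := seqmin x A.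
have E : seqmin (transfer A B x) B = m * (size A)%:R / (size B)%:R.
  apply: seqmin_eq => // [c cB|].
    by rewrite /transfer notA // cB mul0r subr0 mul1r lerDr.
  by exists b => //; rewrite /transfer notA // bB xb mul0r subr0 add0r mul1r.
rewrite {1}/transfer E /transfer -/m.
have -> : m * (size A)%:R / (size B)%:R * (size B)%:R / (size A)%:R = m.
  by field; rewrite !gt_eqF.
by ring.
Qed.

Lemma transfer_support x v : (forall v, 0 <= x v) -> transfer A B x v != 0 ->
  x v != 0 \/ v \in B.
Proof.
move=> x0; case: (boolP (v \in B)) => [vB|vB]; first by right.
have [xv|] := eqVneq (x v) 0; last by left.
rewrite /transfer (negPf vB) xv mul0r addr0 sub0r oppr_eq0.
case: (boolP (v \in A)) => [vA|_]; last by rewrite mul0r eqxx.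
have := seqmin_ge0 A x0; have := seqmin_le x vA; rewrite xv mul1r => h1 h2.
by rewrite (_ : seqmin x A = 0) ?eqxx //; lra.
Qed.

Lemma transfer_vanish x : exists2 a, a \in A & transfer A B x a = 0.
Proof.
have [a aA E] := seqmin_attained x A0; exists a => //.
by rewrite /transfer aA notB // E mul1r subrr mul0r addr0.
Qed.

End Transfer.
End SeqMin.

Section Chart.
Context {R : realType} {T : topologicalType}.
Implicit Types (fs : seq nat -> Prop) (A B : seq nat).

Definition spanned (M : nat) fs (z : nat -> R) : Prop :=
  [/\ forall v, 0 <= z v, \sum_(v < M) z v = 1 &
      exists2 f, fs f & forall v, z v != 0 -> v \in f].

Definition chart (M : nat) fs (Phi : nat -> T -> R) : Prop :=
  [/\ forall v, continuous (Phi v), forall t, spanned M fs (Phi^~ t),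
      forall s t, (forall v, Phi v s = Phi v t) -> s = t &
      forall z, spanned M fs z -> exists t, forall v, Phi v t = z v].

(* [fs'] arises from [fs] by replacing the faces containing [A], which are
   those of the join of [A] with the boundary of [B], by the join of the
   boundary of [A] with [B]. *)
Definition move (M : nat) A B fs fs' : Prop :=
  [/\ [/\ A != [::], B != [::], uniq (A ++ B) & all (fun v => v < M)%N (A ++ B)],
      forall f, fs f -> exists2 b, b \in B & b \notin f,
      (forall f, fs f -> {subset A <= f} -> {subset f <= A ++ B}) /\
      (forall b, b \in B -> exists2 f, fs f & {subset rem b (A ++ B) <= f}),
      (forall f, fs f -> (exists2 a, a \in A & a \notin f) ->
        exists2 f', fs' f' & {subset f <= f'}) /\
      (forall a, a \in A -> exists2 f', fs' f' & {subset rem a (A ++ B) <= f'}) &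
      forall f', fs' f' ->
        (exists2 a, a \in A & a \notin f') /\
        ({subset f' <= A ++ B} \/ exists2 f, fs f & {subset f' <= f})].

Lemma move_spanned M A B fs fs' z : move M A B fs fs' -> spanned M fs z ->
  spanned M fs' (transfer A B z) /\ forall v, transfer B A (transfer A B z) v = z v.
Proof.
move=> [[A0 B0 uAB AB_M] lackB [coA _] [keep new] _] [z0 z1 [f ff zf]].
have [b bB bf] := lackB f ff.
have zb : z b = 0 by apply/eqP; apply: contraR bf => /zf.
split; last by move=> v; apply: transferK zb z0 v.
split; [by move=> v; exact: transfer_ge0|by rewrite transfer_sum|].
have uA : uniq A by move: uAB; rewrite cat_uniq => /and3P[].
have [a aA a0] := transfer_vanish A0 uAB z.
have [m0|m0] := eqVneq (seqmin z A) 0; last first.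
  have [f' ff' f's] := new a aA; exists f' => // v vs; apply: f's.
  rewrite mem_rem_uniq // !inE; apply/andP; split.
    by apply: contraNneq vs => ->; rewrite a0.
  have [zv|vB] := transfer_support z0 vs; last by rewrite mem_cat vB orbT.
  apply: (coA f ff); last exact: zf.
  move=> c cA; apply: zf; rewrite gt_eqF //.
  by apply: lt_le_trans (seqmin_le z cA); rewrite lt_def m0 seqmin_ge0.
have zs v : transfer A B z v = z v by exact: transfer_id.
have za : z a = 0 by rewrite -zs.
have [af|af] := boolP (a \in f); last first.
  have [f' ff' f's] := keep f ff (ex_intro2 _ _ a aA af).
  by exists f' => // v; rewrite zs => /zf/f's.
have [/hasP[c cA cf]|/hasPn Af] := boolP (has (fun c => c \notin f) A).
  have [f' ff' f's] := keep f ff (ex_intro2 _ _ c cA cf).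
  by exists f' => // v; rewrite zs => /zf/f's.
have [f' ff' f's] := new a aA; exists f' => // v; rewrite zs => zv; apply: f's.
rewrite mem_rem_uniq // !inE; apply/andP; split.
  by apply: contraNneq zv => ->; rewrite za.
by apply: (coA f ff (fun c cA => negPn (Af c cA))); exact: zf.
Qed.

Lemma move_sym M A B fs fs' : move M A B fs fs' -> move M B A fs' fs.
Proof.
move=> [[A0 B0 uAB AB_M] lackB [coA old] [keep new] back].
have mem_swap v : (v \in B ++ A) = (v \in A ++ B) by rewrite !mem_cat orbC.
have uBA : uniq (B ++ A) by rewrite uniq_catC.
have rem_swap c : {subset rem c (B ++ A) <= rem c (A ++ B)}.
  by move=> v; rewrite !mem_rem_uniq // !inE mem_swap.
split.
- by split => //; rewrite all_cat andbC -all_cat.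
- by move=> f' /back[].
- split=> [f' /back[_ [h _ v /h|[f ff f'f] Bf']]|a /new[f' ff' h]].
  + by rewrite mem_swap.
  + by have [b bB] := lackB f ff; rewrite (f'f _ (Bf' b bB)).
  + by exists f' => // v /rem_swap/h.
- split=> [f' /back[lackA [h [b bB bf']|]]|b /old[f ff h]].
  + have [f ff hf] := old b bB; exists f => // v vf'; apply: hf.
    rewrite mem_rem_uniq // !inE h // andbT.
    by apply: contraNneq bf' => <-.
  + by move=> [f ff f'f] _; exists f.
  + by exists f => // v /rem_swap/h.
- move=> f ff; split; first exact: lackB.
  have [/hasP[c cA cf]|/hasPn Af] := boolP (has (fun c => c \notin f) A).
    by right; have := keep f ff (ex_intro2 _ _ c cA cf).
  left => v; rewrite mem_swap.
  by apply: (coA f ff (fun c cA => negPn (Af c cA))).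
Qed.

Lemma chart_move M A B fs fs' Phi : move M A B fs fs' -> chart M fs Phi ->
  chart M fs' (fun v t => transfer A B (Phi^~ t) v).
Proof.
move=> mv [cP sP iP surjP]; split.
- by move=> v; exact: transfer_continuous.
- by move=> t; exact: (move_spanned mv (sP t)).1.
- move=> s t st; apply: iP => v.
  have [_ <-] := move_spanned mv (sP s); have [_ <-] := move_spanned mv (sP t).
  by congr (transfer B A _ v); apply/funext.
- move=> z sz; have [sz' zK] := move_spanned (move_sym mv) sz.
  have [t tE] := surjP _ sz'; exists t => v; rewrite -zK.
  by congr (transfer A B _ v); apply/funext.
Qed.

Lemma chart_equiv M fs fs' Phi :
  (forall f, fs f -> exists2 f', fs' f' & {subset f <= f'}) ->
  (forall f', fs' f' -> exists2 f, fs f & {subset f' <= f}) ->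
  chart M fs Phi -> chart M fs' Phi.
Proof.
move=> sub sup [cP sP iP surjP]; split => // [t|z [z0 z1 [f' ff' zf']]].
  have [p0 p1 [f ff pf]] := sP t; have [f' ff' h] := sub f ff.
  by split => //; exists f' => // v /pf/h.
apply: surjP; split => //; have [f ff h] := sup f' ff'.
by exists f => // v /zf'/h.
Qed.

End Chart.

Section CircleHat.
Context {R : realType} (N : nat).
Hypothesis N3 : (3 <= N)%N.

(* The second summand identifies the points [0] and [N] of the circle. *)
Definition circ_hat (v : nat) (p : R) : R :=
  hat (p - v%:R) + (v == 0%N)%:R * hat (p - N%:R).

Lemma hat_shift (v j : nat) (t : R) : 0 <= t <= 1 ->
  hat (j%:R + t - v%:R) = (1 - t) * (v == j)%:R + t * (v == j.+1)%:R.
Proof.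
move=> t01; have [vN|jv] := leqP v j.+1; last first.
  have -> : (v == j) = false by apply/eqP; lia.
  have -> : (v == j.+1) = false by apply/eqP; lia.
  rewrite hat_out /=; first by ring.
  rewrite ler0_norm; move: jv; rewrite -(ler_nat R) -[j.+2%:R]natr1 -[j.+1%:R]natr1; lra.
have := @interpE R R^o j.+1 (fun i => (v == i)%:R : R^o) j t (ltnSn _) t01.
rewrite /interp (bigD1 (Ordinal (vN : v < j.+2)%N)) //= eqxx big1 ?addr0.
  by rewrite /GRing.scale /= mulr1.
move=> i /eqP iv; rewrite (_ : (v == i) = false) ?scaler0 //.
by apply/eqP => vi; apply: iv; apply: val_inj.
Qed.

Lemma circ_hatE (v j : nat) (t : R) : (j < N)%N -> (v < N)%N -> 0 <= t <= 1 ->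
  circ_hat v (j%:R + t) = (1 - t) * (v == j)%:R + t * (v == j.+1 %% N)%N%:R.
Proof.
move=> jN vN t01; rewrite /circ_hat !hat_shift //.
have -> : (N == j) = false by apply/eqP; lia.
have [j1|j1] := ltnP j.+1 N.
  rewrite modn_small // (_ : (N == j.+1) = false); last by apply/eqP; lia.
  by rewrite /=; ring.
have -> : j.+1 = N by lia.
rewrite modnn eqxx (_ : (v == N) = false); last by apply/eqP; lia.
by rewrite /=; ring.
Qed.

Lemma succ_modE j : (j < N)%N ->
  (j.+1 < N)%N /\ (j.+1 %% N = j.+1)%N \/ j.+1 = N /\ (j.+1 %% N = 0)%N.
Proof.
move=> jN; have [j1|j1] := ltnP j.+1 N; first by left; rewrite modn_small.
by right; have -> : j.+1 = N by [lia]; rewrite modnn.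
Qed.

Lemma succ_mod_neq j : (j < N)%N -> (j == j.+1 %% N)%N = false.
Proof. by move=> /succ_modE jS; apply/eqP; clear -jS N3; lia. Qed.

Lemma circ_hat_inj (p q : R) : 0 <= p <= N%:R -> 0 <= q <= N%:R ->
  (forall v, (v < N)%N -> circ_hat v p = circ_hat v q) ->
  [\/ p = q, p = 0 /\ q = N%:R | p = N%:R /\ q = 0].
Proof.
have N0 : (0 < N)%N by lia.
move=> /(floor_split N0)[i [t [iN t01 ->]]] /(floor_split N0)[j [u [jN u01 ->]]] E.
have {}E v : (v < N)%N -> (1 - t) * (v == i)%:R + t * (v == i.+1 %% N)%N%:R =
    (1 - u) * (v == j)%:R + u * (v == j.+1 %% N)%N%:R.
  by move=> vN; rewrite -!circ_hatE // E.
have iS := succ_modE iN; have jS := succ_modE jN.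
have [ij|ij] := eqVneq i j.
  rewrite -ij in E *; have := E i iN; rewrite eqxx.
  have -> : (i == i.+1 %% N)%N = false by apply/eqP; clear -iS N3; lia.
  by move=> /= h; constructor 1; congr (_ + _); lra.
have Ei := E i iN; have Ej := E j jN; rewrite !eqxx in Ei Ej.
have /negbTE ij' := ij; have ji : (j == i) = false by rewrite eq_sym.
rewrite ij' in Ei; rewrite ji in Ej.
have i1 : (i == i.+1 %% N)%N = false by apply/eqP; clear -iS N3; lia.
have j1 : (j == j.+1 %% N)%N = false by apply/eqP; clear -jS N3; lia.
rewrite i1 in Ei; rewrite j1 in Ej.
move: Ei Ej => /=.
have [ijS|ijS] := eqVneq i (j.+1 %% N)%N.
  have -> : (j == i.+1 %% N)%N = false by apply/eqP; clear -ijS ij iS jS N3; lia.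
  move=> /= Ei Ej; have u1 : u = 1 by lra.
  have t0 : t = 0 by lra.
  rewrite u1 t0 addr0; case: jS => [[_ jE]|[jN' j0]].
    by constructor 1; rewrite natr1 ijS jE.
  by constructor 2; rewrite ijS j0 natr1 jN'.
have [jiS|jiS] := eqVneq j (i.+1 %% N)%N.
  move=> /= Ei Ej; have t1 : t = 1 by lra.
  have u0 : u = 0 by lra.
  rewrite t1 u0 addr0; case: iS => [[_ iE]|[iN' i0]].
    by constructor 1; rewrite natr1 jiS iE.
  by constructor 3; rewrite jiS i0 natr1 iN'.
move=> /= Ei Ej; have t1 : t = 1 by lra.
have u1 : u = 1 by lra.
have := E (i.+1 %% N)%N (ltn_pmod _ N0).
rewrite eqxx eq_sym i1 eq_sym (negPf jiS).
have -> : (i.+1 %% N == j.+1 %% N)%N = false by apply/eqP; clear -ij iS jS; lia.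
by rewrite t1 u1 /=; lra.
Qed.

End CircleHat.

Section DiskChart.
Context {R : realType} (k d : nat).
Hypotheses (k0 : (0 < k)%N) (d0 : (0 < d)%N).

Local Notation w := (saw_blade_word k).
Local Notation n := (size w).
Local Notation D := (@disk R w).
Local Notation polar := (@polar R k k0).
Local Notation Nb := (d * n)%N.

Let nE : n = (3 * k)%N := size_saw_blade_word k.
Let N3 : (3 <= Nb)%N. Proof. by rewrite nE; nia. Qed.
Let N0 : (0 < Nb)%N. Proof. by lia. Qed.
Let dR : 0 < d%:R :> R. Proof. by rewrite ltr0n. Qed.

Definition disk_chart (M : nat) (fs : seq nat -> Prop) : Prop :=
  exists2 Phi : nat -> D -> R, chart M fs Phi &
    forall x v, 0 <= x <= n%:R ->
      Phi v (polar 1 x) = if (v < Nb)%N then circ_hat Nb v (d%:R * x) else 0.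

Lemma disk_chart_move M A B fs fs' : move M A B fs fs' ->
  has (leq Nb) A -> disk_chart M fs -> disk_chart M fs'.
Proof.
move=> mv /hasP[a aA aN] [Phi cPhi bPhi].
exists (fun v t => transfer A B (Phi^~ t) v); first exact: chart_move cPhi.
move=> x v x0n; rewrite -bPhi //; apply: transfer_id.
have [_ sP _ _] := cPhi; have [p0 _ _] := sP (polar 1 x).
have := seqmin_ge0 A p0; have := seqmin_le (Phi^~ (polar 1 x)) aA.
by rewrite bPhi // ltnNge aN /= => h1 h2; apply/eqP; rewrite eq_le h1 h2.
Qed.

Lemma disk_chart_equiv M fs fs' :
  (forall f, fs f -> exists2 f', fs' f' & {subset f <= f'}) ->
  (forall f', fs' f' -> exists2 f, fs f & {subset f' <= f}) ->
  disk_chart M fs -> disk_chart M fs'.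
Proof.
by move=> h1 h2 [Phi cPhi bPhi]; exists Phi => //; exact: chart_equiv cPhi.
Qed.

Lemma disk_chart_widen M M' fs : (M <= M')%N ->
  (forall f v, fs f -> v \in f -> (v < M)%N) ->
  disk_chart M fs -> disk_chart M' fs.
Proof.
move=> MM' fM [Phi [cP sP iP surjP] bPhi]; exists Phi => //.
have sumE (z : nat -> R) f : fs f -> (forall v, z v != 0 -> v \in f) ->
    \sum_(v < M') z v = \sum_(v < M) z v.
  move=> ff zf; rewrite -!(big_mkord xpredT) (big_cat_nat (leq0n M) MM') //=.
  rewrite [X in _ + X]big1_seq ?addr0 // => v; rewrite mem_index_iota => /andP[_ /andP[Mv _]].
  by apply/eqP; apply: contraLR Mv => /zf/(fM _ _ ff); rewrite -ltnNge.
split => // [t|z [z0 z1 [f ff zf]]].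
  have [p0 p1 [f ff pf]] := sP t; split => //; last by exists f.
  by rewrite (sumE (Phi^~ t) f).
by apply: surjP; split => //; [rewrite -(sumE z f)|exists f].
Qed.

Definition fan (f : seq nat) : Prop :=
  exists2 j, (j < Nb)%N & f = [:: Nb; j; j.+1 %% Nb]%N.

Lemma scaled_itv (x : R) : 0 <= x <= n%:R -> 0 <= d%:R * x <= Nb%:R.
Proof.
by move=> /andP[x0 xn]; rewrite natrM mulr_ge0 ?(ltW dR) //= ler_pM2l.
Qed.

Lemma circ_hat_sum (p : R) : 0 <= p <= Nb%:R ->
  \sum_(v < Nb) circ_hat Nb v p = 1.
Proof.
move=> /(floor_split N0)[j [t [jN t01 ->]]].
rewrite (eq_bigr (fun v : 'I_Nb => (1 - t) * (v == Ordinal jN)%:R +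
   t * (v == Ordinal (ltn_pmod j.+1 N0))%:R)); last first.
  by move=> v _; rewrite circ_hatE.
rewrite big_split -!mulr_sumr /=.
have one (u : 'I_Nb) : \sum_(v < Nb) (v == u)%:R = 1 :> R.
  by rewrite (bigD1 u) //= eqxx big1 ?addr0 // => v /negPf ->.
by rewrite !one; ring.
Qed.

Lemma fan_chart : disk_chart Nb.+1 fan.
Proof.
have hc : continuous (hat : R -> R) := hat_continuous.
pose val_at (v : nat) (r x : R) : R := if (v < Nb)%N then r * circ_hat Nb v (d%:R * x)
  else if v == Nb then 1 - r else 0.
have /(@choice _ _ _)[Phi PhiP] : forall v, exists phi : D -> R,
    continuous phi /\ forall r x, 0 <= r <= 1 -> 0 <= x <= n%:R ->
      phi (polar r x) = val_at v r x.
  move=> v; rewrite /val_at; case: (ltnP v Nb) => vN.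
    have [|||phi cphi phiE] := @polar_descend R k k0 R
      (fun r x => r * circ_hat Nb v (d%:R * x)); last by exists phi.
    - have c1 : continuous (fun p : R * R => hat (d%:R * p.2 - v%:R)).
        by apply: (cts_comp hc); cts.
      have c2 : continuous (fun p : R * R => hat (d%:R * p.2 - Nb%:R)).
        by apply: (cts_comp hc); cts.
      by rewrite /circ_hat; cts.
    - by move=> x y _ _; rewrite !mul0r.
    - move=> r _; congr (_ * _).
      have -> : d%:R * 0 = 0%:R + 0 :> R by rewrite mulr0 addr0.
      have -> : d%:R * n%:R = Nb.-1%:R + 1 :> R by rewrite natr1 prednK // natrM.
      rewrite !circ_hatE ?lexx ?ler01 // ?prednK // modnn modn_small; [|lia].
      by ring.
  case: (v =P Nb) => _; last by exists (fun=> 0); split => //; exact: cts_cst.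
  have [|||phi cphi phiE] := @polar_descend R k k0 R (fun r x => 1 - r) => //.
    by cts.
  by exists phi.
have PhiE v r x : 0 <= r <= 1 -> 0 <= x <= n%:R -> Phi v (polar r x) = val_at v r x.
  exact: (PhiP v).2.
have r11 : 0 <= (1 : R) <= 1 by rewrite ler01 lexx.
have val_sum r x : 0 <= x <= n%:R -> \sum_(v < Nb.+1) val_at v r x = 1.
  move=> x0n; rewrite big_ord_recr /= {2}/val_at ltnn eqxx.
  rewrite (eq_bigr (fun v : 'I_Nb => r * circ_hat Nb v (d%:R * x))); last first.
    by move=> v _; rewrite /val_at ltn_ord.
  by rewrite -mulr_sumr circ_hat_sum ?scaled_itv //; ring.
have val_ge0 v r x : 0 <= r <= 1 -> 0 <= val_at v r x.
  move=> /andP[r0 r1]; rewrite /val_at; case: ifP => _.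
    by rewrite mulr_ge0 // addr_ge0 ?mulr_ge0 ?hat_ge0.
  by case: ifP => _ //; rewrite subr_ge0.
exists Phi; last first.
  by move=> x v x0n; rewrite PhiE // /val_at subrr mul1r; case: ifP => //; case: ifP.
split.
- by move=> v; exact: (PhiP v).1.
- move=> t; have [r [x [r01 x0n <-]]] := polar_surj k0 t; split.
  + by move=> v; rewrite PhiE // val_ge0.
  + by rewrite (eq_bigr (fun v : 'I__ => val_at v r x)) ?val_sum // => v _; rewrite PhiE.
  + have [j [u [jN u01 xE]]] := floor_split N0 (scaled_itv x0n).
    exists [:: Nb; j; j.+1 %% Nb]%N; first by exists j.
    move=> v; rewrite PhiE // /val_at xE !inE; case: ifP => [vN|_].
      rewrite circ_hatE // => h; apply/orP; right; apply: contraNT h.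
      by rewrite negb_or => /andP[/negPf -> /negPf ->]; rewrite !mulr0 addr0 mulr0.
    by case: ifP => //; rewrite eqxx.
- move=> s t; have [r [x [r01 x0n <-]]] := polar_surj k0 s.
  have [q [y [q01 y0n <-]]] := polar_surj k0 t => E.
  have rq : r = q.
    by have := E Nb; rewrite !PhiE // /val_at ltnn eqxx; lra.
  rewrite -rq in E *; have [r0|r0] := eqVneq r 0.
    by rewrite r0; exact: polar_center.
  have := @circ_hat_inj R _ N3 _ _ (scaled_itv x0n) (scaled_itv y0n).
  case=> [v vN|/mulfI -> //|[x0 yN]|[xN y0]]; last 2 first.
  + have -> : x = 0 by apply: (mulfI (lt0r_neq0 dR)); rewrite x0 mulr0.
    have -> : y = n%:R by apply: (mulfI (lt0r_neq0 dR)); rewrite yN natrM.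
    exact: polar_wrap.
  + have -> : y = 0 by apply: (mulfI (lt0r_neq0 dR)); rewrite y0 mulr0.
    have -> : x = n%:R by apply: (mulfI (lt0r_neq0 dR)); rewrite xN natrM.
    by rewrite polar_wrap.
  + by have := E v; rewrite !PhiE // /val_at vN => /(mulfI r0).
  + by rewrite gt_eqF.
- move=> z [z0 z1 [f [j jN fE] zf]]; rewrite fE in zf.
  have jS : (j.+1 %% Nb < Nb)%N by rewrite ltn_pmod.
  have zout v : v != Nb -> v != j -> v != (j.+1 %% Nb)%N -> z v = 0.
    move=> h1 h2 h3; apply/eqP; apply: contraT => /zf.
    by rewrite !inE (negPf h1) (negPf h2) (negPf h3).
  have jj := succ_mod_neq N3 jN.
  have zsum : z Nb + z j + z (j.+1 %% Nb)%N = 1.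
    rewrite -z1 big_ord_recr /= (bigD1 (Ordinal jN)) //=.
    rewrite (bigD1 (Ordinal jS)) /=; last first.
      by apply/eqP => /(congr1 val) /= /eqP; rewrite eq_sym jj.
    rewrite big1 => [|v /andP[vj vS]]; first by ring.
    by apply: zout => //; rewrite ltn_eqF.
  pose r := z j + z (j.+1 %% Nb)%N.
  have r0 : 0 <= r by rewrite addr_ge0.
  have r1 : r <= 1 by have := z0 Nb; rewrite /r; lra.
  have [t t01 rt] : exists2 t, 0 <= t <= 1 & r * t = z (j.+1 %% Nb)%N.
    have [rz|rn0] := eqVneq r 0.
      exists 0; rewrite ?lexx ?ler01 // mulr0.
      by have := z0 j; have := z0 (j.+1 %% Nb)%N; rewrite /r in rz; lra.
    exists (z (j.+1 %% Nb)%N / r); last by rewrite mulrC divfK.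
    have rp : 0 < r by rewrite lt_def rn0.
    by rewrite divr_ge0 //= ler_pdivrMr // mul1r /r lerDr.
  have xI : 0 <= j%:R + t <= Nb%:R.
    move/andP: t01 => [t0 t1]; rewrite addr_ge0 //=.
    by rewrite (@le_trans _ _ (j%:R + 1)) ?lerD // natr1 ler_nat.
  have xI' : 0 <= (j%:R + t) / d%:R <= n%:R.
    move: xI => /andP[x0 xN]; rewrite divr_ge0 //= ?(ltW dR) // ler_pdivrMr //.
    by rewrite mulrC -natrM.
  exists (polar r ((j%:R + t) / d%:R)) => v; rewrite PhiE ?r0 // /val_at.
  rewrite [d%:R * _]mulrC divfK; last by rewrite gt_eqF.
  have [vN|Nv] := ltnP v Nb; last first.
    have [->|vN] := eqVneq v Nb; first by rewrite /= /r -zsum; ring.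
    by rewrite zout //; apply/eqP => vE; move: Nv; rewrite vE leqNgt ?jS ?jN.
  rewrite circ_hatE // mulrDr !mulrA rt mulrBr mulr1 rt /r.
  have [->|vj] := eqVneq v j; first by rewrite jj /=; ring.
  have [->|vS] := eqVneq v (j.+1 %% Nb)%N; first by rewrite /=; ring.
  by rewrite (zout v) // ?ltn_eqF //=; ring.
Qed.

End DiskChart.

(* The vertices [zigd d j], for [j < 3 * k * d], are those of the boundary of
   the polygon after each edge has been subdivided into [d] segments, seen on
   the circle [R / (k * d)] obtained by the gluing. *)
Definition zigd (d j : nat) : nat :=
  (d * (j %/ d %/ 3) + (if j %/ d %% 3 == 1 then d - j %% d else j %% d))%N.

Lemma zigdE d q s : (s < d)%N ->
  zigd d (d * q + s) = (d * (q %/ 3) + (if q %% 3 == 1 then d - s else s))%N.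
Proof.
move=> sd; have d0 : (0 < d)%N by lia.
by rewrite /zigd [(d * q)%N]mulnC divnMDl // (divn_small sd) addn0 modnMDl (modn_small sd).
Qed.

Lemma zigdS d q s : (s < d)%N ->
  zigd d (d * q + s).+1 =
    (d * (q %/ 3) + (if q %% 3 == 1 then d - s.+1 else s.+1))%N.
Proof.
move=> sd; have [s1|s1] := ltnP s.+1 d; first by rewrite -addnS zigdE.
have -> : ((d * q + s).+1 = d * q.+1 + 0)%N by nia.
have E : s.+1 = d by lia.
rewrite zigdE; last by lia.
rewrite subn0 E subnn.
have := divn_eq q 3; have := ltn_pmod q (isT : 0 < 3)%N.
case: (q %% 3)%N => [|[|[|//]]] _ qE /=.
- have -> : (q.+1 %/ 3 = q %/ 3)%N by lia.
  by have -> : (q.+1 %% 3 = 1)%N by lia.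
- have -> : (q.+1 %/ 3 = q %/ 3)%N by lia.
  by have -> : (q.+1 %% 3 = 2)%N by lia.
- have -> : (q.+1 %/ 3 = (q %/ 3).+1)%N by lia.
  have -> : (q.+1 %% 3 = 0)%N by lia.
  by rewrite /= addn0 mulnS addnC.
Qed.

Lemma eq_mod_sum (R : realType) (N : nat) (P : pred nat) (v0 : nat) (c : nat -> R) :
  (v0 < N)%N -> \sum_(v < N | P v) c v * (v == v0 :> nat)%:R = c v0 * (P v0)%:R.
Proof.
move=> v0N; rewrite big_mkcond (bigD1 (Ordinal v0N)) //= eqxx mulr1 big1 ?addr0.
  by case: (P v0); rewrite ?mulr1 ?mulr0.
move=> v vE; case: ifP => // _; rewrite (_ : (v == v0 :> nat) = false) ?mulr0 //.
by apply: contraNF vE => /eqP h; apply/eqP/val_inj.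
Qed.

Section Boundary.
Context {R : realType} (k d : nat).
Hypotheses (k0 : (0 < k)%N) (d0 : (0 < d)%N) (kd3 : (3 <= k * d)%N).

Local Notation n := (size (saw_blade_word k)).
Local Notation N := (d * n)%N.

Let nE : n = (3 * k)%N := size_saw_blade_word k.
Let N0 : (0 < N)%N. Proof. by rewrite nE; nia. Qed.
Let N3 : (3 <= N)%N. Proof. by rewrite nE; nia. Qed.
Let dR : 0 < d%:R :> R. Proof. by rewrite ltr0n. Qed.

Lemma boundary_label_sum (x : R) (c : nat) : 0 <= x <= n%:R -> (c < k * d)%N ->
  \sum_(v < N | (zigd d v %% (k * d) == c)%N) circ_hat N v (d%:R * x) =
  circ_hat (k * d) c (d%:R * position k x).
Proof.
move=> x0n ckd.
have [j [t [jN t01 xE]]] := floor_split N0 (scaled_itv d0 x0n).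
have [q [s [qn sd jE]]] : exists q s, [/\ (q < n)%N, (s < d)%N & j = d * q + s]%N.
  exists (j %/ d)%N, (j %% d)%N; rewrite ltn_divLR // ltn_mod d0 mulnC jN.
  by split => //; rewrite [(d * _)%N]mulnC -divn_eq.
have sRd : s%:R + 1 <= d%:R :> R by rewrite natr1 ler_nat.
have xE' : x = q%:R + (s%:R + t) / d%:R.
  apply: (mulfI (lt0r_neq0 dR)); rewrite xE jE natrD natrM mulrDr [in RHS]mulrCA.
  by rewrite divff ?mulr1 ?addrA // gt_eqF.
have st01 : 0 <= (s%:R + t) / d%:R <= 1.
  move/andP: t01 => [t0 t1]; rewrite divr_ge0 ?addr_ge0 ?(ltW dR) //=.
  by rewrite ler_pdivrMr // mul1r; apply: le_trans sRd; rewrite lerD2l.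
have dst : d%:R * ((s%:R + t) / d%:R) = s%:R + t.
  by rewrite mulrCA divff ?mulr1 // gt_eqF.
rewrite xE (eq_bigr (fun v : 'I_N => (1 - t) * (v == j :> nat)%:R +
  t * (v == j.+1 %% N :> nat)%N%:R)); last by move=> v _; rewrite circ_hatE.
rewrite big_split /= (@eq_mod_sum _ N (fun v => zigd d v %% (k * d) == c)%N j (fun=> 1 - t)) //.
rewrite (@eq_mod_sum _ N (fun v => zigd d v %% (k * d) == c)%N (j.+1 %% N) (fun=> t))%N; last first.
  by rewrite ltn_mod.
have -> : (zigd d (j.+1 %% N) %% (k * d) = zigd d j.+1 %% (k * d))%N.
  have [[_ ->//]|[jS ->]] := succ_modE N3 jN.
  have zN : zigd d N = (d * k)%N.
    by have := zigdE n d0; rewrite addn0 => ->; rewrite nE modnMr mulKn // addn0.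
  have z0 : zigd d 0 = 0%N by have := zigdE 0 d0; rewrite muln0 addn0 => ->; rewrite ?muln0 ?addn0 /= ?muln0.
  by rewrite jS zN z0 mulnC modnn mod0n.
rewrite jE zigdE // zigdS // xE' positionE // /orient mulrDr.
have q3k : (q %/ 3 < k)%N by rewrite ltn_divLR // mulnC -nE.
have dq : (d * (q %/ 3) + d <= k * d)%N by rewrite addnC -mulnS mulnC leq_mul2r q3k orbT.
rewrite -natrM; set a := (d * (q %/ 3))%N in dq *; case: ifP => _.
  rewrite mulrBr mulr1 dst.
  have -> : a%:R + (d%:R - (s%:R + t)) = (a + (d - s.+1))%:R + (1 - t) :> R.
    by rewrite natrD natrB // -[s.+1%:R]natr1; ring.
  have -> : (d - s = (d - s.+1).+1)%N by lia.
  rewrite addnS circ_hatE ?(modn_small (_ : a + (d - s.+1) < _)%N) //; try lia; last first.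
    by move/andP: t01; lra.
  by rewrite ![(c == _)%N]eq_sym; ring.
have asN : (a + s < k * d)%N by lia.
rewrite dst addrA -natrD addnS circ_hatE // (modn_small asN).
by rewrite ![(c == _)%N]eq_sym.
Qed.

End Boundary.

Section Label.
Context {R : realType} (k d : nat).
Hypotheses (k0 : (0 < k)%N) (d0 : (0 < d)%N) (kd3 : (3 <= k * d)%N).

Local Notation w := (saw_blade_word k).
Local Notation n := (size w).
Local Notation X := (saw_blade R k).
Local Notation D := (@disk R w).
Local Notation polar := (@polar R k k0).
Local Notation position := (@position R k).
Local Notation N := (d * n)%N.

Let nE : n = (3 * k)%N := size_saw_blade_word k.
Let N3 : (3 <= N)%N. Proof. by rewrite nE; nia. Qed.
Let N0 : (0 < N)%N. Proof. by lia. Qed.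
Let kd0 : (0 < k * d)%N. Proof. by lia. Qed.
Let dR : 0 < d%:R :> R. Proof. by rewrite ltr0n. Qed.

Lemma saw_blade_compact : compact [set: X].
Proof.
have -> : [set: X] = (fun p : R * R => sheet k0 p.1 p.2) @` @box R k.
  apply/seteqP; split => // z _.
  by have [r [x [r01 x0n <-]]] := sheet_surj k0 z; exists (r, x).
apply: continuous_compact; last exact: box_compact.
by apply: continuous_subspaceT; exact: sheet_continuous.
Qed.

Definition label (v : nat) : nat :=
  if (v < N)%N then (zigd d v %% (k * d))%N else (k * d + (v - N))%N.

Lemma label_boundary v : (label v < k * d)%N = (v < N)%N.
Proof.
rewrite /label; case: ifP => // [_|_]; first by rewrite ltn_mod.
by apply/negbTE; rewrite -leqNgt leq_addr.
Qed.

Lemma label_interior u v : (N <= u)%N -> label u = label v -> u = v.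
Proof.
move=> Nu uv; have Nv : (N <= v)%N by rewrite leqNgt -label_boundary -uv label_boundary -leqNgt.
by move: uv; rewrite /label !ltnNge Nu Nv /=; lia.
Qed.

(* The fourth condition makes the star of every interior vertex embed into the
   quotient. *)
Definition labelled (M : nat) (fs : seq nat -> Prop) : Prop :=
  [/\ forall f v, fs f -> v \in f -> (v < M)%N,
      forall f, fs f -> exists2 u, u \in f & (N <= u)%N,
      forall f, fs f -> exists2 j, (j < N)%N &
        forall v, v \in f -> (v < N)%N -> v = j \/ v = (j.+1 %% N)%N,
      forall f f' u v v', fs f -> fs f' -> u \in f -> u \in f' -> (N <= u)%N ->
        v \in f -> v' \in f' -> (v < N)%N -> (v' < N)%N ->
        zigd d v = zigd d v' %[mod k * d] -> v = v' &
      forall u, (N <= u < M)%N -> exists2 f, fs f & u \in f].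

Section Labelled.
Variables (M : nat) (fs : seq nat -> Prop) (Phi : nat -> D -> R).
Hypotheses (NM : (N <= M)%N) (lfs : labelled M fs) (cPhi : chart M fs Phi).
Hypothesis bPhi : forall x v, 0 <= x <= n%:R ->
  Phi v (polar 1 x) = if (v < N)%N then circ_hat N v (d%:R * x) else 0.

Local Notation nv := (k * d + (M - N))%N.

Lemma label_lt v : (v < M)%N -> (label v < nv)%N.
Proof.
have [vN _|vN vM] := ltnP v N.
  by have : (label v < k * d)%N by [rewrite label_boundary]; lia.
by rewrite /label (ltnNge v) vN /=; lia.
Qed.

Lemma label_inj f f' u0 u v : fs f -> fs f' -> u0 \in f -> u0 \in f' ->
  (N <= u0)%N -> u \in f -> v \in f' -> label u = label v -> u = v.
Proof.
case: lfs => _ _ _ linj _ ff ff' uf uf' Nu0 u_f vf' E.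
have [uN|Nu] := ltnP u N; last exact: label_interior.
have vN : (v < N)%N by rewrite -label_boundary -E label_boundary.
by apply: (linj f f' u0) => //; move: E; rewrite /label uN vN.
Qed.

Definition collect (z : nat -> R) (c : nat) : R := \sum_(v < M | label v == c) z v.

Lemma collect_val z f v : fs f -> (forall v, z v != 0 -> v \in f) -> v \in f ->
  collect z (label v) = z v.
Proof.
move=> ff zf vf; have [fM lint _ _ _] := lfs.
have [u uf Nu] := lint f ff.
rewrite /collect (bigD1 (Ordinal (fM f v ff vf))) //= big1 ?addr0 //.
move=> i /andP[/eqP E iv]; apply/eqP; apply: contraR iv => /zf i_f.
by apply/eqP/val_inj => /=; apply: (label_inj ff ff uf uf Nu).
Qed.

Lemma collect_supp z c : collect z c != 0 -> exists2 v, z v != 0 & label v = c.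
Proof.
move=> zc; have [/existsP[v /andP[zv /eqP vc]]|/existsPn h] :=
  boolP [exists v : 'I_M, (z v != 0) && (label v == c)]; first by exists v.
move: zc; rewrite /collect big1 ?eqxx // => v vc.
by apply/eqP; have := h v; rewrite vc andbT negbK.
Qed.

Lemma collect_sum z : \sum_(l < nv) collect z l = \sum_(v < M) z v.
Proof.
rewrite (partition_big (fun v : 'I_M => Ordinal (label_lt (ltn_ord v))) xpredT) //=.
Qed.

Lemma collect_eq s t : (forall c, (c < nv)%N -> collect (Phi^~ s) c = collect (Phi^~ t) c) ->
  (exists2 u, (N <= u)%N & Phi u s != 0) -> s = t.
Proof.
move=> E [u Nu us]; have [_ sP iP _] := cPhi; have [fM _ _ _ _] := lfs.
have [s0 s1 [f ff sf]] := sP s; have [t0 t1 [f' ff' tf]] := sP t.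
have uf := sf _ us.
have uf' : u \in f'.
  have : collect (Phi^~ t) (label u) != 0.
    by rewrite -E ?(collect_val ff) // label_lt // (fM f).
  by case/collect_supp => v /tf vf' /esym/(label_interior Nu) ->.
have one p q g g' : fs g -> fs g' -> u \in g -> u \in g' ->
    (forall v, Phi v p != 0 -> v \in g) -> (forall v, Phi v q != 0 -> v \in g') ->
    (forall c, (c < nv)%N -> collect (Phi^~ p) c = collect (Phi^~ q) c) ->
    forall v, Phi v p != 0 -> Phi v p = Phi v q.
  move=> fg fg' ug ug' pg qg' pq v pv; have vg := pg v pv.
  have vnv : (label v < nv)%N by rewrite label_lt // (fM g).
  have : collect (Phi^~ q) (label v) != 0 by rewrite -pq ?(collect_val fg).
  case/collect_supp => x /qg' xg' E'.
  have xv : x = v by exact: (label_inj fg' fg ug' ug Nu).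
  by rewrite xv in xg'; rewrite -(collect_val fg pg vg) -(collect_val fg' qg' xg') pq.
apply: iP => v; have [sv|] := eqVneq (Phi v s) 0; last exact: (one _ _ f f').
have [tv|tv] := eqVneq (Phi v t) 0; first by rewrite sv tv.
by apply/esym/(one _ _ f' f) => // c cn; rewrite E.
Qed.

Lemma boundary_point s : (forall u, (N <= u)%N -> Phi u s = 0) ->
  exists2 x, 0 <= x <= n%:R & polar 1 x = s.
Proof.
move=> s_int; have [_ sP iP _] := cPhi; have [_ _ seg _ _] := lfs.
have [s0 s1 [f ff sf]] := sP s; have [j jN fj] := seg f ff.
have jS : (j.+1 %% N < N)%N by rewrite ltn_pmod.
have sout v : v != j -> v != (j.+1 %% N)%N -> Phi v s = 0.
  move=> vj vS; have [Nv|vN] := leqP N v; first exact: s_int.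
  apply/eqP; apply: contraT => /sf/fj /(_ vN)[] vE.
    by rewrite vE eqxx in vj.
  by rewrite vE eqxx in vS.
have jj := succ_mod_neq N3 jN.
have ssum : Phi j s + Phi (j.+1 %% N)%N s = 1.
  rewrite -s1 (bigD1 (Ordinal (leq_trans jN NM))) //=.
  rewrite (bigD1 (Ordinal (leq_trans jS NM))) /=; last first.
    by apply/eqP => /(congr1 val) /= /eqP; rewrite eq_sym jj.
  rewrite big1 => [|v /andP[vj vS]]; first by ring.
  by apply: sout.
set t := Phi (j.+1 %% N)%N s in ssum.
have t01 : 0 <= t <= 1 by have := s0 j; have := s0 (j.+1 %% N)%N; rewrite -/t; lra.
have xI : 0 <= j%:R + t <= N%:R.
  move/andP: t01 => [t0 t1]; rewrite addr_ge0 //=.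
  by rewrite (@le_trans _ _ (j%:R + 1)) ?lerD // natr1 ler_nat.
have xI' : 0 <= (j%:R + t) / d%:R <= n%:R.
  move: xI => /andP[x0 xN]; rewrite divr_ge0 //= ?(ltW dR) // ler_pdivrMr //.
  by rewrite mulrC -natrM.
exists ((j%:R + t) / d%:R) => //; apply: iP => v; rewrite bPhi //.
rewrite [d%:R * _]mulrC divfK; last by rewrite gt_eqF.
have [vN|Nv] := ltnP v N; last by rewrite s_int.
rewrite circ_hatE //; have [->|vj] := eqVneq v j; first by rewrite jj /=; lra.
have [->|vS] := eqVneq v (j.+1 %% N)%N; first by rewrite /= -/t; ring.
by rewrite (sout v) //=; ring.
Qed.

Lemma collect_boundary x c : 0 <= x <= n%:R -> collect (Phi^~ (polar 1 x)) c =
  if (c < k * d)%N then circ_hat (k * d) c (d%:R * position x) else 0.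
Proof.
move=> x0n; case: ifP => ckd; last first.
  rewrite /collect big1 // => v /eqP vc; rewrite bPhi // -label_boundary vc ckd //.
rewrite -boundary_label_sum // (big_ord_widen_cond _ (fun v => zigd d v %% (k * d) == c)%N
  (fun v => circ_hat N v (d%:R * x)) NM) /collect.
apply: eq_big => [v|v /eqP vc].
  have [vN|vN] := ltnP v N; first by rewrite /label vN andbT.
  by rewrite andbF; apply: contraTF ckd => /eqP <-; rewrite label_boundary -leqNgt.
by rewrite bPhi // -label_boundary vc ckd.
Qed.

Lemma collect_glue x y : 0 <= x <= n%:R -> 0 <= y <= n%:R -> position x = position y ->
  collect (Phi^~ (polar 1 x)) = collect (Phi^~ (polar 1 y)).
Proof. by move=> x0n y0n xy; apply/funext => c; rewrite !collect_boundary // xy. Qed.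

Lemma collect_quot_inj s t :
  (forall c, (c < nv)%N -> collect (Phi^~ s) c = collect (Phi^~ t) c) -> quot s = quot t.
Proof.
move=> E; have [[u Nu us]|s_int] :=
  pselect (exists2 u, (N <= u)%N & Phi u s != 0).
  by congr quot; apply: collect_eq => //; exists u.
have [[u Nu ut]|t_int] := pselect (exists2 u, (N <= u)%N & Phi u t != 0).
  by congr quot; apply/esym/collect_eq; [move=> c cn; rewrite E|exists u].
have zero r : ~ (exists2 u, (N <= u)%N & Phi u r != 0) ->
    forall u, (N <= u)%N -> Phi u r = 0.
  by move=> h u Nu; apply/eqP; apply: contra_notT h => ur; exists u.
have [x x0n xs] := boundary_point (zero s s_int).
have [y y0n yt] := boundary_point (zero t t_int).
rewrite -xs -yt in E *; rewrite -![quot _]/(sheet k0 1 _).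
have pos_itv z : 0 <= d%:R * position z <= (k * d)%:R.
  have /andP[p0 pk] := @position_itv R k k0 z.
  by rewrite mulr_ge0 //= mulnC natrM ler_pM2l.
have [c ckd|/(mulfI (lt0r_neq0 dR)) pq|[p0 qk]|[pk q0]] :=
    circ_hat_inj kd3 (pos_itv x) (pos_itv y).
- by have := E c (ltn_addr _ ckd); rewrite !collect_boundary // ckd.
- exact: sheet_position.
- apply: sheet_position_wrap => //; apply: (mulfI (lt0r_neq0 dR)).
    by rewrite p0 mulr0.
  by rewrite qk mulnC natrM.
- apply/esym/sheet_position_wrap => //; apply: (mulfI (lt0r_neq0 dR)).
    by rewrite q0 mulr0.
  by rewrite pk mulnC natrM.
Qed.

Definition label_complex : {set {set 'I_nv}} :=
  [set s | (s != finset.set0) && `[< exists2 f, fs f &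
    forall l : 'I_nv, l \in s -> exists2 v, v \in f & label v = l >]]%SET.

Lemma label_complex_simplicial : simplicial_complex label_complex.
Proof.
split; first by rewrite inE eqxx.
move=> s t; rewrite !inE => /andP[_ /asboolP[f ff sf]] -> /fintype.subsetP ts.
by apply/asboolP; exists f => // l /ts/sf.
Qed.

Lemma collect_barycentric t :
  (fun l : 'I_nv => collect (Phi^~ t) l) \in @barycentric_points _ R label_complex.
Proof.
have [_ sP _ _] := cPhi; have [p0 p1 [f ff pf]] := sP t; apply/mem_set.
have ps : \sum_(l < nv) collect (Phi^~ t) l = 1 by rewrite collect_sum.
split => //; first by move=> l; rewrite /collect sumr_ge0.
rewrite !inE; apply/andP; split.
  apply/eqP => /setP E; move: ps; rewrite big1 => [/esym/eqP|l _].
    by rewrite oner_eq0.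
  by have := E l; rewrite !inE => /negbFE/eqP.
apply/asboolP; exists f => // l; rewrite inE => /collect_supp[v /pf vf vl].
by exists v.
Qed.

Definition collect_map (t : D) : realization R label_complex :=
  SigSub (collect_barycentric t).

Lemma collect_map_continuous : continuous collect_map.
Proof.
apply: set_type_continuous; apply: ptws_continuous => l.
have [cP _ _ _] := cPhi.
suff c : continuous (fun t => collect (Phi^~ t) l) by exact: c.
by apply: cts_sum => v; exact: cP.
Qed.

Lemma collect_map_surj (p : realization R label_complex) :
  exists t, collect_map t = p.
Proof.
have [z0 z1] := set_valP p; set z := set_val p in z0 z1 *.
rewrite inE => /andP[_ /asboolP[f ff zf]].
have [fM _ _ _ _] := lfs; have [_ _ _ surjP] := cPhi.
pose g v : R := if v \in f then oapp z 0 (insub (label v)) else 0.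
have gf v : g v != 0 -> v \in f by rewrite /g; case: ifP => //; rewrite eqxx.
have gz (l : 'I_nv) : collect g l = z l.
  have [/hasP[v vf /eqP vl]|/hasPn h] := boolP (has (fun v => label v == l) f).
    by rewrite -vl (collect_val ff) // /g vf vl valK.
  have -> : z l = 0.
    apply/eqP; apply: contraT => zl; have [|v vf vl] := zf l; first by rewrite inE.
    by have := h v vf; rewrite vl eqxx.
  rewrite /collect big1 // => v /eqP vl; rewrite /g; case: ifP => // vf.
  by have := h _ vf; rewrite vl eqxx.
have [|t tg] := surjP g.
  split; [|by rewrite -collect_sum -z1; apply: eq_bigr => l _; rewrite gz|by exists f].
  by move=> v; rewrite /g; case: ifP => // _; case: insubP => //= l _ _; exact: z0.
exists t; apply: val_inj; apply/funext => l /=.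
by rewrite -set_valE -/z -gz; congr collect; apply/funext.
Qed.

Lemma label_complex_vertices : vertices label_complex = [set: 'I_nv]%SET.
Proof.
have [fM _ _ _ onto] := lfs; have [_ sP _ _] := cPhi.
apply/setP => l; rewrite !inE; apply/andP; split.
  by apply/set0Pn; exists l; rewrite inE.
suff [f ff [v vf vl]] : exists2 f, fs f & exists2 v, v \in f & label v = l.
  by apply/asboolP; exists f => // m; rewrite inE => /eqP ->; exists v.
have [lkd|kdl] := ltnP l (k * d).
  have ld : 0 <= (l%:R / d%:R : R) <= k%:R.
    by rewrite divr_ge0 ?(ltW dR) //= ler_pdivrMr // -natrM ler_nat ltnW.
  have [x x0n xE] := position_surj k0 ld.
  have : collect (Phi^~ (polar 1 x)) l != 0.
    rewrite collect_boundary // lkd xE mulrCA divff ?gt_eqF // mulr1 -[l%:R]addr0.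
    by rewrite circ_hatE ?lexx ?ler01 // eqxx subr0 !mul1r mul0r addr0 ltr01.
  case/collect_supp => v vx vl; have [_ _ [f ff pf]] := sP (polar 1 x).
  by exists f => //; exists v => //; exact: pf.
have [|f ff uf] := onto (N + (l - k * d))%N.
  by have := ltn_ord l; lia.
exists f => //; exists (N + (l - k * d))%N => //.
by rewrite /label ltnNge leq_addr /= addKn subnKC.
Qed.

Lemma label_triangulable : triangulable_with R X nv.
Proof.
exists 'I_nv, label_complex; split; last first.
  by rewrite label_complex_vertices cardsT card_ord.
split; first exact: label_complex_simplicial.
have [|h ch hq] := @quot_descend R k k0 _ collect_map collect_map_continuous.
  move=> x y x0n y0n xy; apply: val_inj; apply/funext => l /=.
  by rewrite (collect_glue x0n y0n xy).
apply: homeomorphic_sym; apply: (@compact_bijection_homeomorphic _ _ h) => //.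
- exact: saw_blade_compact.
- exact: realization_hausdorff.
- move=> a b; have [s <-] := quot_surj a; have [t <-] := quot_surj b.
  rewrite !hq => /(congr1 val) /= E; apply: collect_quot_inj => c cn.
  exact: (congr1 (fun z : 'I_nv -> R => z (Ordinal cn)) E).
- move=> p; have [t <-] := collect_map_surj p.
  by exists (quot t); rewrite hq.
Qed.

End Labelled.

Lemma triangulable_labelled M fs : (N <= M)%N -> labelled M fs ->
  @disk_chart R k d k0 M fs -> triangulable_with R X (k * d + (M - N)).
Proof. by move=> NM lfs [Phi cPhi bPhi]; exact: (label_triangulable NM lfs cPhi bPhi). Qed.

End Label.

(** * Sequences of moves *)

Definition flip (L : seq (seq nat)) (m : seq nat * seq nat) : seq (seq nat) :=
  [seq rem a (m.1 ++ m.2) | a <- m.1] ++ [seq f <- L | ~~ all (mem f) m.1].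

Definition flippable (c p : nat) (L : seq (seq nat)) (m : seq nat * seq nat) : bool :=
  let: (A, B) := m in
  [&& [&& c \in A, B != [::], uniq (A ++ B) & all (fun v => v < p)%N (A ++ B)],
      all (all (fun v => v < p)%N) L,
      all (fun f => has (fun b => b \notin f) B) L,
      all (fun f => all (mem f) A ==> all (mem (A ++ B)) f) L &
      all (fun b => has (fun f => all (mem f) (rem b (A ++ B))) L) B].

Fixpoint all_flippable (c p : nat) (L : seq (seq nat))
    (ms : seq (seq nat * seq nat)) : bool :=
  if ms is m :: ms' then flippable c p L m && all_flippable c p (flip L m) ms'
  else true.

Definition patched (r : nat -> nat) (L : seq (seq nat)) (rest : seq nat -> Prop)
    (f : seq nat) : Prop :=
  (exists2 g, g \in L & f = map r g) \/ rest f.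

Section Patch.
Variables (c p M : nat) (r : nat -> nat) (rest : seq nat -> Prop).
Hypotheses (rinj : {in gtn p &, injective r})
  (rM : forall v, (v < p)%N -> (r v < M)%N).

Lemma mem_rename v s : (v < p)%N -> all (fun u => u < p)%N s ->
  (r v \in map r s) = (v \in s).
Proof.
move=> vp /allP sp; apply/mapP/idP => [[u us E]|vs]; last by exists v.
by rewrite (rinj _ _ E) // ?inE // sp.
Qed.

Lemma sub_rename s t : all (mem t) s -> {subset map r s <= map r t}.
Proof. by move/allP => st _ /mapP[v /st vt ->]; exact: map_f. Qed.

Lemma flip_move L A B : flippable c p L (A, B) ->
  (forall g, rest g -> (exists2 a, a \in A & r a \notin g) /\
                       (exists2 b, b \in B & r b \notin g)) ->
  move M (map r A) (map r B) (patched r L rest) (patched r (flip L (A, B)) rest).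
Proof.
move=> /and5P[/and4P[A0 B0 uAB ABp] /allP Lp lackB coA old] restAB.
have A0' : A != [::] by case: (A) A0.
have [uA uB AB] : [/\ uniq A, uniq B & forall v, v \in B -> v \notin A].
  by move: uAB; rewrite cat_uniq => /and3P[? /hasPn h ?]; split => // v /h.
have [Ap Bp] : all (fun v => v < p)%N A /\ all (fun v => v < p)%N B.
  by apply/andP; rewrite -all_cat.
have urAB : uniq (map r (A ++ B)).
  rewrite map_inj_in_uniq // => u v uin vin; apply: rinj.
    exact: (allP ABp).
  exact: (allP ABp).
have rem_rename v : v \in A ++ B ->
    rem (r v) (map r (A ++ B)) =i map r (rem v (A ++ B)).
  move=> vAB x; rewrite mem_rem_uniq // inE; apply/andP/mapP.
    case=> xv /mapP[u uAB' xu]; exists u => //.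
    by rewrite mem_rem_uniq // inE uAB' andbT; apply: contraNneq xv => <-; rewrite xu.
  case=> u; rewrite mem_rem_uniq // inE => /andP[uv uAB'] ->; split; last exact: map_f.
  by apply: contra uv => /eqP /rinj ->; rewrite // inE (allP ABp).
have lacks v g : g \in L -> v \in A ++ B -> (r v \notin map r g) = (v \notin g).
  by move=> gL vAB; rewrite mem_rename ?Lp //; exact: (allP ABp).
split.
- split; rewrite -?map_cat //; try by rewrite -size_eq0 size_map size_eq0.
  by apply/allP => _ /mapP[v /(allP ABp) vp ->]; exact: rM.
- move=> f [[g gL ->]|/restAB[_ [b bB bf]]]; last by exists (r b) => //; exact: map_f.
  have /hasP[b bB bg] := allP lackB g gL.
  by exists (r b); [exact: map_f|rewrite lacks // mem_cat bB orbT].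
- rewrite -map_cat; split.
    move=> f [[g gL ->] Ag|/restAB[[a aA af] _] Af]; last first.
      by rewrite (Af _ (map_f r aA)) in af.
    apply: sub_rename; apply: (implyP (allP coA g gL)); apply/allP => a aA.
    by rewrite /= -(mem_rename (allP Ap a aA) (Lp _ gL)) Ag // map_f.
  move=> _ /mapP[b bB ->]; have /hasP[g gL bg] := allP old b bB.
  exists (map r g); first by left; exists g.
  move=> x; rewrite rem_rename; last by rewrite mem_cat bB orbT.
  exact: sub_rename.
- rewrite -map_cat; split.
    move=> f [[g gL ->]|rf] [_ /mapP[a aA ->] af]; last by exists f => //; right.
    exists (map r g) => //; left; exists g => //.
    rewrite mem_cat mem_filter gL andbT; apply/orP; right.
    apply: contra af => /allP /(_ a aA) /= ag; exact: map_f.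
  move=> _ /mapP[a aA ->]; exists (map r (rem a (A ++ B))).
    left; exists (rem a (A ++ B)) => //; rewrite mem_cat.
    by rewrite (map_f (fun a => rem a (A ++ B))).
  by move=> x; rewrite rem_rename // mem_cat aA.
- move=> f' [[g + ->]|rf]; last first.
    have [[a aA af] _] := restAB _ rf; split; first by exists (r a) => //; exact: map_f.
    by right; exists f' => //; right.
  rewrite mem_cat => /orP[/mapP[a aA ->]|].
    have aAB : a \in A ++ B by rewrite mem_cat aA.
    split; last by left; rewrite -map_cat => x; rewrite -rem_rename // => /mem_rem.
    exists (r a); first exact: map_f.
    by rewrite -rem_rename // mem_rem_uniq // inE eqxx.
  rewrite mem_filter => /andP[/allPn[a aA /= ag] gL]; split.
    by exists (r a); [exact: map_f|rewrite lacks // mem_cat aA].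
  by right; exists (map r g) => //; left; exists g.
Qed.

Lemma flips_chart (R : realType) (k d : nat) (k0 : (0 < k)%N) (d0 : (0 < d)%N) L ms :
  (d * size (saw_blade_word k) <= r c)%N -> all_flippable c p L ms ->
  (forall m g, m \in ms -> rest g -> (exists2 a, a \in m.1 & r a \notin g) /\
                                     (exists2 b, b \in m.2 & r b \notin g)) ->
  @disk_chart R k d k0 M (patched r L rest) ->
  @disk_chart R k d k0 M (patched r (foldl flip L ms) rest).
Proof.
move=> rc; elim: ms L => //= -[A B] ms IH L /andP[fl fls] restP dc.
apply: IH => // [m g mms|]; first by apply: restP; rewrite inE mms orbT.
have := flip_move fl (fun g => restP (A, B) g (mem_head _ _)).
move/disk_chart_move; apply => //.
by have /and5P[/and4P[A0 _ _ _] _ _ _ _] := fl; apply/hasP; exists (r c) => //; exact: map_f.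
Qed.

End Patch.

(** * Small saw blades *)

Definition fan_facets (N : nat) : seq (seq nat) :=
  [seq [:: N; j; j.+1 %% N]%N | j <- iota 0 N].

Definition labelled_facets (k d M : nat) (L : seq (seq nat)) : bool :=
  let N := (d * (3 * k))%N in
  [&& all (all (fun v => v < M)%N) L,
      all (has (leq N)) L,
      all (fun f => has (fun j => all (fun v => (v < N) ==>
        ((v == j) || (v == j.+1 %% N)))%N f) (iota 0 N)) L,
      all (fun f => all (fun f' => has (fun u => (N <= u) && (u \in f'))%N f ==>
        all (fun v => all (fun v' => [&& (v < N), (v' < N) &
          zigd d v == zigd d v' %[mod k * d]] ==> (v == v'))%N f') f) L) L &
      all (fun u => has (fun f => u \in f) L) (iota N (M - N))].

Lemma labelled_facetsP k d M L (fs : seq nat -> Prop) : labelled_facets k d M L ->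
  (forall f, fs f -> f \in L) -> (forall f, f \in L -> fs f) -> labelled k d M fs.
Proof.
move=> /and5P[/allP LM /allP Lint /allP seg /allP linj /allP onto] fL Lf.
have NE : (d * size (saw_blade_word k) = d * (3 * k))%N by rewrite size_saw_blade_word.
split; rewrite ?NE.
- by move=> f v /fL/LM/allP; exact.
- by move=> f /fL/Lint/hasP.
- move=> f /fL/seg/hasP[j]; rewrite mem_iota add0n => /andP[_ jN] /allP fj.
  by exists j => // v /fj /implyP h /h /orP[]/eqP; [left|right].
- move=> f f' u v v' /fL/linj/allP h /fL/h/implyP {}h uf uf' Nu vf vf' vN vN' E.
  have /h/allP/(_ v vf)/allP/(_ v' vf')/implyP : has (fun u => (d * (3 * k) <= u) && (u \in f'))%N f.
    by apply/hasP; exists u => //; rewrite Nu.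
  by rewrite vN vN' /= => /(_ (introT eqP E))/eqP.
- move=> u /andP[Nu uM]; have /onto/hasP[f /Lf ff uf] : u \in iota (d * (3 * k)) (M - d * (3 * k)).
    by rewrite mem_iota Nu subnKC // (leq_trans Nu (ltnW uM)).
  by exists f.
Qed.

Lemma flips_triangulable (R : realType) (k d M : nat) (ms : seq (seq nat * seq nat)) :
  let N := (d * (3 * k))%N in
  (0 < k)%N -> (0 < d)%N -> (3 <= k * d)%N -> (N < M)%N ->
  all_flippable N M (fan_facets N) ms ->
  labelled_facets k d M (foldl flip (fan_facets N) ms) ->
  triangulable_with R (saw_blade R k) (k * d + (M - N)).
Proof.
move=> N k0 d0 kd3 NM fl lab.
have NE : (d * size (saw_blade_word k) = N)%N by rewrite size_saw_blade_word.
have N0 : (0 < N)%N by rewrite /N; nia.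
pose fs := patched id (foldl flip (fan_facets N) ms) (fun=> False).
have := @triangulable_labelled R k d k0 d0 kd3 M fs; rewrite NE; apply.
- exact: ltnW.
- apply: labelled_facetsP lab _ _ => f; last by left; exists f => //; rewrite map_id.
  by case=> // -[g gL ->]; rewrite map_id.
apply: (flips_chart _ _ _ _ fl); rewrite ?NE //.
have : @disk_chart R k d k0 M (fan k d).
  apply: disk_chart_widen (fan_chart k0 d0); first by rewrite NE.
  move=> f v [j jN ->]; rewrite !inE => /or3P[]/eqP ->; rewrite ?ltnS // 1?ltnW //.
  by rewrite ltn_mod; lia.
apply: disk_chart_equiv => f [].
  move=> j; rewrite NE => jN ->; exists [:: N; j; j.+1 %% N]%N => //.
  left; exists [:: N; j; j.+1 %% N]%N; last by rewrite map_id.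
  by apply/mapP; exists j => //; rewrite mem_iota.
  move=> [g /mapP[j + ->] ->]; rewrite mem_iota add0n => /andP[_ jN].
  by rewrite map_id; exists [:: N; j; j.+1 %% N]%N => //; exists j; rewrite NE.
by case.
Qed.

Lemma dunce_hat_triangulable (R : realType) : triangulable_with R (saw_blade R 1) 8.
Proof.
apply: (@flips_triangulable R 1 3 14 [:: ([:: 0; 1; 9], [:: 10]);
  ([:: 0; 9], [:: 8; 10]); ([:: 1; 2; 9], [:: 11]); ([:: 2; 9], [:: 3; 11]);
  ([:: 3; 9; 11], [:: 12]); ([:: 3; 9], [:: 4; 12]); ([:: 8; 9; 10], [:: 13]);
  ([:: 8; 9], [:: 7; 13]); ([:: 7; 9], [:: 6; 13]); ([:: 1; 9], [:: 11; 10])]%N);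
  by [|vm_compute].
Qed.

Lemma two_bladed_triangulable (R : realType) : triangulable_with R (saw_blade R 2) 9.
Proof.
apply: (@flips_triangulable R 2 2 17 [:: ([:: 0; 1; 12], [:: 13]);
  ([:: 1; 12], [:: 2; 13]); ([:: 0; 12], [:: 11; 13]); ([:: 11; 13; 12], [:: 14]);
  ([:: 13; 12], [:: 2; 14]); ([:: 2; 12], [:: 3; 14]); ([:: 3; 12], [:: 4; 14]);
  ([:: 9; 10; 12], [:: 15]); ([:: 9; 12], [:: 8; 15]); ([:: 7; 8; 12], [:: 16]);
  ([:: 7; 12], [:: 6; 16]); ([:: 6; 12], [:: 5; 16]); ([:: 8; 12], [:: 15; 16])]%N);
  by [|vm_compute].
Qed.

(** * Saw blades with at least three blades *)

Section ManyBlades.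
Variable N : nat.

Definition hub_facets : seq (seq nat) :=
  [:: [:: N; 0; 1]; [:: N; 1; N + 1]; [:: 1; 2; N + 1]]%N.

Definition blade_facets (m : nat) : seq (seq nat) :=
  [:: [:: 3 * m + 2; N + 2 * m + 1; N + 2 * m + 2];
      [:: N; N + 2 * m + 1; N + 2 * m + 2];
      [:: 3 * m + 3; N + 2 * m + 2; 3 * m + 2];
      [:: 3 * m + 4; N + 2 * m + 2; N + 2 * m + 3];
      [:: N; N + 2 * m + 2; N + 2 * m + 3];
      [:: 3 * m + 4; 3 * m + 5; N + 2 * m + 3];
      [:: 3 * m + 3; 3 * m + 4; N + 2 * m + 2]]%N.

Definition finished (m : nat) (f : seq nat) : Prop :=
  f \in hub_facets \/ exists2 i, (i < m)%N & f \in blade_facets i.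

Definition unfinished (l : nat) (f : seq nat) : Prop :=
  exists2 j, (l <= j < N)%N & f = [:: N; j; j.+1 %% N]%N.

(* The triangulation of the disk once the first [m] blades are in place. *)
Definition stage (m : nat) (f : seq nat) : Prop :=
  [\/ finished m f, f = [:: N; 3 * m + 2; N + 2 * m + 1]%N
    | unfinished (3 * m + 2) f].

Definition window (m v : nat) : nat :=
  nth 0 [:: N; N + 2 * m + 1; 3 * m + 2; 3 * m + 3; 3 * m + 4; 3 * m + 5;
            N + 2 * m + 2; N + 2 * m + 3]%N v.

Lemma window_inj m : (3 * m + 5 < N)%N -> {in gtn 8 &, injective (window m)}.
Proof.
move=> mN u v; rewrite !inE => u8 v8 /eqP; rewrite nth_uniq //; first by move/eqP.
by rewrite /= !inE; lia.
Qed.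

Lemma hub_vertex f v : f \in hub_facets -> v \in f ->
  (v \in [:: 0; 1; 2; N; N + 1] /\ (N \in f -> (v < N)%N -> v < 2))%N.
Proof.
by rewrite !inE => /or3P[]/eqP ->; rewrite !inE; lia.
Qed.

Lemma blade_vertex m f v : (3 * m + 5 < N)%N -> f \in blade_facets m -> v \in f ->
  (3 * m + 2 <= v <= 3 * m + 5 \/ v = N \/ N + 2 * m + 1 <= v <= N + 2 * m + 3)%N
  /\ (N \in f -> N <= v)%N.
Proof.
by move=> mN; rewrite !inE; do ?case/orP; move=> /eqP ->; rewrite !inE; lia.
Qed.

Lemma unfinished_vertex l f v : (0 < N)%N -> unfinished l f -> v \in f ->
  (v = 0 \/ l <= v <= N)%N.
Proof.
move=> N0 [j jN ->]; rewrite !inE => /or3P[]/eqP ->; try lia.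
have [E|E] := ltnP j.+1 N; first by rewrite modn_small //; lia.
by have -> : j.+1 = N by [lia]; rewrite modnn; left.
Qed.

Definition remaining (m : nat) (f : seq nat) : Prop :=
  finished m f \/ unfinished (3 * m + 5) f.

Lemma remaining_vertex m f : (3 * m + 5 < N)%N -> remaining m f ->
  [/\ 3 * m + 3 \notin f, 3 * m + 4 \notin f, N + 2 * m + 2 \notin f,
      N + 2 * m + 3 \notin f & (N \notin f) || (3 * m + 2 \notin f)]%N.
Proof.
move=> mN fR.
suff H v : v \in f -> [/\ v != 3 * m + 3, v != 3 * m + 4, v != N + 2 * m + 2,
    v != N + 2 * m + 3 & (N \in f) ==> (v != 3 * m + 2)]%N.
  split; try (by apply/negP => /H[]; rewrite ?eqxx).
  by rewrite -implybE; apply/implyP => Nf; apply/negP => /H[_ _ _ _]; rewrite Nf eqxx.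
move=> vf; case: fR => [[fh|[i im fb]]|fu].
- have [+ h] := hub_vertex fh vf; rewrite !inE => vE.
  by split; try lia; apply/implyP => /h; lia.
- have [|vE h] := blade_vertex _ fb vf; first by lia.
  by split; try lia; apply/implyP => /h; lia.
- have [|vE|vE] := unfinished_vertex _ fu vf; first by lia.
    by split; try lia; apply/implyP => _; lia.
  by split; try lia; apply/implyP => _; lia.
Qed.

Definition window_facets : seq (seq nat) :=
  [:: [:: 0; 2; 1]; [:: 0; 2; 3]; [:: 0; 3; 4]; [:: 0; 4; 5]]%N.

Definition blade_moves : seq (seq nat * seq nat) :=
  [:: ([:: 0; 3; 4], [:: 6]); ([:: 0; 4; 5], [:: 7]); ([:: 0; 4], [:: 6; 7]);
      ([:: 0; 3], [:: 6; 2]); ([:: 0; 2], [:: 1; 6])]%N.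

Lemma stage_window m f : (3 * m + 5 < N)%N ->
  stage m f <-> patched (window m) window_facets (remaining m) f.
Proof.
move=> mN; split.
  case=> [ff|->|[j jN ->]]; first by right; left.
    by left; exists [:: 0; 2; 1]%N.
  have [j5|j5] := leqP (3 * m + 5) j.
    by right; right; exists j; rewrite // j5; case/andP: jN.
  have jE : [|| j == 3 * m + 2, j == 3 * m + 3 | j == 3 * m + 4]%N by lia.
  left; case/or3P: jE => /eqP ->; rewrite modn_small; try lia.
  - by exists [:: 0; 2; 3]%N => //; rewrite /window /= -addnS.
  - by exists [:: 0; 3; 4]%N => //; rewrite /window /= -addnS.
  - by exists [:: 0; 4; 5]%N => //; rewrite /window /= -addnS.
have seg j : (3 * m + 2 <= j < 3 * m + 5)%N -> unfinished (3 * m + 2) [:: N; j; j.+1]%N.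
  by move=> jm; exists j; rewrite ?modn_small //; lia.
case=> [[g + ->]|[ff|[j jN ->]]]; last 2 first.
- by constructor 1.
- by constructor 3; exists j => //; lia.
rewrite !inE => /or4P[]/eqP ->; rewrite /window /=; first by constructor 2.
- constructor 3; rewrite (_ : 3 * m + 3 = (3 * m + 2).+1)%N; [apply: seg; lia|lia].
- constructor 3; rewrite (_ : 3 * m + 4 = (3 * m + 3).+1)%N; [apply: seg; lia|lia].
- constructor 3; rewrite (_ : 3 * m + 5 = (3 * m + 4).+1)%N; [apply: seg; lia|lia].
Qed.

Lemma stage_next m f : 
  (stage m.+1 f -> exists2 f', patched (window m) (foldl flip window_facets blade_moves)
    (remaining m) f' & {subset f <= f'}) /\
  (patched (window m) (foldl flip window_facets blade_moves) (remaining m) f ->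
    exists2 f', stage m.+1 f' & {subset f <= f'}).
Proof.
have fE : foldl flip window_facets blade_moves = 
  [:: [:: 2; 1; 6]; [:: 0; 1; 6]; [:: 3; 6; 2]; [:: 4; 6; 7]; [:: 0; 6; 7];
      [:: 4; 5; 7]; [:: 0; 5; 7]; [:: 3; 4; 6]]%N by vm_compute.
have bE : blade_facets m = map (map (window m)) (rem [:: 0; 5; 7]%N
  (foldl flip window_facets blade_moves)) by rewrite fE.
have m5 : (3 * m.+1 + 2 = 3 * m + 5)%N by lia.
have m3 : (N + 2 * m.+1 + 1 = N + 2 * m + 3)%N by lia.
split.
  case=> [[fh|[i]]|->|].
  - by exists f => //; right; left; left.
  - rewrite ltnS leq_eqVlt => /predU1P[->|im] fb; exists f => //.
      move: fb; rewrite bE => /mapP[g gL ->]; left; exists g => //.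
      exact: mem_rem gL.
    by right; left; right; exists i.
  - exists [:: N; 3 * m.+1 + 2; N + 2 * m.+1 + 1]%N => //; left.
    by exists [:: 0; 5; 7]%N; [rewrite fE|rewrite m5 m3].
  - by rewrite m5 => fu; exists f => //; right; right.
case=> [[g gL ->]|[[fh|[i im fb]]|fu]].
- exists (map (window m) g) => //; have [->|g057] := eqVneq g [:: 0; 5; 7]%N.
    by constructor 2; rewrite m5 m3.
  constructor 1; right; exists m => //; rewrite bE map_f // mem_rem_uniq ?fE //.
  by rewrite inE g057 -fE.
- by exists f => //; constructor 1; left.
- by exists f => //; constructor 1; right; exists i => //; apply: leqW.
- by exists f => //; constructor 3; rewrite m5.
Qed.

Lemma blade_moves_remaining m e g : (3 * m + 5 < N)%N -> e \in blade_moves ->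
  remaining m g -> (exists2 a, a \in e.1 & window m a \notin g) /\
                   (exists2 b, b \in e.2 & window m b \notin g).
Proof.
move=> mN eb /(remaining_vertex mN)[g3 g4 g6 g7 g02].
have [a ag a02] : exists2 a, a \in [:: 0; 2]%N & window m a \notin g.
  by case/orP: g02 => ?; [exists 0%N|exists 2%N].
move: eb; rewrite !inE => /or4P[|||/orP[]] /eqP -> /=; split.
- by exists 3%N.
- by exists 6%N.
- by exists 4%N.
- by exists 7%N.
- by exists 4%N.
- by exists 6%N.
- by exists 3%N.
- by exists 6%N.
- by exists a.
- by exists 6%N.
Qed.

End ManyBlades.

Section ManyBladesChart.
Context {R : realType} (k : nat).
Hypotheses (k0 : (0 < k)%N) (k3 : (3 <= k)%N).

Local Notation N := (3 * k)%N.
Local Notation M := (N + 2 * k)%N.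

Let NE : (1 * size (saw_blade_word k) = N)%N.
Proof. by rewrite mul1n size_saw_blade_word. Qed.

Lemma stage_chart m : (m < k)%N -> @disk_chart R k 1 k0 M (stage N m).
Proof.
elim: m => [_|m IH mk].
  pose r v := nth 0%N [:: N; 1; 2; N + 1]%N v.
  pose rest f := exists2 j, (j < N)%N /\ j <> 1%N & f = [:: N; j; j.+1 %% N]%N.
  have : @disk_chart R k 1 k0 M (patched r [:: [:: 0; 1; 2]]%N rest).
    have : @disk_chart R k 1 k0 M (fan k 1).
      apply: disk_chart_widen (fan_chart k0 (ltn0Sn 0)); first by rewrite NE; lia.
      by move=> f v [j + ->]; rewrite !inE NE => jN /or3P[]/eqP -> //; lia.
    apply: disk_chart_equiv => f.
      move=> [j + ->]; rewrite NE => jN; exists [:: N; j; j.+1 %% N]%N => //.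
      have [->|j1] := eqVneq j 1%N; last by right; exists j => //; split=> //; exact/eqP.
      by left; exists [:: 0; 1; 2]%N => //; rewrite /r /= modn_small //; lia.
    case=> [[g + ->]|[j [jN j1] ->]].
      rewrite inE => /eqP ->; exists [:: N; 1; 2]%N => //; exists 1%N; rewrite NE; first by lia.
      by rewrite modn_small //; lia.
    by exists [:: N; j; j.+1 %% N]%N => //; exists j; rewrite NE.
  move/(@flips_chart 0 4 M r rest _ _ R k 1 k0 (ltn0Sn 0) [:: [:: 0; 1; 2]]%N
    [:: ([:: 0; 1; 2], [:: 3])]%N).
  have -> : foldl flip [:: [:: 0; 1; 2]]%N [:: ([:: 0; 1; 2], [:: 3])]%N =
    [:: [:: 1; 2; 3]; [:: 0; 2; 3]; [:: 0; 1; 3]]%N by vm_compute.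
  move=> dc; suff : @disk_chart R k 1 k0 M
      (patched r [:: [:: 1; 2; 3]; [:: 0; 2; 3]; [:: 0; 1; 3]]%N rest).
    apply: disk_chart_equiv => f.
      move=> fP; exists f => //; case: fP => [[g + ->]|[j [jN j1] ->]].
        rewrite !inE => /or3P[]/eqP ->; rewrite /r /=.
        - by constructor 1; left; rewrite !inE eqxx !orbT.
        - by constructor 2; rewrite !muln0 !add0n addn0.
        - by constructor 1; left; rewrite !inE eqxx !orbT.
      have [->|j0] := eqVneq j 0%N.
        by constructor 1; left; rewrite modn_small ?inE ?eqxx //; lia.
      by constructor 3; exists j => //; lia.
    move=> fP; exists f => //; case: fP => [[|[]//]|->|[j jN ->]].
    - rewrite !inE => /or3P[]/eqP ->.
      + right; exists 0%N; first by split => //; lia.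
        by rewrite modn_small //; lia.
      + by left; exists [:: 0; 1; 3]%N.
      + by left; exists [:: 1; 2; 3]%N.
    - by left; exists [:: 0; 2; 3]%N => //; rewrite /r /= !muln0 !add0n addn0.
    - by right; exists j => //; lia.
  apply: dc => //.
  - move=> u v; rewrite !inE => u4 v4 /eqP; rewrite nth_uniq //; first by move/eqP.
    by rewrite /= !inE; lia.
  - by case=> [|[|[|[|]]]] //= _; rewrite /r /=; lia.
  - by rewrite NE.
  - move=> e g; rewrite inE => /eqP -> /= [j [jN j1] ->]; split.
      have [->|j2] := eqVneq j 2%N.
        exists 1%N => //; rewrite /r !inE /=.
        by have := succ_modE (_ : 3 <= N)%N (_ : 2 < N)%N; lia.
      exists 2%N => //; rewrite /r !inE /=.
      by have := @succ_modE N _ j jN; lia.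
    exists 3%N => //; rewrite /r !inE /=.
    by have := @succ_modE N _ j jN; lia.
have mN : (3 * m + 5 < N)%N by lia.
apply: disk_chart_equiv (fun f => (stage_next N m f).2) (fun f => (stage_next N m f).1) _.
apply: (@flips_chart 0 8 M (window N m)) => //.
- exact: window_inj.
- by case=> [|[|[|[|[|[|[|[|]]]]]]]] //= _; rewrite /window /=; lia.
- by rewrite NE.
- by move=> e g eb; exact: blade_moves_remaining.
apply: disk_chart_equiv (IH (ltnW mk)) => f fP; exists f => //.
  by apply/stage_window.
by apply/stage_window.
Qed.

End ManyBladesChart.

Section ManyBladesLabels.
Variable p : nat.
Hypothesis p2 : (2 <= p)%N.

Local Notation k := p.+1.
Local Notation N := (3 * k)%N.
Local Notation M := (N + 2 * k)%N.

Lemma stage_last f : stage N p f ->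
  [\/ f \in hub_facets N, exists2 i, (i < p)%N & f \in blade_facets N i,
      f = [:: N; 3 * p + 2; N + 2 * p + 1]%N | f = [:: N; 3 * p + 2; 0]%N].
Proof.
case=> [[fh|fb]|->|[j jN ->]]; [by constructor 1|by constructor 2|by constructor 3|].
have -> : j = (3 * p + 2)%N by lia.
by constructor 4; rewrite (_ : (3 * p + 2).+1 = N)%N ?modnn //; lia.
Qed.

Lemma stage_link f u v : stage N p f -> u \in f -> v \in f -> (N <= u)%N -> (v < N)%N ->
  (u = N /\ v = 3 * p + 2 \/ 2 * v <= 3 * (u - N) + 2 /\ 3 * (u - N) <= 2 * v + 2)%N.
Proof.
case/stage_last=> [|[i ip]|->|->].
- by rewrite !inE => /or3P[]/eqP ->; rewrite !inE; clear; lia.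
- by rewrite !inE; do ?case/orP; move=> /eqP ->; rewrite !inE; clear -ip; lia.
- by rewrite !inE; clear; lia.
- by rewrite !inE; clear; lia.
Qed.

Lemma zigd1E v : zigd 1 v = (v %/ 3 + (v %% 3 == 1))%N.
Proof.
have := zigdE v (ltn0Sn 0); rewrite mul1n addn0 => ->.
by rewrite mul1n; case: (_ == _).
Qed.

Lemma eqmod_cases a b : (a <= k)%N -> (b <= k)%N -> a = b %[mod k] ->
  [\/ a = b, a = 0 /\ b = k | a = k /\ b = 0]%N.
Proof.
rewrite leq_eqVlt => /predU1P[->|ak]; rewrite leq_eqVlt => /predU1P[->|bk].
- by constructor 1.
- by rewrite modnn modn_small // => <-; constructor 3.
- by rewrite modnn modn_small // => ->; constructor 2.
- by rewrite !modn_small // => ->; constructor 1.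
Qed.

Lemma link_labels t v v' : (v < N)%N -> (v' < N)%N ->
  (t = 0 /\ v = 3 * p + 2 \/ 2 * v <= 3 * t + 2 /\ 3 * t <= 2 * v + 2)%N ->
  (t = 0 /\ v' = 3 * p + 2 \/ 2 * v' <= 3 * t + 2 /\ 3 * t <= 2 * v' + 2)%N ->
  zigd 1 v = zigd 1 v' %[mod k] -> v = v'.
Proof.
move=> vN vN' vt vt'; rewrite !zigd1E => E.
have bound u : (u < N)%N -> (u %/ 3 + (u %% 3 == 1) <= k)%N by lia.
have := eqmod_cases (bound v vN) (bound v' vN') E; clear -p2 vN vN' vt vt'.
by case=> [?|[? ?]|[? ?]]; lia.
Qed.

Lemma stage_labelled : labelled k 1 M (stage N p).
Proof.
rewrite /labelled mul1n muln1 size_saw_blade_word; split.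
- move=> f v /stage_last[|[i ip]|->|->].
  + by rewrite !inE => /or3P[]/eqP ->; rewrite !inE; clear; lia.
  + by rewrite !inE; do ?case/orP; move=> /eqP ->; rewrite !inE; clear -ip; lia.
  + by rewrite !inE; clear; lia.
  + by rewrite !inE; clear; lia.
- move=> f /stage_last[|[i ip]|->|->].
  + rewrite !inE => /or3P[]/eqP ->; [exists N|exists N|exists (N + 1)%N];
      rewrite ?inE ?eqxx ?orbT ?leq_addr //.
  + rewrite !inE; do ?case/orP; move=> /eqP ->;
      [exists (N + 2 * i + 1)%N|exists N|exists (N + 2 * i + 2)%N|
       exists (N + 2 * i + 3)%N|exists N|exists (N + 2 * i + 3)%N|
       exists (N + 2 * i + 2)%N]; rewrite ?inE ?eqxx ?orbT -?addnA ?leq_addr //.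
  + by exists N; rewrite ?inE ?eqxx.
  + by exists N; rewrite ?inE ?eqxx.
- move=> f /stage_last fP.
  suff [j jN fj] : exists2 j, (j < N)%N & forall v, v \in f -> (v < N)%N ->
      v = j \/ v = j.+1 \/ v = 0%N /\ j.+1 = N.
    exists j => // v vf vN; have [->|[vj|[-> ->]]] := fj v vf vN; first by left.
      by right; rewrite -vj modn_small.
    by right; rewrite modnn.
  case: fP => [|[i ip]|->|->].
  + by rewrite !inE => /or3P[]/eqP ->; [exists 0%N|exists 0%N|exists 1%N];
      try (move=> v; rewrite !inE); clear -p2; lia.
  + by rewrite !inE; do ?case/orP; move=> /eqP ->;
      [exists (3 * i + 2)%N|exists 0%N|exists (3 * i + 2)%N|exists (3 * i + 4)%N|
       exists 0%N|exists (3 * i + 4)%N|exists (3 * i + 3)%N];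
      try (move=> v; rewrite !inE); clear -p2 ip; lia.
  + by exists (3 * p + 2)%N => [|v]; rewrite ?inE; clear; lia.
  + by exists (3 * p + 2)%N => [|v]; rewrite ?inE; clear; lia.
- move=> f f' u v v' fP fP' uf uf' Nu vf vf' vN vN'.
  have := stage_link fP uf vf Nu vN; have := stage_link fP' uf' vf' Nu vN'.
  move=> h' h; apply: (@link_labels (u - N)) => //.
    by case: h => [[-> ->]|]; [left; rewrite subnn|right].
  by case: h' => [[-> ->]|]; [left; rewrite subnn|right].
- move=> u /andP[Nu uM]; have [i [ip uE]] : exists i, (i < k)%N /\
      (u = N + 2 * i \/ u = N + 2 * i + 1)%N.
    by exists ((u - N) %/ 2)%N; lia.
  case: uE => ->; last first.
    move: ip; rewrite ltnS leq_eqVlt => /predU1P[->|ip].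
      exists [:: N; 3 * p + 2; N + 2 * p + 1]%N; last by rewrite !inE eqxx !orbT.
      by constructor 2.
    exists [:: N; N + 2 * i + 1; N + 2 * i + 2]%N; last by rewrite !inE eqxx orbT.
    by constructor 1; right; exists i; rewrite // !inE eqxx orbT.
  case: i ip => [|i] ip.
    exists [:: N; 0; 1]%N; last by rewrite muln0 addn0 !inE eqxx.
    by constructor 1; left; rewrite inE eqxx.
  exists [:: N; N + 2 * i + 1; N + 2 * i + 2]%N.
    by constructor 1; right; exists i; rewrite // !inE eqxx orbT.
  by rewrite !inE; clear; lia.
Qed.

End ManyBladesLabels.

Lemma many_bladed_triangulable (R : realType) (k : nat) : (3 <= k)%N ->
  triangulable_with R (saw_blade R k) (3 * k).
Proof.
case: k => // p p2; have k0 : (0 < p.+1)%N by [].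
have kd3 : (3 <= p.+1 * 1)%N by rewrite muln1.
have := @triangulable_labelled R p.+1 1 k0 (ltn0Sn 0) kd3 _ _ _ (stage_labelled p2)
  (stage_chart k0 p2 (ltnSn p)).
rewrite mul1n muln1 size_saw_blade_word addKn leq_addr => /(_ isT).
by rewrite -[X in (X + _)%N]mul1n -mulnDl.
Qed.

Local Close Scope ring_scope.
Local Close Scope classical_set_scope.

Theorem theorem11 (R : realType) :
  [/\ triangulable_with R (saw_blade R 1) 8,
      triangulable_with R (saw_blade R 2) 9,
      (forall k : nat, (3 <= k)%N ->
         triangulable_with R (saw_blade R k) (3 * k)%N)
    & (forall k : nat, (1 <= k)%N ->
       forall (V : finType) (K : {set {set V}}),
         triangulates R K (saw_blade R k) ->
         contractible R (realization R K) /\ ~~ collapsible K)].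
Proof.
split.
- exact: dunce_hat_triangulable.
- exact: two_bladed_triangulable.
- by move=> k k3; exact: many_bladed_triangulable.
- by move=> k k1 V K; exact: triangulation_contractible_not_collapsible.
Qed.
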